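(* Let $\alpha\in\left[\frac12,2\right)$. Then $M_{\alpha,1-\alpha}\subset\mathcal{G}$. Moreover, if $\frac12\le\alpha\le1$, then: (i) each $f\in M_{\alpha,1-\alpha}$ generates a semigroup $\{F_t\}_{t\ge0}$ of holomorphic self-mappings of $\mathbb{D}$ that satisfies $$|F_t(z)|\le e^{\frac{1-2\alpha}{2\alpha}t}|z|,\qquad z\in\mathbb{D},\ t>0;$$ (ii) the family $\{M_{\alpha,1-\alpha}\}_{\alpha\in[\frac12,1]}$ is a filtration of $\mathcal{G}$ that satisfies $M_{1,0}=\mathcal{A}_{\frac12}\subsetneq\mathcal{G}$ and $$\sup_{f\in M_{\alpha,1-\alpha}}|\Phi(f,\lambda)|=\max\left(\frac{1}{2-\alpha},\,|1-\lambda|\right)\quad\text{for all }\lambda\in\mathbb{C}.$$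
   Context: $\mathbb{D}$ is the open unit disk in $\mathbb{C}$. $\mathcal{A}$ is the set of holomorphic functions $f:\mathbb{D}\to\mathbb{C}$ with $f(0)=0$, $f'(0)=1$. $\mathcal{G}$ is the set of $f\in\mathcal{A}$ with $\operatorname{Re}\frac{f(z)}{z}>0$ for all $z\in\mathbb{D}$; $\mathcal{A}_{\frac12}$ is the set of $f\in\mathcal{A}$ with $\operatorname{Re}\frac{f(z)}{z}>\frac12$ for all $z\in\mathbb{D}$. A holomorphic $f:\mathbb{D}\to\mathbb{C}$ generates a semigroup $\{F_t\}_{t\ge0}$ if for every $z\in\mathbb{D}$ the Cauchy problem $\frac{\partial u(t,z)}{\partial t}+f(u(t,z))=0$, $u(0,z)=z$, has a unique solution $u(t,z)\in\mathbb{D}$ for all $t\ge0$; then $F_t(z)=u(t,z)$. The elements of $\mathcal{G}$ are exactly the functions in $\mathcal{A}$ with this property. A filtration of $\mathcal{G}$ is a family $\{\mathfrak{F}_s\}_{s\in[a,b]}$ of subsets $\mathfrak{F}_s\subseteq\mathcal{G}$, with $a,b\in[-\infty,+\infty]$, $a<b$, such that $\mathfrak{F}_s\subseteq\mathfrak{F}_t$ whenever $a\le s\le t\le b$. For $f(z)=z+\sum_{k\ge2}f_kz^k\in\mathcal{A}$ and $\lambda\in\mathbb{C}$, $\Phi(f,\lambda)=f_3-\lambda f_2^2$. For real $\alpha<2$, $$M_{\alpha,1-\alpha}=\left\{f\in\mathcal{A}:\ \operatorname{Re}\left[\alpha\frac{f(z)}{z}+(1-\alpha)\frac{zf'(z)}{f(z)}\right]>\frac12\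 \text{ for all } z\in\mathbb{D}\right\},$$ where $f(z)/z$ and $zf'(z)/f(z)$ have value $1$ at $z=0$, a term with zero coefficient is omitted, and the expression is required to be well defined on $\mathbb{D}$, i.e. $f(z)\ne0$ for $z\in\mathbb{D}\setminus\{0\}$ if $\alpha\ne1$. *)

(* Defs.v *)
From Stdlib Require Export Reals.
From Coquelicot Require Export Coquelicot.

Open Scope R_scope.

(** Functions on the unit disk are represented by total functions [C -> C];
    every notion below only depends on their values in the disk. *)

Definition in_disk (z : C) : Prop := Cmod z < 1.

Definition holomorphic_on_disk (f : C -> C) : Prop :=
  forall z : C, in_disk z -> @ex_derive C_AbsRing C_NormedModule f z.

Definition class_A (f : C -> C) : Prop :=
  holomorphic_on_disk f /\ f (RtoC 0) = RtoC 0 /\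
  @is_derive C_AbsRing C_NormedModule f (RtoC 0) (RtoC 1).

(** [f(z)/z] and [z f'(z)/f(z)], extended by 1 at the origin. *)
Definition f_over_z (f : C -> C) (z : C) : C :=
  if Ceq_dec z (RtoC 0) then RtoC 1 else (f z / z)%C.

Definition zf'_over_f (f : C -> C) (z : C) : C :=
  if Ceq_dec z (RtoC 0) then RtoC 1 else (z * C_derive f z / f z)%C.

Definition class_G (f : C -> C) : Prop :=
  class_A f /\ forall z : C, in_disk z -> 0 < Re (f_over_z f z).

Definition class_A_half (f : C -> C) : Prop :=
  class_A f /\ forall z : C, in_disk z -> 1 / 2 < Re (f_over_z f z).

(** The class M_{alpha, 1 - alpha}.  For [alpha = 1] the second term vanishes
    since division is total, so it is indeed omitted even where [f z = 0]. *)
Definition class_M (alpha : R) (f : C -> C) : Prop :=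
  class_A f /\
  (alpha <> 1 -> forall z : C, in_disk z -> z <> RtoC 0 -> f z <> RtoC 0) /\
  forall z : C, in_disk z ->
    1 / 2 < Re (RtoC alpha * f_over_z f z
                + RtoC (1 - alpha) * zf'_over_f f z)%C.

(** Derivative of [u : [0, +oo) -> C] at [t]: two-sided for [t > 0], and the
    right derivative for [t = 0]. *)
Definition is_derive_ge0 (u : R -> C) (t : R) (l : C) : Prop :=
  @filterdiff R_AbsRing R_NormedModule C_R_NormedModule
    u (within (fun s : R => 0 <= s) (locally t))
    (fun h : R => @scal R_AbsRing C_R_NormedModule h l).

Definition cauchy_solution (f : C -> C) (z : C) (u : R -> C) : Prop :=
  u 0 = z /\
  forall t : R, 0 <= t -> in_disk (u t) /\ is_derive_ge0 u t (- f (u t))%C.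

(** [f] generates [F]: for every [z] in the disk, [t |-> F t z] is the unique
    solution of the Cauchy problem. *)
Definition generates (f : C -> C) (F : R -> C -> C) : Prop :=
  forall z : C, in_disk z ->
    cauchy_solution f z (fun t : R => F t z) /\
    forall v : R -> C, cauchy_solution f z v ->
      forall t : R, 0 <= t -> v t = F t z.

Definition semigroup_of_self_maps (F : R -> C -> C) : Prop :=
  (forall t : R, 0 <= t ->
     holomorphic_on_disk (F t) /\
     forall z : C, in_disk z -> in_disk (F t z)) /\
  (forall z : C, in_disk z -> F 0 z = z) /\
  (forall (s t : R) (z : C), 0 <= s -> 0 <= t -> in_disk z ->
     F (s + t) z = F s (F t z)) /\
  (forall z : C, in_disk z ->
     filterlim (fun t : R => F t z) (at_right 0) (@locally C_UniformSpace z)).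

Definition is_filtration_of_G (a b : Rbar) (F : Rbar -> (C -> C) -> Prop) : Prop :=
  Rbar_lt a b /\
  (forall s : Rbar, Rbar_le a s -> Rbar_le s b ->
     forall f : C -> C, F s f -> class_G f) /\
  (forall s t : Rbar, Rbar_le a s -> Rbar_le s t -> Rbar_le t b ->
     forall f : C -> C, F s f -> F t f).

(** [f(z) = sum_k c_k z^k] on the disk. *)
Definition taylor_coefficients (f : C -> C) (c : nat -> C) : Prop :=
  forall z : C, in_disk z -> @is_pseries C_AbsRing C_NormedModule c z (f z).

(** The Fekete-Szego functional, on the coefficient sequence of [f]. *)
Definition Phi (c : nat -> C) (lambda : C) : C :=
  (c 3%nat - lambda * (c 2%nat * c 2%nat))%C.

(* Main.v *)
Require Import Defs.
From Stdlib Require Import Reals.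
From Coquelicot Require Import Coquelicot.
From Stdlib Require Import Lra Lia ClassicalEpsilon.

(** Write [p = f / z] and [q = alpha p + (1 - alpha) (1 + z p' / p)], so that the
    class [M_(alpha, 1 - alpha)] is given by [Re q > 1 / 2].

    Inclusions. If [Re p] takes a value at most [c < 1], let [z0] be a point of least
    modulus with [Re p = c] ([first_touch]). Then [z0 p'(z0)] is real and nonpositive,
    hence [Re q] at [z0] is at most [alpha c + 1 - alpha] if [alpha <= 1] or [c = 0].
    For [alpha >= 1 / 2] this contradicts [Re q > 1 / 2] when [c = 0], and also when
    [alpha <= 1] and [c = (2 alpha - 1) / (2 alpha)] ([class_M_Re_gt]). For
    [c = 1 / 2] the Schwarz lemma applied to [(p - 1) / p] sharpens the sign of
    [z0 p'(z0)] ([jack_half]) and gives [Re p > 1 / 2] on the whole disk when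
    [1 / 2 <= alpha <= 1] ([class_M_sub_half]). Monotonicity in [alpha] follows,
    because [q] for a larger [alpha] is a convex combination of [q] and [p].

    Semigroup. With [u = z exp (- v)] the Cauchy problem [u' = - f u] becomes
    [v' = p (z exp (- v))], whose right-hand side has real part at least
    [c = (2 alpha - 1) / (2 alpha)]. Hence [Re v >= c t], the solution never leaves the
    disk of radius [|z|], where [p] is Lipschitz, it exists for all times, and
    [|u| <= exp (- c t) |z|] ([picard_lindelof], [flow_exists]).
    Uniqueness comes from Gronwall's inequality, and gives the semigroup law;
    holomorphy in [z] comes from comparison with the linearized equation
    ([flow_holomorphic]).

    Fekete-Szego functional. The function [(q - 1) / q] is bounded by [1] and has the
    expansion [c2 z + (2 - alpha) (c3 - c2^2) z^2 + ...], so that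
    [(2 - alpha) |c3 - c2^2| <= 1 - |c2|^2] ([schwarz_coefficients]); this gives the
    upper bound. The value [|1 - lambda|] is attained by [z / (1 - z)]. The value
    [1 / (2 - alpha)] corresponds to [q = 1 / (1 - z^2)], that is to [p = 1 / u] for a
    power series [u] in [z^2] solving a linear equation; truncations and dilations of
    [u] give functions of the class whose functional approaches it ([extremal_odd]).

    All this rests on function theory for functions that are only assumed to be
    complex differentiable at each point. Goursat's theorem on rectangles, read in the
    coordinate [log w], gives the mean value property on circles, even for functions
    that merely have a limit at the centre ([mean_value]). Applied to difference
    quotients it shows that derivatives are holomorphic, and Lipschitz on smaller disks
    ([hol_deriv]); combined with a quadratic perturbation it gives the maximum principle
    ([max_principle]), hence the Schwarz lemma and Taylor expansions
    ([hol_taylor]). *)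

(** * Moduli, continuity and differentiability in the plane *)

Lemma Cmod_minus_sym : forall a b : C, Cmod (a - b) = Cmod (b - a).
Proof. intros a b. rewrite <- (Cmod_opp (a - b)). f_equal. ring. Qed.

Lemma Cmod_minus_triangle : forall a b c : C,
  Cmod (a - c) <= Cmod (a - b) + Cmod (b - c).
Proof.
  intros a b c. replace (a - c)%C with ((a - b) + (b - c))%C by ring.
  apply Cmod_triangle.
Qed.

Lemma Cmod_diag : forall z : C, Cmod (z - z) = 0.
Proof. intros z. replace (z - z)%C with (RtoC 0) by ring. apply Cmod_0. Qed.

Lemma Cminus_neq_0 : forall w z : C, w <> z -> (w - z)%C <> 0.
Proof. intros w z H K. apply H. rewrite <- (Cplus_0_l z), <- K. ring. Qed.

Lemma Cmod_triangle_sub : forall a b : C, Cmod (a - b) <= Cmod a + Cmod b.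
Proof.
  intros a b. rewrite <- (Cmod_opp b).
  replace (a - b)%C with (a + - b)%C by ring. apply Cmod_triangle.
Qed.

Lemma Cmod_triangle_inv : forall a b : C, Cmod a - Cmod b <= Cmod (a - b).
Proof.
  intros a b. pose proof (Cmod_triangle (a - b) b) as H.
  replace (a - b + b)%C with a in H by ring. lra.
Qed.

Lemma Re_le_Cmod : forall c : C, Re c <= Cmod c.
Proof.
  intros c. pose proof (re_le_Cmod c) as H. pose proof (Rle_abs (Re c)). lra.
Qed.

Lemma C_ext : forall a b : C, Re a = Re b -> Im a = Im b -> a = b.
Proof.
  intros [a1 a2] [b1 b2]; simpl; intros; subst; reflexivity.
Qed.

Lemma Cmod_le_Re_Im : forall c : C, Cmod c <= Rabs (Re c) + Rabs (Im c).
Proof.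
  intros c.
  replace c with (RtoC (Re c) + Ci * RtoC (Im c))%C at 1
    by (apply C_ext; destruct c; unfold Re, Im; simpl; ring).
  eapply Rle_trans; [apply Cmod_triangle|].
  rewrite Cmod_mult, Cmod_Ci, !Cmod_R. lra.
Qed.

Lemma im_le_Cmod : forall c : C, Rabs (Im c) <= Cmod c.
Proof.
  intros c. eapply Rle_trans; [|apply Rmax_Cmod]. apply Rmax_r.
Qed.

Lemma locally_Cmod : forall (z : C) (P : C -> Prop),
  @locally C_UniformSpace z P <-> exists d : R, 0 < d /\ forall w : C, Cmod (w - z) < d -> P w.
Proof.
  intros z P; split.
  - intros [d Hd]. exists d. split; [apply cond_pos|].
    intros w Hw. apply Hd. split.
    + change (Rabs (Re w - Re z) < d).
      replace (Re w - Re z) with (Re (w - z)%C) by (unfold Re, Im; simpl; ring).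
      eapply Rle_lt_trans; [apply re_le_Cmod|exact Hw].
    + change (Rabs (Im w - Im z) < d).
      replace (Im w - Im z) with (Im (w - z)%C) by (unfold Re, Im; simpl; ring).
      eapply Rle_lt_trans; [apply im_le_Cmod|exact Hw].
  - intros [d [Hd H]].
    assert (Hd2 : 0 < d / 2) by lra.
    exists (mkposreal _ Hd2). intros w [H1 H2].
    change (Rabs (Re w - Re z) < d / 2) in H1.
    change (Rabs (Im w - Im z) < d / 2) in H2.
    apply H. eapply Rle_lt_trans; [apply Cmod_le_Re_Im|].
    replace (Re (w - z)%C) with (Re w - Re z) by (unfold Re, Im; simpl; ring).
    replace (Im (w - z)%C) with (Im w - Im z) by (unfold Re, Im; simpl; ring). lra.
Qed.

Lemma locally_Rabs : forall (t : R) (P : R -> Prop),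
  locally t P <-> exists d : R, 0 < d /\ forall s : R, Rabs (s - t) < d -> P s.
Proof.
  intros t P; split.
  - intros [d Hd]. exists d. split; [apply cond_pos|]. intros s Hs. apply Hd. exact Hs.
  - intros [d [Hd H]]. exists (mkposreal d Hd). intros s Hs. apply H. exact Hs.
Qed.

(** Continuity measured by the modulus, for a variable in any uniform space: this
    treats functions on the plane and curves together. *)
Definition ccont {X : UniformSpace} (h : X -> C) (x : X) : Prop :=
  forall eps : R, 0 < eps -> locally x (fun y => Cmod (h y - h x) < eps).

Lemma Cmod_div_le : forall (a b : C) M, b <> 0 -> Cmod a <= M * Cmod b -> Cmod (a / b) <= M.
Proof.
  intros a b M Hb H. rewrite Cmod_div by exact Hb. apply Rle_div_l; [|exact H].
  apply Cmod_gt_0, Hb.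
Qed.

Section Continuity.
Context {X : UniformSpace}.
Implicit Types (g h : X -> C) (x : X).

Lemma ccont_const : forall c x, ccont (fun _ => c) x.
Proof.
  intros c x eps Heps. apply filter_forall. intros y.
  rewrite Cmod_diag. exact Heps.
Qed.

Lemma ccont_ext_loc : forall g h x,
  locally x (fun y => g y = h y) -> ccont g x -> ccont h x.
Proof.
  intros g h x He Hg eps Heps.
  pose proof (locally_singleton _ _ He) as Hx.
  generalize (filter_and _ _ He (Hg eps Heps)). apply filter_imp.
  intros y [H1 H2]. rewrite <- H1, <- Hx. exact H2.
Qed.

Lemma ccont_ext : forall g h x, (forall y, g y = h y) -> ccont g x -> ccont h x.
Proof.
  intros g h x He. apply ccont_ext_loc. apply filter_forall. exact He.
Qed.

Lemma ccont_plus : forall g h x,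
  ccont g x -> ccont h x -> ccont (fun y => (g y + h y)%C) x.
Proof.
  intros g h x Hg Hh eps Heps.
  assert (H2 : 0 < eps / 2) by lra.
  generalize (filter_and _ _ (Hg _ H2) (Hh _ H2)). apply filter_imp.
  intros y [H3 H4].
  replace (g y + h y - (g x + h x))%C with ((g y - g x) + (h y - h x))%C by ring.
  eapply Rle_lt_trans; [apply Cmod_triangle|]. lra.
Qed.

Lemma ccont_opp : forall h x, ccont h x -> ccont (fun y => (- h y)%C) x.
Proof.
  intros h x Hh eps Heps. generalize (Hh _ Heps). apply filter_imp.
  intros y H. replace (- h y - - h x)%C with (- (h y - h x))%C by ring.
  rewrite Cmod_opp. exact H.
Qed.

Lemma ccont_minus : forall g h x,
  ccont g x -> ccont h x -> ccont (fun y => (g y - h y)%C) x.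
Proof. intros g h x Hg Hh. apply ccont_plus; [|apply ccont_opp]; assumption. Qed.

Lemma ccont_mult : forall g h x,
  ccont g x -> ccont h x -> ccont (fun y => (g y * h y)%C) x.
Proof.
  intros g h x Hg Hh eps Heps.
  set (A := 1 + Cmod (g x) + Cmod (h x)).
  pose proof (Cmod_ge_0 (g x)) as Pg. pose proof (Cmod_ge_0 (h x)) as Ph.
  assert (HA : 1 <= A) by (unfold A; lra).
  assert (H2 : 0 < Rmin 1 (eps / (2 * A))).
  { apply Rmin_case; [lra|]. apply Rdiv_lt_0_compat; lra. }
  generalize (filter_and _ _ (Hg _ H2) (Hh _ H2)). apply filter_imp.
  intros y [H3 H4].
  pose proof (Rmin_l 1 (eps / (2 * A))) as Q1. pose proof (Rmin_r 1 (eps / (2 * A))) as Q2.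
  set (m := Rmin 1 (eps / (2 * A))) in *.
  replace (g y * h y - g x * h x)%C
    with ((g y - g x) * (h y - h x) + (g y - g x) * h x + g x * (h y - h x))%C by ring.
  eapply Rle_lt_trans; [apply Cmod_triangle|].
  eapply Rle_lt_trans; [apply Rplus_le_compat_r, Cmod_triangle|].
  rewrite !Cmod_mult.
  pose proof (Cmod_ge_0 (g y - g x)) as P1. pose proof (Cmod_ge_0 (h y - h x)) as P2.
  assert (E : eps / (2 * A) * A = eps / 2) by (field; lra).
  assert (Q3 : m * A <= eps / 2) by (rewrite <- E; apply Rmult_le_compat_r; lra).
  assert (Cmod (g y - g x) * Cmod (h y - h x) <= m * 1) by (apply Rmult_le_compat; lra).
  assert (Cmod (g y - g x) * Cmod (h x) <= m * Cmod (h x)) by (apply Rmult_le_compat_r; lra).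
  assert (Cmod (g x) * Cmod (h y - h x) <= Cmod (g x) * m) by (apply Rmult_le_compat_l; lra).
  unfold A in Q3. nra.
Qed.

Lemma ccont_nonzero : forall h x, ccont h x -> h x <> 0 ->
  locally x (fun y => Cmod (h x) / 2 < Cmod (h y)).
Proof.
  intros h x Hh Hx. apply Cmod_gt_0 in Hx.
  assert (H2 : 0 < Cmod (h x) / 2) by lra.
  generalize (Hh _ H2). apply filter_imp. intros y H.
  pose proof (Cmod_triangle_inv (h x) (h y)) as Q. rewrite Cmod_minus_sym in Q. lra.
Qed.

Lemma ccont_inv : forall h x, ccont h x -> h x <> 0 -> ccont (fun y => (/ h y)%C) x.
Proof.
  intros h x Hh Hx eps Heps.
  pose proof (proj1 (Cmod_gt_0 _) Hx) as Px. set (A := Cmod (h x)) in *.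
  assert (H2 : 0 < eps * (A * A / 2)) by (apply Rmult_lt_0_compat; nra).
  generalize (filter_and _ _ (ccont_nonzero _ _ Hh Hx) (Hh _ H2)). apply filter_imp.
  intros y [H3 H4]. fold A in H3.
  assert (Hy : h y <> 0) by (apply Cmod_gt_0; lra).
  replace (/ h y - / h x)%C with (- (h y - h x) / (h y * h x))%C by (field; auto).
  rewrite Cmod_div by (apply Cmult_neq_0; assumption).
  rewrite Cmod_opp, Cmod_mult. fold A.
  apply Rmult_lt_reg_r with (Cmod (h y) * A); [nra|].
  unfold Rdiv. rewrite Rmult_assoc, Rinv_l by nra. rewrite Rmult_1_r.
  eapply Rlt_trans; [exact H4|].
  apply Rmult_lt_compat_l; [exact Heps|nra].
Qed.

Lemma ccont_div : forall g h x,
  ccont g x -> ccont h x -> h x <> 0 -> ccont (fun y => (g y / h y)%C) x.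
Proof. intros g h x Hg Hh Hx. apply ccont_mult; [|apply ccont_inv]; assumption. Qed.

Lemma ccont_comp : forall (g : C -> C) h x,
  @ccont C_UniformSpace g (h x) -> ccont h x -> ccont (fun y => g (h y)) x.
Proof.
  intros g h x Hg Hh eps Heps.
  destruct (proj1 (locally_Cmod _ _) (Hg eps Heps)) as [d [Hd H]].
  generalize (Hh d Hd). apply filter_imp. intros y Hy. apply H. exact Hy.
Qed.

Lemma ccont_Re : forall h x, ccont h x -> continuous (fun y => Re (h y)) x.
Proof.
  intros h x Hh. apply filterlim_locally. intros eps.
  generalize (Hh eps (cond_pos eps)). apply filter_imp. intros y Hy.
  change (Rabs (Re (h y) - Re (h x)) < eps).
  replace (Re (h y) - Re (h x)) with (Re (h y - h x)%C) by (unfold Re, Im; simpl; ring).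
  eapply Rle_lt_trans; [apply re_le_Cmod|exact Hy].
Qed.

Lemma ccont_Im : forall h x, ccont h x -> continuous (fun y => Im (h y)) x.
Proof.
  intros h x Hh. apply filterlim_locally. intros eps.
  generalize (Hh eps (cond_pos eps)). apply filter_imp. intros y Hy.
  change (Rabs (Im (h y) - Im (h x)) < eps).
  replace (Im (h y) - Im (h x)) with (Im (h y - h x)%C) by (unfold Re, Im; simpl; ring).
  eapply Rle_lt_trans; [apply im_le_Cmod|exact Hy].
Qed.

Lemma ccont_Cmod : forall h x, ccont h x -> continuous (fun y => Cmod (h y)) x.
Proof.
  intros h x Hh. apply filterlim_locally. intros eps.
  generalize (Hh eps (cond_pos eps)). apply filter_imp. intros y Hy.
  change (Rabs (Cmod (h y) - Cmod (h x)) < eps).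
  pose proof (Cmod_triangle_inv (h y) (h x)) as Q1.
  pose proof (Cmod_triangle_inv (h x) (h y)) as Q2. rewrite Cmod_minus_sym in Q2.
  apply Rabs_def1; lra.
Qed.

End Continuity.

Lemma ccont_id : forall z : C_UniformSpace, ccont (fun w => w) z.
Proof.
  intros z eps Heps. apply locally_Cmod. exists eps. auto.
Qed.

Lemma ccont_RtoC : forall t : R, ccont (fun s => RtoC s) t.
Proof.
  intros t eps Heps. apply locally_Rabs. exists eps. split; [exact Heps|].
  intros s Hs. rewrite <- RtoC_minus, Cmod_R. exact Hs.
Qed.

(** Caratheodory's form of differentiability: [l] is the value at [x] of a
    difference quotient of [g] that is continuous there. The map [i] embeds the
    variable in the complex plane, so that the rules of calculus below serve
    both functions of a complex variable and curves. *)
Definition diff {X : UniformSpace} (i g : X -> C) (x : X) (l : C) : Prop :=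
  exists h : X -> C, ccont h x /\ h x = l /\ forall y, g y = (g x + (i y - i x) * h y)%C.

Definition cdiff (g : C -> C) (z l : C) : Prop := @diff C_UniformSpace (fun w => w) g z l.

Definition rdiff (u : R -> C) (t : R) (l : C) : Prop := diff RtoC u t l.

Section Calculus.
Context {X : UniformSpace} {i : X -> C}.
Implicit Types (g h : X -> C) (x : X).

Lemma diff_eps : forall g x l, (forall y y', i y = i y' -> y = y') -> ccont i x ->
  (diff i g x l <-> forall eps, 0 < eps ->
     locally x (fun y => Cmod (g y - g x - l * (i y - i x)) <= eps * Cmod (i y - i x))).
Proof.
  intros g x l Hi Ci. split.
  - intros [h [Hc [Hx Hg]]] eps Heps. generalize (Hc eps Heps). apply filter_imp.
    intros y Hy. rewrite (Hg y).
    replace (g x + (i y - i x) * h y - g x - l * (i y - i x))%C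
      with ((h y - h x) * (i y - i x))%C by (rewrite Hx; ring).
    rewrite Cmod_mult. apply Rmult_le_compat_r; [apply Cmod_ge_0|lra].
  - intros H.
    set (h := fun y => if Ceq_dec (i y) (i x) then l else ((g y - g x) / (i y - i x))%C).
    assert (Hx : h x = l) by (unfold h; destruct (Ceq_dec (i x) (i x)); congruence).
    exists h. split; [|split; [exact Hx|]].
    + intros eps Heps. assert (H2 : 0 < eps / 2) by lra.
      generalize (H _ H2). apply filter_imp. intros y Hy. rewrite Hx. unfold h.
      destruct (Ceq_dec (i y) (i x)) as [E|E]; [rewrite Cmod_diag; exact Heps|].
      apply Cminus_neq_0 in E. pose proof (proj1 (Cmod_gt_0 _) E) as P.
      replace ((g y - g x) / (i y - i x) - l)%C
        with ((g y - g x - l * (i y - i x)) / (i y - i x))%C by (field; exact E).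
      rewrite Cmod_div by exact E. apply Rlt_div_l; [exact P|nra].
    + intros y. unfold h. destruct (Ceq_dec (i y) (i x)) as [E|E].
      * rewrite (Hi _ _ E). ring.
      * field. apply Cminus_neq_0, E.
Qed.

Lemma diff_cont : forall g x l, ccont i x -> diff i g x l -> ccont g x.
Proof.
  intros g x l Ci [h [Hc [Hx Hg]]].
  apply ccont_ext with (fun y => (g x + (i y - i x) * h y)%C); [intros; symmetry; apply Hg|].
  apply ccont_plus; [apply ccont_const|]. apply ccont_mult; [|exact Hc].
  apply ccont_minus; [exact Ci|apply ccont_const].
Qed.

Lemma diff_val : forall g x l l', l = l' -> diff i g x l -> diff i g x l'.
Proof. intros; subst; assumption. Qed.

Lemma diff_const : forall c x, diff i (fun _ => c) x 0.
Proof.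
  intros c x. exists (fun _ => RtoC 0). split; [apply ccont_const|].
  split; [reflexivity|]. intros; ring.
Qed.

Lemma diff_embed : forall x, diff i i x 1.
Proof.
  intros x. exists (fun _ => RtoC 1). split; [apply ccont_const|].
  split; [reflexivity|]. intros; ring.
Qed.

Lemma diff_plus : forall g h x l m, diff i g x l -> diff i h x m ->
  diff i (fun y => (g y + h y)%C) x (l + m)%C.
Proof.
  intros g h x l m [g' [Cg [Lg Eg]]] [h' [Ch [Lh Eh]]].
  exists (fun y => (g' y + h' y)%C). split; [apply ccont_plus; assumption|].
  split; [congruence|]. intros y. rewrite (Eg y), (Eh y). ring.
Qed.

Lemma diff_mult : forall g h x l m, ccont h x -> diff i g x l -> diff i h x m ->
  diff i (fun y => (g y * h y)%C) x (l * h x + g x * m)%C.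
Proof.
  intros g h x l m Ck [g' [Cg [Lg Eg]]] [h' [Ch [Lh Eh]]].
  exists (fun y => (g' y * h y + g x * h' y)%C). split.
  { apply ccont_plus; apply ccont_mult; try assumption. apply ccont_const. }
  split; [congruence|]. intros y. rewrite (Eg y), (Eh y). ring.
Qed.

Lemma diff_scal : forall c g x l, diff i g x l -> diff i (fun y => (c * g y)%C) x (c * l)%C.
Proof.
  intros c g x l [g' [Cg [Lg Eg]]].
  exists (fun y => (c * g' y)%C). split; [apply ccont_mult; [apply ccont_const|assumption]|].
  split; [congruence|]. intros y. rewrite (Eg y). ring.
Qed.

Lemma diff_opp : forall g x l, diff i g x l -> diff i (fun y => (- g y)%C) x (- l)%C.
Proof.
  intros g x l [g' [Cg [Lg Eg]]].
  exists (fun y => (- g' y)%C). split; [apply ccont_opp; assumption|].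
  split; [congruence|]. intros y. rewrite (Eg y). ring.
Qed.

Lemma diff_minus : forall g h x l m, diff i g x l -> diff i h x m ->
  diff i (fun y => (g y - h y)%C) x (l - m)%C.
Proof. intros. apply diff_plus; [|apply diff_opp]; assumption. Qed.

Lemma diff_comp : forall (g : C -> C) h x l m, ccont h x -> cdiff g (h x) l -> diff i h x m ->
  diff i (fun y => g (h y)) x (l * m)%C.
Proof.
  intros g h x l m Ck [g' [Cg [Lg Eg]]] [h' [Ch [Lh Eh]]].
  exists (fun y => (g' (h y) * h' y)%C). split.
  { apply ccont_mult; [|assumption]. apply (ccont_comp g' h); assumption. }
  split; [congruence|]. intros y. rewrite (Eg (h y)), (Eh y) at 1. ring.
Qed.

End Calculus.

Lemma cdiff_eps : forall g z l, cdiff g z l <->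
  forall eps, 0 < eps -> exists d, 0 < d /\ forall w, Cmod (w - z) < d ->
    Cmod (g w - g z - l * (w - z)) <= eps * Cmod (w - z).
Proof.
  intros g z l. unfold cdiff. rewrite diff_eps; [|auto|apply ccont_id].
  split; intros H eps Heps; [apply locally_Cmod, H, Heps|apply locally_Cmod, H, Heps].
Qed.

Lemma rdiff_eps : forall u t l, rdiff u t l <->
  forall eps, 0 < eps -> exists d, 0 < d /\ forall s, Rabs (s - t) < d ->
    Cmod (u s - u t - l * RtoC (s - t)) <= eps * Rabs (s - t).
Proof.
  intros u t l. unfold rdiff. rewrite diff_eps; [|apply RtoC_inj|apply ccont_RtoC].
  split; intros H eps Heps.
  - destruct (proj1 (locally_Rabs _ _) (H eps Heps)) as [d [Hd H']].
    exists d; split; [exact Hd|]. intros s Hs. rewrite <- Cmod_R, RtoC_minus. apply H', Hs.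
  - destruct (H eps Heps) as [d [Hd H']]. apply locally_Rabs. exists d; split; [exact Hd|].
    intros s Hs. rewrite <- RtoC_minus, Cmod_R. apply H', Hs.
Qed.

Lemma cdiff_cont : forall g z l, cdiff g z l -> @ccont C_UniformSpace g z.
Proof. intros g z l. apply diff_cont, ccont_id. Qed.

Lemma rdiff_cont : forall u t l, rdiff u t l -> ccont u t.
Proof. intros u t l. apply diff_cont, ccont_RtoC. Qed.

Lemma cdiff_mult : forall g h z l m, cdiff g z l -> cdiff h z m ->
  cdiff (fun w => (g w * h w)%C) z (l * h z + g z * m)%C.
Proof. intros g h z l m Hg Hh. apply diff_mult; [eapply cdiff_cont, Hh|exact Hg|exact Hh]. Qed.

Lemma rdiff_mult : forall g h t l m, rdiff g t l -> rdiff h t m ->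
  rdiff (fun s => (g s * h s)%C) t (l * h t + g t * m)%C.
Proof. intros g h t l m Hg Hh. apply diff_mult; [eapply rdiff_cont, Hh|exact Hg|exact Hh]. Qed.

Lemma cdiff_comp : forall g h z l m, cdiff g (h z) l -> cdiff h z m ->
  cdiff (fun w => g (h w)) z (l * m)%C.
Proof. intros g h z l m Hg Hh. apply diff_comp; [eapply cdiff_cont, Hh|exact Hg|exact Hh]. Qed.

Lemma rdiff_comp : forall g u t l m, cdiff g (u t) l -> rdiff u t m ->
  rdiff (fun s => g (u s)) t (l * m)%C.
Proof. intros g u t l m Hg Hu. apply diff_comp; [eapply rdiff_cont, Hu|exact Hg|exact Hu]. Qed.

Lemma cdiff_id : forall z, cdiff (fun w => w) z 1.
Proof. exact (@diff_embed C_UniformSpace (fun w => w)). Qed.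

Lemma rdiff_RtoC : forall t, rdiff (fun s => RtoC s) t 1.
Proof. exact (@diff_embed R_UniformSpace RtoC). Qed.

Lemma cdiff_is_derive : forall g z l,
  cdiff g z l <-> @is_derive C_AbsRing C_NormedModule g z l.
Proof.
  intros g z l. rewrite cdiff_eps. split.
  - intros H. split; [apply is_linear_scal_l|].
    intros x Hx. assert (x = z) as ->.
    { symmetry. apply (is_filter_lim_locally_unique (z : AbsRing_UniformSpace C_AbsRing)). exact Hx. }
    intros eps. destruct (H eps (cond_pos eps)) as [d [Hd H']].
    exists (mkposreal d Hd). intros w Hw.
    change (Cmod (g w - g z - (w - z) * l) <= eps * Cmod (w - z)).
    rewrite (Cmult_comm (w - z) l). apply H'. exact Hw.
  - intros [_ H] eps Heps.
    destruct (H z (fun P HP => HP) (mkposreal eps Heps)) as [d Hd].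
    exists d; split; [apply cond_pos|]. intros w Hw.
    specialize (Hd w Hw).
    change (Cmod (g w - g z - (w - z) * l) <= eps * Cmod (w - z)) in Hd.
    rewrite (Cmult_comm l). exact Hd.
Qed.

Lemma cdiff_ext_loc : forall g h z l,
  (exists d, 0 < d /\ forall w, Cmod (w - z) < d -> g w = h w) -> cdiff g z l -> cdiff h z l.
Proof.
  intros g h z l [d0 [Hd0 He]] Hg. rewrite cdiff_eps in *. intros eps Heps.
  destruct (Hg eps Heps) as [d [Hd H]].
  exists (Rmin d d0). split; [apply Rmin_case; assumption|].
  intros w Hw. rewrite <- (He w), <- (He z).
  - apply H. eapply Rlt_le_trans; [exact Hw|apply Rmin_l].
  - rewrite Cmod_diag. exact Hd0.
  - eapply Rlt_le_trans; [exact Hw|apply Rmin_r].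
Qed.

Lemma cdiff_ext : forall g h z l, (forall w, g w = h w) -> cdiff g z l -> cdiff h z l.
Proof.
  intros g h z l He. apply cdiff_ext_loc. exists 1. split; [lra|auto].
Qed.

Lemma cdiff_unique : forall g z l l', cdiff g z l -> cdiff g z l' -> l = l'.
Proof.
  intros g z l l' H H'. apply cdiff_is_derive in H, H'.
  rewrite <- (is_C_derive_unique _ _ _ H). apply is_C_derive_unique. exact H'.
Qed.

Lemma cdiff_inv : forall h z m, cdiff h z m -> h z <> 0 ->
  cdiff (fun w => (/ h w)%C) z (- m / (h z * h z))%C.
Proof.
  intros h z m Hh Hz. pose proof (cdiff_cont _ _ _ Hh) as Ck.
  destruct Hh as [h' [Ch [Lh Eh]]].
  destruct (proj1 (locally_Cmod _ _) (ccont_nonzero _ _ Ck Hz)) as [d [Hd Hn]].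
  apply cdiff_ext_loc with
    (fun w => (/ h z + (w - z) * (- h' w * / (h w * h z)))%C).
  { exists d. split; [exact Hd|]. intros w Hw.
    assert (Hw0 : h w <> 0).
    { apply Cmod_gt_0. specialize (Hn w Hw). pose proof (Cmod_ge_0 (h z)). lra. }
    replace ((w - z) * (- h' w * / (h w * h z)))%C
      with (- (h w - h z) / (h w * h z))%C
      by (rewrite (Eh w) at 1; field; auto).
    field. auto. }
  exists (fun w => (- h' w * / (h w * h z))%C). split.
  { apply ccont_mult; [apply ccont_opp; assumption|].
    apply ccont_inv; [|apply Cmult_neq_0; assumption].
    apply ccont_mult; [exact Ck|apply ccont_const]. }
  split; [rewrite Lh; reflexivity|]. intros w. ring.
Qed.

Lemma cdiff_div : forall g h z l m, cdiff g z l -> cdiff h z m -> h z <> 0 ->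
  cdiff (fun w => (g w / h w)%C) z ((l * h z - g z * m) / (h z * h z))%C.
Proof.
  intros g h z l m Hg Hh Hz.
  replace ((l * h z - g z * m) / (h z * h z))%C
    with (l * / h z + g z * (- m / (h z * h z)))%C by (field; exact Hz).
  apply cdiff_mult with (h := fun w => (/ h w)%C); [exact Hg|]. apply cdiff_inv; assumption.
Qed.

Lemma is_derive_eps : forall (u : R -> R) t l, is_derive u t l <->
  forall eps, 0 < eps -> exists d, 0 < d /\ forall s, Rabs (s - t) < d ->
    Rabs (u s - u t - l * (s - t)) <= eps * Rabs (s - t).
Proof.
  intros u t l; split.
  - intros [_ H] eps Heps.
    destruct (H t (fun P HP => HP) (mkposreal eps Heps)) as [d Hd].
    exists d; split; [apply cond_pos|]. intros s Hs.
    specialize (Hd s Hs).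
    change (Rabs (u s - u t - (s - t) * l) <= eps * Rabs (s - t)) in Hd.
    rewrite (Rmult_comm l). exact Hd.
  - intros H. split; [apply is_linear_scal_l|].
    intros x Hx. assert (x = t) as ->.
    { symmetry. apply (is_filter_lim_locally_unique (t : R_UniformSpace)). exact Hx. }
    intros eps. destruct (H eps (cond_pos eps)) as [d [Hd H']].
    exists (mkposreal d Hd). intros s Hs.
    change (Rabs (u s - u t - (s - t) * l) <= eps * Rabs (s - t)).
    rewrite (Rmult_comm (s - t) l). apply H'. exact Hs.
Qed.

Lemma rdiff_Re : forall u t l, rdiff u t l -> is_derive (fun s => Re (u s)) t (Re l).
Proof.
  intros u t l H. rewrite rdiff_eps in H. apply is_derive_eps.
  intros eps Heps. destruct (H eps Heps) as [d [Hd Hs]].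
  exists d; split; [exact Hd|]. intros s Hst.
  eapply Rle_trans; [|apply Hs; exact Hst].
  eapply Rle_trans; [|apply re_le_Cmod]. right. f_equal. unfold Re, Im; simpl. ring.
Qed.

Lemma rdiff_Im : forall u t l, rdiff u t l -> is_derive (fun s => Im (u s)) t (Im l).
Proof.
  intros u t l H. rewrite rdiff_eps in H. apply is_derive_eps.
  intros eps Heps. destruct (H eps Heps) as [d [Hd Hs]].
  exists d; split; [exact Hd|]. intros s Hst.
  eapply Rle_trans; [|apply Hs; exact Hst].
  eapply Rle_trans; [|apply im_le_Cmod]. right. f_equal. unfold Re, Im; simpl. ring.
Qed.

Lemma rdiff_of_parts : forall u t l, is_derive (fun s => Re (u s)) t (Re l) ->
  is_derive (fun s => Im (u s)) t (Im l) -> rdiff u t l.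
Proof.
  intros u t l H1 H2. rewrite is_derive_eps in H1, H2. apply rdiff_eps.
  intros eps Heps. destruct (H1 (eps / 2)) as [d1 [Hd1 K1]]; [lra|].
  destruct (H2 (eps / 2)) as [d2 [Hd2 K2]]; [lra|].
  exists (Rmin d1 d2). split; [apply Rmin_case; assumption|].
  intros s Hs.
  specialize (K1 s (Rlt_le_trans _ _ _ Hs (Rmin_l _ _))).
  specialize (K2 s (Rlt_le_trans _ _ _ Hs (Rmin_r _ _))).
  eapply Rle_trans; [apply Cmod_le_Re_Im|].
  replace (Re (u s - u t - l * RtoC (s - t))%C)
    with (Re (u s) - Re (u t) - Re l * (s - t)) by (unfold Re, Im; simpl; ring).
  replace (Im (u s - u t - l * RtoC (s - t))%C)
    with (Im (u s) - Im (u t) - Im l * (s - t)) by (unfold Re, Im; simpl; ring). lra.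
Qed.

(** * Complex exponential *)

Definition cexp (z : C) : C := (exp (Re z) * cos (Im z), exp (Re z) * sin (Im z)).

Lemma cexp_plus : forall a b, cexp (a + b) = (cexp a * cexp b)%C.
Proof.
  intros [a1 a2] [b1 b2]. unfold cexp; simpl. rewrite exp_plus, cos_plus, sin_plus.
  apply C_ext; simpl; ring.
Qed.

Lemma cexp_0 : cexp 0 = 1.
Proof. unfold cexp; simpl. rewrite exp_0, cos_0, sin_0. apply C_ext; simpl; ring. Qed.

Lemma cexp_opp_r : forall z, (cexp z * cexp (- z))%C = 1.
Proof. intros z. rewrite <- cexp_plus, <- cexp_0. f_equal. ring. Qed.

Lemma Cmod_cexp : forall z, Cmod (cexp z) = exp (Re z).
Proof.
  intros z. unfold Cmod, cexp; simpl.
  replace (_ + _) with (Rsqr (exp (Re z))).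
  - apply sqrt_Rsqr. apply Rlt_le, exp_pos.
  - pose proof (sin2_cos2 (Im z)) as H. unfold Rsqr in *. nra.
Qed.

Lemma cexp_neq_0 : forall z, cexp z <> 0.
Proof. intros z. apply Cmod_gt_0. rewrite Cmod_cexp. apply exp_pos. Qed.

Lemma exp_le_compat : forall x y, x <= y -> exp x <= exp y.
Proof.
  intros x y [H|H]; [apply Rlt_le, exp_increasing, H|rewrite H; lra].
Qed.

Lemma rdiff_Cmod_le : forall U u a b M, a <= b ->
  (forall t, a <= t <= b -> rdiff U t (u t)) -> (forall t, a <= t <= b -> Cmod (u t) <= M) ->
  Cmod (U b - U a) <= M * (b - a).
Proof.
  intros U u a b M Hab HU HM.
  set (D := (U b - U a)%C). pose proof (Cmod_ge_0 D) as PD.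
  destruct (MVT_gen (fun t => Re (Cconj D * U t)) a b (fun t => Re (Cconj D * u t))) as [c [Hc Ec]].
  - rewrite Rmin_left, Rmax_right by lra. intros t Ht.
    apply rdiff_Re, diff_scal, HU. lra.
  - rewrite Rmin_left, Rmax_right by lra. intros t Ht.
    apply continuity_pt_filterlim.
    apply (ccont_Re (fun t => (Cconj D * U t)%C)).
    eapply rdiff_cont, diff_scal, HU, Ht.
  - rewrite Rmin_left, Rmax_right in Hc by lra.
    assert (E : Cmod D ^ 2 = Re (Cconj D * u c) * (b - a)).
    { rewrite <- Ec, Cmod2_alt. unfold D, Re, Im, Cconj; simpl. ring. }
    assert (Q : Re (Cconj D * u c) <= Cmod D * M).
    { eapply Rle_trans; [apply Re_le_Cmod|]. rewrite Cmod_mult, Cmod_conj.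
      apply Rmult_le_compat_l; auto. }
    assert (Cmod D ^ 2 <= Cmod D * (M * (b - a))).
    { rewrite E, <- Rmult_assoc. apply Rmult_le_compat_r; lra. }
    destruct (Req_dec (Cmod D) 0) as [K|K]; [|nra].
    rewrite K. apply Rmult_le_pos; [|lra].
    eapply Rle_trans; [apply Cmod_ge_0|]. apply (HM a). lra.
Qed.

Lemma rdiff_cexp_ray : forall h t, rdiff (fun s => cexp (RtoC s * h)) t (h * cexp (RtoC t * h))%C.
Proof.
  intros [a b] t. apply rdiff_of_parts; unfold cexp, Re, Im; simpl; auto_derive; auto; unfold Rminus; ring.
Qed.

(** Along the segment from [0] to [h] the function [exp w - 1 - w] has derivative
    [h (exp w - 1)], and [exp w - 1] is itself bounded in the same way. *)
Lemma cexp_taylor1 : forall h, Cmod (cexp h - 1 - h) <= exp (Cmod h) * Cmod h ^ 2.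
Proof.
  intros h. pose proof (Cmod_ge_0 h) as Ph.
  assert (E0 : (RtoC 0 * h)%C = 0) by ring. assert (E1 : (RtoC 1 * h)%C = h) by ring.
  assert (B1 : forall t, 0 <= t <= 1 -> Cmod (cexp (RtoC t * h) - 1) <= exp (Cmod h) * Cmod h).
  { intros t Ht.
    assert (Q : Cmod (cexp (RtoC t * h) - cexp (RtoC 0 * h)) <= Cmod h * exp (Cmod h) * (t - 0)).
    { apply (rdiff_Cmod_le (fun s => cexp (RtoC s * h)) (fun s => (h * cexp (RtoC s * h))%C)); [lra| |].
      - intros s _. apply rdiff_cexp_ray.
      - intros s Hs. rewrite Cmod_mult, Cmod_cexp. apply Rmult_le_compat_l; [exact Ph|].
        apply exp_le_compat. eapply Rle_trans; [apply Re_le_Cmod|].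
        rewrite Cmod_mult, Cmod_R, Rabs_pos_eq by lra. nra. }
    rewrite E0, cexp_0 in Q.
    assert (0 <= Cmod h * exp (Cmod h)) by (apply Rmult_le_pos; [exact Ph|apply Rlt_le, exp_pos]). nra. }
  replace (cexp h - 1 - h)%C
    with ((cexp (RtoC 1 * h) - RtoC 1 * h) - (cexp (RtoC 0 * h) - RtoC 0 * h))%C
    by (rewrite E0, E1, cexp_0; ring).
  replace (exp (Cmod h) * Cmod h ^ 2) with (Cmod h * (exp (Cmod h) * Cmod h) * (1 - 0)) by ring.
  apply (rdiff_Cmod_le (fun s => (cexp (RtoC s * h) - RtoC s * h)%C)
    (fun s => (h * cexp (RtoC s * h) - (1 * h + RtoC s * 0))%C)); [lra| |].
  - intros s _. apply diff_minus; [apply rdiff_cexp_ray|].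
    apply (rdiff_mult RtoC (fun _ => h)); [apply rdiff_RtoC|apply diff_const].
  - intros s Hs. replace (h * cexp (RtoC s * h) - (1 * h + RtoC s * 0))%C
      with (h * (cexp (RtoC s * h) - 1))%C by ring.
    rewrite Cmod_mult. apply Rmult_le_compat_l; [exact Ph|apply B1, Hs].
Qed.

Lemma cdiff_cexp_0 : cdiff cexp 0 1.
Proof.
  apply cdiff_eps. intros eps Heps. pose proof (exp_pos 1) as Pe.
  exists (Rmin 1 (eps / exp 1)). split; [apply Rmin_case; [lra|apply Rdiv_lt_0_compat; lra]|].
  intros w Hw. rewrite cexp_0. replace (1 * (w - 0))%C with w by ring.
  replace (w - 0)%C with w in * by ring. pose proof (Cmod_ge_0 w) as Pw.
  pose proof (Rlt_le_trans _ _ _ Hw (Rmin_l _ _)) as w1.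
  pose proof (Rlt_le_trans _ _ _ Hw (Rmin_r _ _)) as w2. apply Rlt_div_r in w2; [|lra].
  eapply Rle_trans; [apply cexp_taylor1|].
  assert (exp (Cmod w) <= exp 1) by (apply exp_le_compat; lra).
  replace (exp (Cmod w) * Cmod w ^ 2) with (exp (Cmod w) * Cmod w * Cmod w) by ring.
  apply Rmult_le_compat_r; [exact Pw|]. nra.
Qed.

Lemma cdiff_cexp : forall z, cdiff cexp z (cexp z).
Proof.
  intros z.
  apply cdiff_ext with (fun w => (cexp z * cexp (w - z))%C).
  { intros w. rewrite <- cexp_plus. f_equal. ring. }
  eapply diff_val; cycle 1.
  - apply diff_scal. apply cdiff_comp with (l := RtoC 1) (h := fun w => (w - z)%C).
    + replace (z - z)%C with (RtoC 0) by ring. apply cdiff_cexp_0.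
    + apply diff_minus; [apply cdiff_id|apply diff_const].
  - ring.
Qed.

(** * Bisection of rectangles *)

Record rect := Rect { xl : R; xr : R; yl : R; yr : R }.

Definition quarter (i j : bool) (r : rect) : rect :=
  let m := (xl r + xr r) / 2 in let n := (yl r + yr r) / 2 in
  Rect (if i then m else xl r) (if i then xr r else m)
       (if j then n else yl r) (if j then yr r else n).

Definition rect_ok (r : rect) : Prop := xl r <= xr r /\ yl r <= yr r.

Definition sub_rect (r s : rect) : Prop :=
  xl s <= xl r /\ xr r <= xr s /\ yl s <= yl r /\ yr r <= yr s.

Lemma nested_intervals : forall a b : nat -> R, (forall n, a n <= b n) ->
  (forall n, a n <= a (S n)) -> (forall n, b (S n) <= b n) -> exists x, forall n, a n <= x <= b n.
Proof.
  intros a b Hab Ha Hb.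
  assert (Ha' : forall n k, a n <= a (n + k)%nat).
  { intros n k. induction k as [|k IH]; [rewrite Nat.add_0_r; lra|].
    rewrite Nat.add_succ_r. specialize (Ha (n + k)%nat). lra. }
  assert (Hb' : forall n k, b (n + k)%nat <= b n).
  { intros n k. induction k as [|k IH]; [rewrite Nat.add_0_r; lra|].
    rewrite Nat.add_succ_r. specialize (Hb (n + k)%nat). lra. }
  assert (H : forall n m, a n <= b m).
  { intros n m. specialize (Ha' n m). specialize (Hb' m n). rewrite Nat.add_comm in Hb'.
    specialize (Hab (n + m)%nat). lra. }
  destruct (completeness (fun x => exists n, x = a n)) as [x [Hub Hlub]].
  { exists (b 0%nat). intros x [n ->]. apply H. }
  { exists (a 0%nat), 0%nat. reflexivity. }
  exists x. intros n. split; [apply Hub; exists n; reflexivity|].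
  apply Hlub. intros z [m ->]. apply H.
Qed.

Lemma nested_rects : forall s : nat -> rect,
  (forall n, rect_ok (s n)) -> (forall n, sub_rect (s (S n)) (s n)) ->
  exists x y, forall n, xl (s n) <= x <= xr (s n) /\ yl (s n) <= y <= yr (s n).
Proof.
  intros s Hok Hsub.
  destruct (nested_intervals (fun n => xl (s n)) (fun n => xr (s n))) as [x Hx];
    try (intros n; apply Hok || apply Hsub).
  destruct (nested_intervals (fun n => yl (s n)) (fun n => yr (s n))) as [y Hy];
    try (intros n; apply Hok || apply Hsub).
  exists x, y. intros n. split; [apply Hx|apply Hy].
Qed.

(** A property that always passes to a quarter concentrates at a point. It is
    applied to the unboundedness of a continuous function and to the excess of a
    boundary integral over a multiple of the area. *)
Lemma bisection : forall (P : rect -> Prop) (r : rect), rect_ok r -> P r ->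
  (forall s, rect_ok s -> sub_rect s r -> P s -> exists i j, P (quarter i j s)) ->
  exists x y, forall n, exists s, rect_ok s /\ sub_rect s r /\ P s /\
    xl s <= x <= xr s /\ yl s <= y <= yr s /\
    xr s - xl s = (xr r - xl r) / 2 ^ n /\ yr s - yl s = (yr r - yl r) / 2 ^ n.
Proof.
  intros P r Hr HP Hstep.
  set (step := fun s => match excluded_middle_informative (exists ij, P (quarter (fst ij) (snd ij) s)) with
    | left H => let ij := proj1_sig (constructive_indefinite_description _ H) in
                quarter (fst ij) (snd ij) s
    | right _ => s end).
  set (s := fun n => Nat.iter n step r).
  assert (Hs : forall n, rect_ok (s n) /\ sub_rect (s n) r /\ P (s n) /\ sub_rect (s (S n)) (s n) /\
      xr (s n) - xl (s n) = (xr r - xl r) / 2 ^ n /\ yr (s n) - yl (s n) = (yr r - yl r) / 2 ^ n).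
  { assert (Hq : forall q, rect_ok q -> sub_rect q r -> P q ->
      exists i j, step q = quarter i j q /\ P (quarter i j q)).
    { intros q H1 H2 H3. unfold step.
      destruct (excluded_middle_informative (exists ij, P (quarter (fst ij) (snd ij) q))) as [H|H].
      - exists (fst (proj1_sig (constructive_indefinite_description _ H))),
          (snd (proj1_sig (constructive_indefinite_description _ H))).
        split; [reflexivity|].
        exact (proj2_sig (constructive_indefinite_description _ H)).
      - exfalso. apply H. destruct (Hstep q H1 H2 H3) as [i [j Hij]]. exists (i, j). exact Hij. }
    assert (Hq' : forall i j q, rect_ok q -> rect_ok (quarter i j q) /\ sub_rect (quarter i j q) q /\
      xr (quarter i j q) - xl (quarter i j q) = (xr q - xl q) / 2 /\
      yr (quarter i j q) - yl (quarter i j q) = (yr q - yl q) / 2).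
    { intros i j q [H1 H2]. unfold rect_ok, sub_rect, quarter. destruct i, j; simpl; lra. }
    assert (Hn : forall n, rect_ok (s n) /\ sub_rect (s n) r /\ P (s n) /\
      xr (s n) - xl (s n) = (xr r - xl r) / 2 ^ n /\ yr (s n) - yl (s n) = (yr r - yl r) / 2 ^ n).
    { induction n as [|n [H1 [H2 [H3 [H4 H5]]]]].
      - unfold s; simpl. repeat split; try apply Hr; try exact HP; unfold sub_rect; lra.
      - destruct (Hq _ H1 H2 H3) as [i [j [E HPq]]].
        change (s (S n)) with (step (s n)). rewrite E.
        destruct (Hq' i j _ H1) as [K1 [K2 [K3 K4]]].
        split; [exact K1|]. split; [unfold sub_rect in *; lra|]. split; [exact HPq|].
        rewrite K3, K4, H4, H5. simpl. split; field; apply pow_nonzero; lra. }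
    intros n. destruct (Hn n) as [H1 [H2 [H3 [H4 H5]]]].
    repeat (split; [assumption|]). split; [|split; assumption].
    change (s (S n)) with (step (s n)). destruct (Hq _ H1 H2 H3) as [i [j [E HPq]]].
    rewrite E. apply Hq'. exact H1. }
  destruct (nested_rects s) as [x [y Hxy]].
  { intros n. apply Hs. }
  { intros n. apply Hs. }
  exists x, y. intros n. exists (s n).
  destruct (Hs n) as [H1 [H2 [H3 [H4 [H5 H6]]]]].
  destruct (Hxy n) as [K1 K2]. tauto.
Qed.

Lemma pow2_small : forall A d, 0 < d -> exists n : nat, A / 2 ^ n < d.
Proof.
  intros A d Hd.
  destruct (Rle_or_lt A 0) as [HA|HA].
  - exists 0%nat. simpl. lra.
  - destruct (pow_lt_1_zero (/ 2)) with (y := d / A) as [N HN].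
    + rewrite Rabs_pos_eq; lra.
    + apply Rdiv_lt_0_compat; lra.
    + exists N. specialize (HN N (Nat.le_refl _)).
      rewrite pow_inv, Rabs_pos_eq in HN.
      * apply Rmult_lt_reg_l with (/ A); [apply Rinv_0_lt_compat; lra|].
        replace (/ A * (A / 2 ^ N)) with (/ 2 ^ N) by (field; split; [apply pow_nonzero|]; lra).
        replace (/ A * d) with (d / A) by (field; lra). exact HN.
      * apply Rlt_le, Rinv_0_lt_compat, pow_lt; lra.
Qed.

(** * Extreme values on closed bounded sets *)

Definition closed_C (S : C -> Prop) : Prop :=
  forall z, (forall d, 0 < d -> exists w, S w /\ Cmod (w - z) < d) -> S z.

Definition cont_on (S : C -> Prop) (F : C -> R) : Prop :=
  forall z, S z -> forall eps, 0 < eps -> exists d, 0 < d /\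
    forall w, S w -> Cmod (w - z) < d -> Rabs (F w - F z) < eps.

Lemma rect_close : forall x y w1 w2 a b c d e, a <= x <= b -> c <= y <= d ->
  a <= w1 <= b -> c <= w2 <= d -> b - a < e / 2 -> d - c < e / 2 ->
  Cmod ((w1, w2) - (x, y))%C < e.
Proof.
  intros. eapply Rle_lt_trans; [apply Cmod_le_Re_Im|].
  unfold Re, Im; simpl. unfold Rabs. repeat destruct Rcase_abs; lra.
Qed.

(** Unboundedness on a rectangle passes to a quarter, and at a limit point it
    contradicts continuity. *)
Lemma cont_bounded : forall (S : C -> Prop) (F : C -> R) r,
  closed_C S -> (forall z, S z -> Cmod z <= r) -> cont_on S F ->
  exists M, forall z, S z -> F z <= M.
Proof.
  intros S F r Hcl Hbd HF. apply NNPP. intros Hno.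
  assert (Hr : 0 <= r).
  { destruct (Rle_or_lt 0 r) as [H|H]; [exact H|].
    exfalso. apply Hno. exists 0. intros z Hz. pose proof (Cmod_ge_0 z).
    specialize (Hbd z Hz). lra. }
  set (P := fun s : rect => forall M, exists z, S z /\ xl s <= Re z <= xr s /\
     yl s <= Im z <= yr s /\ M < F z).
  destruct (bisection P (Rect (-r) r (-r) r)) as [x [y Hxy]].
  - unfold rect_ok; simpl; lra.
  - intros M. apply NNPP. intros H. apply Hno. exists M. intros z Hz.
    apply Rnot_lt_le. intros H'. apply H. exists z.
    pose proof (re_le_Cmod z) as Q1. pose proof (im_le_Cmod z) as Q2.
    specialize (Hbd z Hz). simpl.
    assert (- r <= Re z <= r) by (revert Q1; unfold Rabs; destruct Rcase_abs; lra).
    assert (- r <= Im z <= r) by (revert Q2; unfold Rabs; destruct Rcase_abs; lra).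
    auto.
  - intros s Hok _ HP. apply NNPP. intros H.
    assert (Hq : forall i j, exists M, forall z, S z ->
      xl (quarter i j s) <= Re z <= xr (quarter i j s) ->
      yl (quarter i j s) <= Im z <= yr (quarter i j s) -> F z <= M).
    { intros i j. apply NNPP. intros H'. apply H. exists i, j. intros M.
      apply NNPP. intros H''. apply H'. exists M. intros z Hz K1 K2.
      apply Rnot_lt_le. intros K3. apply H''. exists z. auto. }
    destruct (Hq false false) as [M1 K1]. destruct (Hq false true) as [M2 K2].
    destruct (Hq true false) as [M3 K3]. destruct (Hq true true) as [M4 K4].
    destruct (HP (Rmax (Rmax M1 M2) (Rmax M3 M4))) as [z [Hz [Hx [Hy HM]]]].
    pose proof (Rmax_l M1 M2). pose proof (Rmax_r M1 M2).
    pose proof (Rmax_l M3 M4). pose proof (Rmax_r M3 M4).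
    pose proof (Rmax_l (Rmax M1 M2) (Rmax M3 M4)). pose proof (Rmax_r (Rmax M1 M2) (Rmax M3 M4)).
    specialize (K1 z Hz). specialize (K2 z Hz). specialize (K3 z Hz). specialize (K4 z Hz).
    unfold quarter in *; simpl in *.
    destruct (Rle_or_lt (Re z) ((xl s + xr s) / 2)) as [A|A];
    destruct (Rle_or_lt (Im z) ((yl s + yr s) / 2)) as [B|B].
    + assert (F z <= M1) by (apply K1; lra). lra.
    + assert (F z <= M2) by (apply K2; lra). lra.
    + assert (F z <= M3) by (apply K3; lra). lra.
    + assert (F z <= M4) by (apply K4; lra). lra.
  - assert (Hnear : forall e, 0 < e -> exists s, P s /\ forall z, xl s <= Re z <= xr s ->
       yl s <= Im z <= yr s -> Cmod (z - (x, y)) < e).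
    { intros e He. destruct (pow2_small (2 * r) (e / 2)) as [n Hn]; [lra|].
      destruct (Hxy n) as [s [_ [_ [HP [H1 [H2 [H3 H4]]]]]]]. simpl in *.
      exists s. split; [exact HP|]. intros [z1 z2] K1 K2. unfold Re, Im in K1, K2; simpl in *.
      apply rect_close with (xl s) (xr s) (yl s) (yr s); try lra. }
    assert (HS : S (x, y)).
    { apply Hcl. intros e He. destruct (Hnear e He) as [s [HP Hs]].
      destruct (HP 0) as [z [Hz [K1 [K2 _]]]]. exists z. auto. }
    destruct (HF _ HS 1) as [e [He Hc]]; [lra|].
    destruct (Hnear e He) as [s [HP Hs]].
    destruct (HP (F (x, y) + 1)) as [z [Hz [K1 [K2 K3]]]].
    specialize (Hc z Hz (Hs z K1 K2)). apply Rabs_def2 in Hc. lra.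
Qed.

(** A supremum [m] that is not attained would make [1 / (m - F)] continuous and
    unbounded. *)
Lemma cont_max : forall (S : C -> Prop) (F : C -> R) r,
  closed_C S -> (forall z, S z -> Cmod z <= r) -> cont_on S F -> (exists z, S z) ->
  exists z0, S z0 /\ forall z, S z -> F z <= F z0.
Proof.
  intros S F r Hcl Hbd HF [z1 Hz1].
  destruct (cont_bounded S F r Hcl Hbd HF) as [M HM].
  destruct (completeness (fun x => exists z, S z /\ x = F z)) as [m [Hub Hlub]].
  { exists M. intros x [z [Hz ->]]. auto. }
  { exists (F z1), z1. auto. }
  apply NNPP. intros Hno.
  assert (Hlt : forall z, S z -> F z < m).
  { intros z Hz. assert (F z <= m) by (apply Hub; exists z; auto).
    destruct (Req_dec (F z) m) as [E|E]; [|lra].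
    exfalso. apply Hno. exists z. split; [exact Hz|]. intros w Hw. rewrite E.
    apply Hub; exists w; auto. }
  destruct (cont_bounded S (fun z => / (m - F z)) r Hcl Hbd) as [B HB].
  { intros z Hz eps Heps. pose proof (Hlt z Hz) as Lz.
    set (a := m - F z) in *. assert (Pa : 0 < a) by (unfold a; lra).
    set (e := Rmin (a / 2) (eps * (a * a / 2))).
    assert (He : 0 < e).
    { apply Rmin_case; [lra|]. apply Rmult_lt_0_compat; [exact Heps|]. nra. }
    destruct (HF z Hz e He) as [d [Hd Hc]]. exists d; split; [exact Hd|].
    intros w Hw Hwz. specialize (Hc w Hw Hwz).
    pose proof (Rmin_l (a / 2) (eps * (a * a / 2))) as e1.
    pose proof (Rmin_r (a / 2) (eps * (a * a / 2))) as e2. fold e in e1, e2.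
    set (b := m - F w). assert (Hb : Rabs (a - b) < e).
    { unfold a, b. replace (m - F z - (m - F w)) with (F w - F z) by ring. exact Hc. }
    assert (Pb : a / 2 < b) by (apply Rabs_def2 in Hb; lra).
    replace (/ b - / a) with ((a - b) / (b * a)) by (field; lra).
    unfold Rdiv. rewrite Rabs_mult, Rabs_inv, (Rabs_pos_eq (b * a)) by nra.
    apply Rmult_lt_reg_r with (b * a); [nra|].
    rewrite Rmult_assoc, Rinv_l, Rmult_1_r by nra.
    eapply Rlt_le_trans; [exact Hb|]. eapply Rle_trans; [exact e2|].
    apply Rmult_le_compat_l; nra. }
  assert (PB : 0 < B).
  { eapply Rlt_le_trans; [|apply (HB z1 Hz1)]. apply Rinv_0_lt_compat.
    specialize (Hlt z1 Hz1). lra. }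
  assert (m <= m - / B).
  { apply Hlub. intros x [z [Hz ->]]. specialize (HB z Hz). specialize (Hlt z Hz).
    apply Rle_Rinv in HB; [|apply Rinv_0_lt_compat; lra|exact PB].
    rewrite Rinv_inv in HB. lra. }
  pose proof (Rinv_0_lt_compat _ PB). lra.
Qed.

Lemma closed_disk_closed : forall r, closed_C (fun z => Cmod z <= r).
Proof.
  intros r z H. apply Rnot_lt_le. intros K.
  destruct (H (Cmod z - r)) as [w [Hw Hwz]]; [lra|].
  pose proof (Cmod_triangle_inv z w) as Q. rewrite Cmod_minus_sym in Q. lra.
Qed.

(** * Integrals of complex valued functions of a real variable *)

Definition CI (u : R -> C) (a b : R) : C :=
  (RInt (fun t => Re (u t)) a b, RInt (fun t => Im (u t)) a b).

Definition cont_seg (u : R -> C) (a b : R) : Prop := forall t, a <= t <= b -> ccont u t.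

Lemma ex_RInt_Re : forall u a b, a <= b -> cont_seg u a b -> ex_RInt (fun t => Re (u t)) a b.
Proof.
  intros u a b Hab Hu. apply (ex_RInt_continuous (V := R_CompleteNormedModule)). rewrite Rmin_left, Rmax_right by lra.
  intros t Ht. apply ccont_Re. apply Hu. exact Ht.
Qed.

Lemma ex_RInt_Im : forall u a b, a <= b -> cont_seg u a b -> ex_RInt (fun t => Im (u t)) a b.
Proof.
  intros u a b Hab Hu. apply (ex_RInt_continuous (V := R_CompleteNormedModule)). rewrite Rmin_left, Rmax_right by lra.
  intros t Ht. apply ccont_Im. apply Hu. exact Ht.
Qed.

Lemma CI_ext : forall u v a b, (forall t, a <= t <= b -> u t = v t) -> a <= b -> CI u a b = CI v a b.
Proof.
  intros u v a b H Hab. unfold CI. f_equal; apply RInt_ext; rewrite Rmin_left, Rmax_right by lra;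
  intros t Ht; rewrite H by lra; reflexivity.
Qed.

Lemma CI_plus : forall u v a b, a <= b -> cont_seg u a b -> cont_seg v a b ->
  CI (fun t => (u t + v t)%C) a b = (CI u a b + CI v a b)%C.
Proof.
  intros u v a b Hab Hu Hv. apply C_ext; unfold CI, Re, Im; simpl.
  - apply (RInt_plus (V := R_CompleteNormedModule) (fun t => Re (u t)) (fun t => Re (v t)));
      apply ex_RInt_Re; assumption.
  - apply (RInt_plus (V := R_CompleteNormedModule) (fun t => Im (u t)) (fun t => Im (v t)));
      apply ex_RInt_Im; assumption.
Qed.

Lemma CI_scal : forall c u a b, a <= b -> cont_seg u a b ->
  CI (fun t => (c * u t)%C) a b = (c * CI u a b)%C.
Proof.
  intros c u a b Hab Hu.
  pose proof (ex_RInt_Re u a b Hab Hu) as E1. pose proof (ex_RInt_Im u a b Hab Hu) as E2.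
  apply C_ext; unfold CI.
  - change (RInt (fun t => Re c * Re (u t) - Im c * Im (u t)) a b =
      Re c * RInt (fun t => Re (u t)) a b - Im c * RInt (fun t => Im (u t)) a b).
    rewrite (RInt_minus (V := R_CompleteNormedModule) (fun t => Re c * Re (u t)) (fun t => Im c * Im (u t))).
    + rewrite (RInt_scal (V := R_CompleteNormedModule) (fun t => Re (u t))) by exact E1.
      rewrite (RInt_scal (V := R_CompleteNormedModule) (fun t => Im (u t))) by exact E2.
      reflexivity.
    + apply (ex_RInt_scal (V := R_CompleteNormedModule)); exact E1.
    + apply (ex_RInt_scal (V := R_CompleteNormedModule)); exact E2.
  - change (RInt (fun t => Re c * Im (u t) + Im c * Re (u t)) a b =
      Re c * RInt (fun t => Im (u t)) a b + Im c * RInt (fun t => Re (u t)) a b).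
    rewrite (RInt_plus (V := R_CompleteNormedModule) (fun t => Re c * Im (u t)) (fun t => Im c * Re (u t))).
    + rewrite (RInt_scal (V := R_CompleteNormedModule) (fun t => Re (u t))) by exact E1.
      rewrite (RInt_scal (V := R_CompleteNormedModule) (fun t => Im (u t))) by exact E2.
      reflexivity.
    + apply (ex_RInt_scal (V := R_CompleteNormedModule)); exact E2.
    + apply (ex_RInt_scal (V := R_CompleteNormedModule)); exact E1.
Qed.

Lemma cont_seg_scal : forall c u a b, cont_seg u a b -> cont_seg (fun t => (c * u t)%C) a b.
Proof. intros c u a b H t Ht. apply ccont_mult; [apply ccont_const|auto]. Qed.

Lemma CI_minus : forall u v a b, a <= b -> cont_seg u a b -> cont_seg v a b ->
  CI (fun t => (u t - v t)%C) a b = (CI u a b - CI v a b)%C.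
Proof.
  intros u v a b Hab Hu Hv.
  rewrite (CI_ext _ (fun t => (u t + (- (1)) * v t)%C)) by (intros; try ring; assumption).
  rewrite CI_plus; [|assumption|assumption|apply cont_seg_scal; assumption].
  rewrite CI_scal by assumption. ring.
Qed.

Lemma CI_const : forall c a b, CI (fun _ => c) a b = (RtoC (b - a) * c)%C.
Proof.
  intros c a b. unfold CI. rewrite !RInt_const. apply C_ext; unfold Re, Im; simpl;
  unfold scal; simpl; unfold mult; simpl; ring.
Qed.

Lemma CI_Chasles : forall u a b c, a <= b -> b <= c -> cont_seg u a c ->
  (CI u a b + CI u b c)%C = CI u a c.
Proof.
  intros u a b c Hab Hbc Hu.
  assert (H1 : cont_seg u a b) by (intros t Ht; apply Hu; lra).
  assert (H2 : cont_seg u b c) by (intros t Ht; apply Hu; lra).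
  apply C_ext; unfold CI, Re, Im; simpl.
  - apply (RInt_Chasles (V := R_CompleteNormedModule) (fun t => fst (u t)));
    apply ex_RInt_Re; assumption.
  - apply (RInt_Chasles (V := R_CompleteNormedModule) (fun t => snd (u t)));
    apply ex_RInt_Im; assumption.
Qed.

Lemma Re_CI_le : forall u (f : R -> R) a b, a <= b -> cont_seg u a b ->
  (forall t, a <= t <= b -> Re (u t) <= f t) -> ex_RInt f a b ->
  Re (CI u a b) <= RInt f a b.
Proof.
  intros u f a b Hab Hu Hf Ef. unfold CI. change (RInt (fun t => Re (u t)) a b <= RInt f a b).
  apply RInt_le; [exact Hab|apply ex_RInt_Re; assumption|exact Ef|].
  intros t Ht. apply Hf. lra.
Qed.

(** The bound follows from the one on real parts after rotating the integral
    onto the positive axis. *)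
Lemma CI_norm_le : forall u (f : R -> R) a b, a <= b -> cont_seg u a b ->
  (forall t, a <= t <= b -> Cmod (u t) <= f t) -> ex_RInt f a b ->
  Cmod (CI u a b) <= RInt f a b.
Proof.
  intros u f a b Hab Hu Hf Ef.
  set (I := CI u a b). pose proof (Cmod_ge_0 I) as P.
  destruct (Req_dec (Cmod I) 0) as [E|E].
  { rewrite E. apply RInt_ge_0; [exact Hab|exact Ef|].
    intros t Ht. eapply Rle_trans; [apply Cmod_ge_0|apply Hf; lra]. }
  assert (H : Re (CI (fun t => (Cconj I * u t)%C) a b) <= RInt (fun t => Cmod I * f t) a b).
  { apply Re_CI_le; [exact Hab|apply cont_seg_scal; exact Hu| |].
    - intros t Ht. eapply Rle_trans; [apply Re_le_Cmod|].
      rewrite Cmod_mult, Cmod_conj. apply Rmult_le_compat_l; auto.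
    - apply (ex_RInt_scal (V := R_CompleteNormedModule)); exact Ef. }
  rewrite (RInt_scal (V := R_CompleteNormedModule) f) in H by exact Ef.
  rewrite CI_scal in H by assumption. fold I in H.
  change (Re (Cconj I * I) <= Cmod I * RInt f a b) in H.
  assert (Q : Re (Cconj I * I) = Cmod I ^ 2).
  { rewrite Cmod2_alt. unfold Re, Im, Cconj; simpl. ring. }
  rewrite Q in H. nra.
Qed.

Lemma CI_bound : forall u M a b, a <= b -> cont_seg u a b ->
  (forall t, a <= t <= b -> Cmod (u t) <= M) -> Cmod (CI u a b) <= M * (b - a).
Proof.
  intros u M a b Hab Hu HM.
  eapply Rle_trans; [apply CI_norm_le with (f := fun _ => M); try assumption|].
  - apply ex_RInt_const.
  - rewrite RInt_const. right. unfold scal; simpl; unfold mult; simpl. ring.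
Qed.

Lemma CI_FTC : forall U u a b, a <= b -> cont_seg u a b ->
  (forall t, a <= t <= b -> rdiff U t (u t)) -> CI u a b = (U b - U a)%C.
Proof.
  intros U u a b Hab Hu HU. apply C_ext.
  - change (RInt (fun t => Re (u t)) a b = Re (U b) - Re (U a)).
    apply is_RInt_unique.
    apply (is_RInt_derive (V := R_CompleteNormedModule) (fun t => Re (U t)) (fun t => Re (u t)));
    rewrite Rmin_left, Rmax_right by lra; intros t Ht.
    + apply rdiff_Re, HU, Ht.
    + apply ccont_Re, Hu, Ht.
  - change (RInt (fun t => Im (u t)) a b = Im (U b) - Im (U a)).
    apply is_RInt_unique.
    apply (is_RInt_derive (V := R_CompleteNormedModule) (fun t => Im (U t)) (fun t => Im (u t)));
    rewrite Rmin_left, Rmax_right by lra; intros t Ht.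
    + apply rdiff_Im, HU, Ht.
    + apply ccont_Im, Hu, Ht.
Qed.

(** * Goursat's theorem on rectangles *)

Lemma rdiff_horizontal : forall x y, rdiff (fun t => ((t, y) : C)) x 1.
Proof.
  intros x y. apply rdiff_of_parts; unfold Re, Im; simpl.
  - apply (is_derive_id (K := R_AbsRing)).
  - apply (is_derive_const (K := R_AbsRing) (V := R_NormedModule)).
Qed.

Lemma rdiff_vertical : forall x y, rdiff (fun t => ((x, t) : C)) y Ci.
Proof.
  intros x y. apply rdiff_of_parts; unfold Re, Im; simpl.
  - apply (is_derive_const (K := R_AbsRing) (V := R_NormedModule)).
  - apply (is_derive_id (K := R_AbsRing)).
Qed.

Definition in_rect (w : C) (r : rect) : Prop :=
  xl r <= Re w <= xr r /\ yl r <= Im w <= yr r.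

Definition boundary_int (H : C -> C) (r : rect) : C :=
  (CI (fun x => H (x, yl r)) (xl r) (xr r) - CI (fun x => H (x, yr r)) (xl r) (xr r)
   + Ci * (CI (fun y => H (xr r, y)) (yl r) (yr r) - CI (fun y => H (xl r, y)) (yl r) (yr r)))%C.

Definition cont_rect (H : C -> C) (r : rect) : Prop :=
  forall w, in_rect w r -> @ccont C_UniformSpace H w.

Lemma cont_rect_h : forall H r y a b, cont_rect H r -> xl r <= a -> b <= xr r ->
  yl r <= y <= yr r -> cont_seg (fun x => H (x, y)) a b.
Proof.
  intros H r y a b Hc Ha Hb Hy t Ht.
  apply (ccont_comp H (fun x => ((x, y) : C))).
  - apply Hc. unfold in_rect, Re, Im; simpl. lra.
  - eapply rdiff_cont, rdiff_horizontal.
Qed.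

Lemma cont_rect_v : forall H r x a b, cont_rect H r -> yl r <= a -> b <= yr r ->
  xl r <= x <= xr r -> cont_seg (fun y => H (x, y)) a b.
Proof.
  intros H r x a b Hc Ha Hb Hy t Ht.
  apply (ccont_comp H (fun y => ((x, y) : C))).
  - apply Hc. unfold in_rect, Re, Im; simpl. lra.
  - eapply rdiff_cont, rdiff_vertical.
Qed.

Lemma boundary_int_quarters : forall H r, rect_ok r -> cont_rect H r ->
  boundary_int H r =
  (boundary_int H (quarter false false r) + boundary_int H (quarter false true r) +
   boundary_int H (quarter true false r) + boundary_int H (quarter true true r))%C.
Proof.
  intros H r [H1 H2] Hc. unfold boundary_int; simpl.
  set (m := (xl r + xr r) / 2). set (n := (yl r + yr r) / 2).
  assert (Hm : xl r <= m <= xr r) by (unfold m; lra).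
  assert (Hn : yl r <= n <= yr r) by (unfold n; lra).
  rewrite <- (CI_Chasles (fun x => H (x, yl r)) (xl r) m (xr r)); try lra;
    [|apply cont_rect_h with r; auto; lra].
  rewrite <- (CI_Chasles (fun x => H (x, yr r)) (xl r) m (xr r)); try lra;
    [|apply cont_rect_h with r; auto; lra].
  rewrite <- (CI_Chasles (fun y => H (xl r, y)) (yl r) n (yr r)); try lra;
    [|apply cont_rect_v with r; auto; lra].
  rewrite <- (CI_Chasles (fun y => H (xr r, y)) (yl r) n (yr r)); try lra;
    [|apply cont_rect_v with r; auto; lra].
  ring.
Qed.

Lemma boundary_int_primitive : forall Q H r, rect_ok r ->
  (forall w, cdiff Q w (H w)) -> (forall w, @ccont C_UniformSpace H w) ->
  boundary_int H r = 0.
Proof.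
  intros Q H r [H1 H2] HQ Hc. unfold boundary_int.
  assert (Hc' : cont_rect H r) by (intros w _; apply Hc).
  assert (Eh : forall y, yl r <= y <= yr r ->
    CI (fun x => H (x, y)) (xl r) (xr r) = (Q (xr r, y) - Q (xl r, y))%C).
  { intros y Hy. apply CI_FTC with (U := fun x => Q (x, y)); [exact H1| |].
    - apply cont_rect_h with r; auto; lra.
    - intros t _. apply diff_val with (H (t, y) * 1)%C; [ring|].
      apply (rdiff_comp Q (fun x => ((x, y) : C))); [apply HQ|apply rdiff_horizontal]. }
  assert (Ev : forall x, xl r <= x <= xr r ->
    (Ci * CI (fun y => H (x, y)) (yl r) (yr r))%C = (Q (x, yr r) - Q (x, yl r))%C).
  { intros x Hx.
    assert (Hs : cont_seg (fun y => H (x, y)) (yl r) (yr r)) by (apply cont_rect_v with r; auto; lra).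
    rewrite <- CI_scal by assumption.
    apply CI_FTC with (U := fun y => Q (x, y)); [exact H2| |].
    - apply cont_seg_scal; exact Hs.
    - intros t _. apply diff_val with (H (x, t) * Ci)%C; [ring|].
      apply (rdiff_comp Q (fun y => ((x, y) : C))); [apply HQ|apply rdiff_vertical]. }
  rewrite (Eh (yl r)), (Eh (yr r)) by lra.
  replace (Ci * (CI (fun y => H (xr r, y)) (yl r) (yr r) - CI (fun y => H (xl r, y)) (yl r) (yr r)))%C
    with (Ci * CI (fun y => H (xr r, y)) (yl r) (yr r) - Ci * CI (fun y => H (xl r, y)) (yl r) (yr r))%C
    by ring.
  rewrite (Ev (xl r)), (Ev (xr r)) by lra. ring.
Qed.

Lemma boundary_int_minus : forall G H r, rect_ok r -> cont_rect G r -> cont_rect H r ->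
  boundary_int (fun w => (G w - H w)%C) r = (boundary_int G r - boundary_int H r)%C.
Proof.
  intros G H r [H1 H2] CG CH. unfold boundary_int.
  rewrite !CI_minus; try assumption; try (apply cont_rect_h with r; auto; lra);
    try (apply cont_rect_v with r; auto; lra).
  ring.
Qed.

Lemma boundary_int_bound : forall H r M, rect_ok r -> cont_rect H r ->
  (forall w, in_rect w r -> Cmod (H w) <= M) ->
  Cmod (boundary_int H r) <= M * (2 * (xr r - xl r + (yr r - yl r))).
Proof.
  intros H r M [H1 H2] Hc HM. unfold boundary_int.
  assert (Bh : forall y, yl r <= y <= yr r -> Cmod (CI (fun x => H (x, y)) (xl r) (xr r)) <= M * (xr r - xl r)).
  { intros y Hy. apply CI_bound; [exact H1|apply cont_rect_h with r; auto; lra|].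
    intros t Ht. apply HM. unfold in_rect, Re, Im; simpl. lra. }
  assert (Bv : forall x, xl r <= x <= xr r -> Cmod (CI (fun y => H (x, y)) (yl r) (yr r)) <= M * (yr r - yl r)).
  { intros x Hx. apply CI_bound; [exact H2|apply cont_rect_v with r; auto; lra|].
    intros t Ht. apply HM. unfold in_rect, Re, Im; simpl. lra. }
  eapply Rle_trans; [apply Cmod_triangle|].
  rewrite Cmod_mult, Cmod_Ci.
  eapply Rle_trans; [apply Rplus_le_compat; [apply Cmod_triangle_sub|
    apply Rmult_le_compat_l; [lra|apply Cmod_triangle_sub]]|].
  pose proof (Bh (yl r)). pose proof (Bh (yr r)). pose proof (Bv (xl r)). pose proof (Bv (xr r)). lra.
Qed.

(** Up to an error of smaller order [H] is affine near [w0], and an affine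
    function has a primitive. *)
Lemma boundary_int_local : forall H w0 l eps, cdiff H w0 l -> 0 < eps ->
  exists d, 0 < d /\ forall r, rect_ok r -> cont_rect H r -> in_rect w0 r ->
    xr r - xl r + (yr r - yl r) < d ->
    Cmod (boundary_int H r) <= eps * (2 * (xr r - xl r + (yr r - yl r)) ^ 2).
Proof.
  intros H w0 l eps Hl Heps.
  destruct (proj1 (cdiff_eps _ _ _) Hl eps Heps) as [d [Hd Hd']].
  exists d; split; [exact Hd|]. intros r Hok Hc Hw0 Hsize.
  set (A := fun w : C => (H w0 + l * (w - w0))%C).
  assert (CA : forall w, @ccont C_UniformSpace A w).
  { intros w. apply ccont_plus; [apply ccont_const|]. apply ccont_mult; [apply ccont_const|].
    apply ccont_minus; [apply ccont_id|apply ccont_const]. }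
  assert (EA : boundary_int A r = 0).
  { apply boundary_int_primitive with (Q := fun w => (H w0 * w + l / 2 * ((w - w0) * (w - w0)))%C); auto.
    intros w. eapply diff_val; cycle 1.
    - apply diff_plus; apply diff_scal; [apply cdiff_id|].
      apply cdiff_mult; apply diff_minus; (apply cdiff_id || apply diff_const).
    - unfold A. field. }
  replace (boundary_int H r) with (boundary_int (fun w => (H w - A w)%C) r).
  2: { rewrite boundary_int_minus; [rewrite EA; ring| | |]; auto. intros w _; apply CA. }
  set (s := xr r - xl r + (yr r - yl r)) in *.
  replace (eps * (2 * s ^ 2)) with (eps * s * (2 * s)) by ring.
  apply boundary_int_bound; [exact Hok| |].
  - intros w Hw. apply ccont_minus; [apply Hc, Hw|apply CA].
  - intros w Hw. unfold A.
    assert (Hs : Cmod (w - w0) <= s).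
    { eapply Rle_trans; [apply Cmod_le_Re_Im|]. unfold in_rect, s in *.
      destruct w as [w1 w2], w0 as [v1 v2]; unfold Re, Im in *; simpl in *.
      unfold Rabs. repeat destruct Rcase_abs; lra. }
    replace (H w - (H w0 + l * (w - w0)))%C with (H w - H w0 - l * (w - w0))%C by ring.
    eapply Rle_trans; [apply Hd'; lra|]. apply Rmult_le_compat_l; lra.
Qed.

(** If the integral were nonzero, some quarter would keep at least the same ratio
    of integral to area; the ratio would then stay bounded below along rectangles
    shrinking to a point, against the local estimate. *)
Lemma goursat : forall H r, xl r < xr r -> yl r < yr r ->
  (forall w, in_rect w r -> exists l, cdiff H w l) -> boundary_int H r = 0.
Proof.
  intros H r Hx Hy HH.
  assert (Hc : cont_rect H r).
  { intros w Hw. destruct (HH w Hw) as [l Hl]. eapply cdiff_cont, Hl. }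
  assert (Hcs : forall s, sub_rect s r -> cont_rect H s).
  { intros s Hs w Hw. apply Hc. unfold sub_rect, in_rect in *. lra. }
  set (area := fun s => (xr s - xl s) * (yr s - yl s)).
  assert (Pr : 0 < area r) by (unfold area; apply Rmult_lt_0_compat; lra).
  apply Cmod_eq_0. pose proof (Cmod_ge_0 (boundary_int H r)) as P0.
  apply Rle_antisym; [|exact P0]. apply Rnot_lt_le. intros P.
  set (k := Cmod (boundary_int H r) / area r).
  assert (Pk : 0 < k) by (apply Rdiv_lt_0_compat; assumption).
  destruct (bisection (fun s => k * area s <= Cmod (boundary_int H s)) r) as [x [y Hxy]].
  - unfold rect_ok; lra.
  - right. unfold k. field. lra.
  - intros s Hok Hsub HP. apply NNPP. intros Hno.
    assert (Hq : forall i j, Cmod (boundary_int H (quarter i j s)) < k * area (quarter i j s)).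
    { intros i j. apply Rnot_le_lt. intros K. apply Hno. exists i, j. exact K. }
    assert (Ha : forall i j, area (quarter i j s) = area s / 4).
    { intros i j. unfold area, quarter. destruct i, j; simpl; field. }
    rewrite (boundary_int_quarters H s Hok (Hcs s Hsub)) in HP.
    pose proof (Hq false false) as Q1. pose proof (Hq false true) as Q2.
    pose proof (Hq true false) as Q3. pose proof (Hq true true) as Q4.
    rewrite Ha in Q1, Q2, Q3, Q4.
    set (b1 := boundary_int H (quarter false false s)) in *.
    set (b2 := boundary_int H (quarter false true s)) in *.
    set (b3 := boundary_int H (quarter true false s)) in *.
    set (b4 := boundary_int H (quarter true true s)) in *.
    pose proof (Cmod_triangle (b1 + b2 + b3) b4). pose proof (Cmod_triangle (b1 + b2) b3).
    pose proof (Cmod_triangle b1 b2). lra.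
  - assert (Hin : in_rect (x, y) r).
    { destruct (Hxy 0%nat) as [s [_ [Hs [_ [K1 [K2 _]]]]]].
      unfold in_rect, sub_rect, Re, Im in *; simpl. lra. }
    destruct (HH _ Hin) as [l Hl].
    set (A := xr r - xl r) in *. set (B := yr r - yl r) in *.
    assert (PA : 0 < A) by (unfold A; lra). assert (PB : 0 < B) by (unfold B; lra).
    set (eps := k * (A * B) / (4 * (A + B) ^ 2)).
    assert (Pe : 0 < eps).
    { apply Rdiv_lt_0_compat; [apply Rmult_lt_0_compat; nra|].
      assert (0 < (A + B) ^ 2) by (apply pow_lt; lra). lra. }
    destruct (boundary_int_local H (x, y) l eps Hl Pe) as [d [Hd Hloc]].
    destruct (pow2_small (A + B) d Hd) as [n Hn].
    destruct (Hxy n) as [s [Hok [Hs [HP [K1 [K2 [K3 K4]]]]]]].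
    assert (P2 : 0 < 2 ^ n) by (apply pow_lt; lra).
    assert (Es : xr s - xl s + (yr s - yl s) = (A + B) / 2 ^ n).
    { rewrite K3, K4. field. lra. }
    specialize (Hloc s Hok (Hcs s Hs)). rewrite Es in Hloc.
    assert (Hw : in_rect (x, y) s) by (unfold in_rect, Re, Im; simpl; lra).
    specialize (Hloc Hw Hn). unfold area in HP. rewrite K3, K4 in HP.
    assert (E1 : k * (A / 2 ^ n * (B / 2 ^ n)) = k * (A * B) / (2 ^ n) ^ 2) by (field; lra).
    assert (E2 : eps * (2 * ((A + B) / 2 ^ n) ^ 2) = k * (A * B) / (2 ^ n) ^ 2 / 2).
    { unfold eps. field. split; lra. }
    rewrite E1 in HP. rewrite E2 in Hloc.
    assert (0 < k * (A * B) / (2 ^ n) ^ 2).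
    { apply Rdiv_lt_0_compat; [apply Rmult_lt_0_compat; nra|]. apply pow_lt. exact P2. }
    lra.
Qed.

(** * The mean value property *)

Definition expi (t : R) : C := (cos t, sin t).

Lemma cexp_pair : forall x y, cexp (x, y) = (RtoC (exp x) * expi y)%C.
Proof. intros. unfold cexp, expi. apply C_ext; unfold Re, Im; simpl; ring. Qed.

Lemma Cmod_expi : forall t, Cmod (expi t) = 1.
Proof.
  intros t. pose proof (Cmod_cexp (0, t)) as H. rewrite cexp_pair in H.
  unfold Re in H; simpl in H. rewrite exp_0 in H. rewrite Cmod_mult, Cmod_R, Rabs_R1 in H. lra.
Qed.

Lemma rdiff_expi : forall t, rdiff expi t (Ci * expi t)%C.
Proof.
  intros t. apply rdiff_of_parts; unfold Re, Im; simpl.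
  - replace (0 * cos t - 1 * sin t) with (- sin t) by ring. apply is_derive_cos.
  - replace (0 * sin t + 1 * cos t) with (cos t) by ring. apply is_derive_sin.
Qed.

Lemma expi_0 : expi 0 = 1.
Proof. unfold expi. rewrite cos_0, sin_0. reflexivity. Qed.

Lemma expi_2PI : expi (2 * PI) = 1.
Proof. unfold expi. rewrite cos_2PI, sin_2PI. reflexivity. Qed.

Lemma two_PI_pos : 0 <= 2 * PI.
Proof. pose proof PI_RGT_0. lra. Qed.

(** Cauchy's theorem for the annulus: in the coordinate [log w] circles become
    vertical segments, and the horizontal sides of a rectangle of height [2 PI]
    cancel by periodicity. *)
Lemma circle_int_indep : forall g Rad rho1 rho2,
  (forall w : C, w <> 0 -> Cmod w < Rad -> exists l, cdiff g w l) ->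
  0 < rho1 < rho2 -> rho2 < Rad ->
  CI (fun t => g (RtoC rho1 * expi t)%C) 0 (2 * PI) =
  CI (fun t => g (RtoC rho2 * expi t)%C) 0 (2 * PI).
Proof.
  intros g Rad r1 r2 Hg H1 H2.
  set (r := Rect (ln r1) (ln r2) 0 (2 * PI)).
  pose proof PI_RGT_0 as HPI.
  assert (G := goursat (fun w => g (cexp w)) r).
  unfold boundary_int, r in G; simpl in G.
  assert (Eb : CI (fun x => g (cexp (x, 2 * PI))) (ln r1) (ln r2) = CI (fun x => g (cexp (x, 0))) (ln r1) (ln r2)).
  { apply CI_ext; [|apply Rlt_le, ln_increasing; lra]. intros x _.
    rewrite !cexp_pair, expi_0, expi_2PI. reflexivity. }
  rewrite Eb in G.
  assert (Ev : forall s, 0 < s -> CI (fun y => g (cexp (ln s, y))) 0 (2 * PI)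
     = CI (fun t => g (RtoC s * expi t)%C) 0 (2 * PI)).
  { intros s Hs. apply CI_ext; [|lra]. intros t _. rewrite cexp_pair, exp_ln by exact Hs. reflexivity. }
  rewrite !Ev in G by lra.
  set (I1 := CI (fun t => g (RtoC r1 * expi t)%C) 0 (2 * PI)) in *.
  set (I2 := CI (fun t => g (RtoC r2 * expi t)%C) 0 (2 * PI)) in *.
  assert (K : (Ci * (I2 - I1) = 0)%C).
  { rewrite <- G; [ring| | |].
    - apply ln_increasing; lra.
    - lra.
    - intros w Hw. unfold in_rect in Hw; simpl in Hw.
      destruct (Hg (cexp w)) as [l Hl].
      + apply cexp_neq_0.
      + rewrite Cmod_cexp. eapply Rle_lt_trans; [|exact H2].
        rewrite <- (exp_ln r2) by lra. apply exp_le_compat. lra.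
      + exists (l * cexp w)%C. apply cdiff_comp; [exact Hl|apply cdiff_cexp]. }
  assert (E : (I2 - I1 = 0)%C).
  { replace (I2 - I1)%C with (- Ci * (Ci * (I2 - I1)))%C; [rewrite K; ring|].
    apply C_ext; unfold Re, Im; simpl; ring. }
  replace I2 with (I2 - I1 + I1)%C by ring. rewrite E. ring.
Qed.

Definition tends_at (g : C -> C) (z L : C) : Prop :=
  forall eps, 0 < eps -> exists d, 0 < d /\
    forall w, w <> z -> Cmod (w - z) < d -> Cmod (g w - L) < eps.

Lemma circle_cont : forall g z rho,
  (forall w, Cmod (w - z) = rho -> @ccont C_UniformSpace g w) -> 0 <= rho ->
  forall a b, cont_seg (fun t => g (z + RtoC rho * expi t)%C) a b.
Proof.
  intros g z rho Hg Hr a b t _.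
  apply (ccont_comp g (fun t => (z + RtoC rho * expi t)%C)).
  - apply Hg. replace (z + RtoC rho * expi t - z)%C with (RtoC rho * expi t)%C by ring.
    rewrite Cmod_mult, Cmod_R, Cmod_expi, Rabs_pos_eq by exact Hr. ring.
  - apply ccont_plus; [apply ccont_const|]. apply ccont_mult; [apply ccont_const|].
    eapply rdiff_cont, rdiff_expi.
Qed.

(** The integral does not depend on the radius, which may tend to [0]. Only the
    limit of [g] at the centre enters, so that difference quotients are allowed. *)
Lemma mean_value_0 : forall g Rad rho L,
  (forall w : C, w <> 0 -> Cmod w < Rad -> exists l, cdiff g w l) ->
  tends_at g 0 L -> 0 < rho < Rad ->
  CI (fun t => g (RtoC rho * expi t)%C) 0 (2 * PI) = (RtoC (2 * PI) * L)%C.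
Proof.
  intros g Rad rho L Hg HL Hr. pose proof PI_RGT_0 as HPI.
  set (I := CI (fun t => g (RtoC rho * expi t)%C) 0 (2 * PI)).
  assert (E : (I - RtoC (2 * PI) * L = 0)%C); [|replace I with (I - RtoC (2 * PI) * L + RtoC (2 * PI) * L)%C by ring; rewrite E; ring].
  apply Cmod_eq_0. apply Rle_antisym; [|apply Cmod_ge_0].
  apply Rnot_lt_le. intros K. set (e := Cmod (I - RtoC (2 * PI) * L)) in *.
  destruct (HL (e / (4 * PI))) as [d [Hd Hd']]; [apply Rdiv_lt_0_compat; lra|].
  set (s := Rmin (rho / 2) (d / 2)).
  assert (Hs : 0 < s) by (apply Rmin_case; lra).
  pose proof (Rmin_l (rho / 2) (d / 2)) as s1. pose proof (Rmin_r (rho / 2) (d / 2)) as s2.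
  fold s in s1, s2.
  assert (EI : I = CI (fun t => g (RtoC s * expi t)%C) 0 (2 * PI)).
  { unfold I. symmetry. apply circle_int_indep with Rad; auto; lra. }
  assert (Hm : forall t, Cmod (RtoC s * expi t) = s).
  { intros t. rewrite Cmod_mult, Cmod_R, Cmod_expi, Rabs_pos_eq by lra. ring. }
  assert (Hn : forall t, (RtoC s * expi t)%C <> 0).
  { intros t. apply Cmod_gt_0. rewrite Hm. exact Hs. }
  assert (Hc : cont_seg (fun t => g (RtoC s * expi t)%C) 0 (2 * PI)).
  { intros t _. apply ccont_ext with (fun t => g (0 + RtoC s * expi t)%C).
    { intros y. f_equal. ring. }
    apply (circle_cont g 0 s) with t t; try lra.
    intros w Hw. replace (w - 0)%C with w in Hw by ring.
    destruct (Hg w) as [l Hl]; [apply Cmod_gt_0; lra|lra|]. eapply cdiff_cont, Hl. }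
  assert (B : Cmod (CI (fun t => (g (RtoC s * expi t) - L)%C) 0 (2 * PI)) <= e / (4 * PI) * (2 * PI - 0)).
  { apply CI_bound; [lra| |].
    - intros t Ht. apply ccont_minus; [apply Hc, Ht|apply ccont_const].
    - intros t _. apply Rlt_le, Hd'; [apply Hn|].
      replace (RtoC s * expi t - 0)%C with (RtoC s * expi t)%C by ring. rewrite Hm. lra. }
  rewrite CI_minus, CI_const, <- EI in B; [|lra|exact Hc|intros t _; apply ccont_const].
  rewrite Rminus_0_r in B. fold e in B.
  replace (e / (4 * PI) * (2 * PI)) with (e / 2) in B by (field; lra). lra.
Qed.

Lemma mean_value : forall g z Rad rho L,
  (forall w : C, w <> z -> Cmod (w - z) < Rad -> exists l, cdiff g w l) ->
  tends_at g z L -> 0 < rho < Rad ->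
  CI (fun t => g (z + RtoC rho * expi t)%C) 0 (2 * PI) = (RtoC (2 * PI) * L)%C.
Proof.
  intros g z Rad rho L Hg HL Hr.
  apply (mean_value_0 (fun w => g (z + w)%C) Rad rho L); [| |exact Hr].
  - intros w Hw Hw'. destruct (Hg (z + w)%C) as [l Hl].
    + intros K. apply Hw. replace w with (z + w - z)%C by ring. rewrite K. ring.
    + replace (z + w - z)%C with w by ring. exact Hw'.
    + exists (l * (0 + 1))%C. apply cdiff_comp; [exact Hl|].
      apply diff_plus; [apply diff_const|apply cdiff_id].
  - intros eps Heps. destruct (HL eps Heps) as [d [Hd Hd']]. exists d; split; [exact Hd|].
    intros w Hw Hw'. apply Hd'.
    + intros K. apply Hw. replace w with (z + w - z)%C by ring. rewrite K. ring.
    + replace (z + w - z)%C with (w - 0)%C by ring. exact Hw'.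
Qed.

Lemma cont_tends : forall g z, @ccont C_UniformSpace g z -> tends_at g z (g z).
Proof.
  intros g z H eps Heps. destruct (proj1 (locally_Cmod _ _) (H eps Heps)) as [d [Hd H']].
  exists d; split; [exact Hd|]. intros w _ Hw. apply H', Hw.
Qed.

(** * Regularity of holomorphic functions *)

Definition slope (f : C -> C) (z w : C) : C := ((f w - f z) / (w - z))%C.

Lemma slope_tends : forall f z l, cdiff f z l -> tends_at (slope f z) z l.
Proof.
  intros f z l [h [Hc [Hz Hf]]] eps Heps.
  destruct (cont_tends h z Hc eps Heps) as [d [Hd H]]. exists d; split; [exact Hd|].
  intros w Hw Hw'. specialize (H w Hw Hw'). unfold slope.
  rewrite (Hf w). replace ((f z + (w - z) * h w - f z) / (w - z))%C with (h w)
    by (field; apply Cminus_neq_0, Hw).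
  rewrite <- Hz. exact H.
Qed.

Lemma slope_cdiff : forall f z w l, w <> z -> cdiff f w l -> exists m, cdiff (slope f z) w m.
Proof.
  intros f z w l Hw Hl. eexists. unfold slope. apply cdiff_div.
  - apply diff_minus; [exact Hl|apply diff_const].
  - apply diff_minus; [apply cdiff_id|apply diff_const].
  - apply Cminus_neq_0, Hw.
Qed.

(** The mean value property of the difference quotient at [z]. Since it requires
    differentiability alone, it yields the regularity of the derivative below. *)
Lemma cauchy_derivative : forall f z Rad rho l,
  (forall w, Cmod (w - z) < Rad -> exists l, cdiff f w l) -> cdiff f z l -> 0 < rho < Rad ->
  CI (fun t => slope f z (z + RtoC rho * expi t)%C) 0 (2 * PI) = (RtoC (2 * PI) * l)%C.
Proof.
  intros f z Rad rho l Hf Hl Hr.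
  apply mean_value with Rad; [|apply slope_tends, Hl|exact Hr].
  intros w Hw Hw'. destruct (Hf w Hw') as [m Hm]. apply slope_cdiff with m; assumption.
Qed.

Definition segment (a b : C) (t : R) : C := (a + RtoC t * (b - a))%C.

Lemma rdiff_segment : forall a b t, rdiff (segment a b) t (b - a)%C.
Proof.
  intros a b t. unfold segment. eapply diff_val; cycle 1.
  - apply diff_plus; [apply diff_const|]. apply rdiff_mult; [apply rdiff_RtoC|apply diff_const].
  - cbv beta; ring.
Qed.

Lemma segment_in_disk : forall a b r t, Cmod a <= r -> Cmod b <= r -> 0 <= t <= 1 ->
  Cmod (segment a b t) <= r.
Proof.
  intros a b r t Ha Hb Ht. unfold segment.
  replace (a + RtoC t * (b - a))%C with (RtoC (1 - t) * a + RtoC t * b)%C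
    by (rewrite RtoC_minus; ring).
  eapply Rle_trans; [apply Cmod_triangle|]. rewrite !Cmod_mult, !Cmod_R, !Rabs_pos_eq by lra. nra.
Qed.

Lemma cdiff_Cmod_le : forall f f' a b M,
  (forall t, 0 <= t <= 1 -> cdiff f (segment a b t) (f' (segment a b t))) ->
  (forall t, 0 <= t <= 1 -> Cmod (f' (segment a b t)) <= M) ->
  Cmod (f b - f a) <= M * Cmod (b - a).
Proof.
  intros f f' a b M Hf HM.
  replace (f b) with (f (segment a b 1)) by (f_equal; unfold segment; ring).
  replace (f a) with (f (segment a b 0)) by (f_equal; unfold segment; ring).
  replace (M * Cmod (b - a)) with (M * Cmod (b - a) * (1 - 0)) by ring.
  apply (rdiff_Cmod_le (fun t => f (segment a b t)) (fun t => (f' (segment a b t) * (b - a))%C)).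
  - lra.
  - intros t Ht. apply rdiff_comp; [apply Hf, Ht|apply rdiff_segment].
  - intros t Ht. rewrite Cmod_mult. apply Rmult_le_compat_r; [apply Cmod_ge_0|auto].
Qed.

Definition hol (f f' : C -> C) : Prop := forall z, Cmod z < 1 -> cdiff f z (f' z).

Lemma cauchy_estimate : forall f z Rad rho l M,
  (forall w, Cmod (w - z) < Rad -> exists l, cdiff f w l) -> cdiff f z l -> 0 < rho < Rad ->
  (forall w, Cmod (w - z) <= rho -> Cmod (f w) <= M) -> Cmod l <= 2 * M / rho.
Proof.
  intros f z Rad rho l M Hf Hl Hr HM. pose proof PI_RGT_0 as HPI.
  pose proof (cauchy_derivative f z Rad rho l Hf Hl Hr) as E.
  assert (Hm : forall t, (z + RtoC rho * expi t - z)%C = (RtoC rho * expi t)%C) by (intros; ring).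
  assert (Hm' : forall t, Cmod (RtoC rho * expi t) = rho).
  { intros t. rewrite Cmod_mult, Cmod_R, Cmod_expi, Rabs_pos_eq by lra. ring. }
  assert (B : Cmod (CI (fun t => slope f z (z + RtoC rho * expi t)%C) 0 (2 * PI)) <= 2 * M / rho * (2 * PI - 0)).
  { apply CI_bound; [lra| |].
    - apply circle_cont; [|lra]. intros w Hw.
      destruct (Hf w) as [m Hm'']; [lra|].
      destruct (slope_cdiff f z w m) as [k Hk]; [|exact Hm''|eapply cdiff_cont, Hk].
      intros ->. rewrite Cmod_diag in Hw. lra.
    - intros t _. unfold slope. rewrite Hm.
      rewrite Cmod_div by (apply Cmod_gt_0; rewrite Hm'; lra). rewrite Hm'.
      apply Rmult_le_compat_r; [apply Rlt_le, Rinv_0_lt_compat; lra|].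
      eapply Rle_trans; [apply Cmod_triangle_sub|].
      pose proof (HM z). pose proof (HM (z + RtoC rho * expi t)%C) as Q. rewrite Hm, Hm' in Q.
      replace (z - z)%C with (RtoC 0) in * by ring. rewrite Cmod_0 in *. lra. }
  rewrite E, Cmod_mult, Cmod_R, Rabs_pos_eq, Rminus_0_r in B by lra.
  apply Rmult_le_reg_l with (2 * PI); lra.
Qed.

Lemma hol_bounded : forall f f' r, hol f f' -> r < 1 ->
  exists M, forall z, Cmod z <= r -> Cmod (f z) <= M.
Proof.
  intros f f' r Hf Hr.
  apply (cont_bounded (fun z => Cmod z <= r) (fun z => Cmod (f z)) r); auto.
  - apply closed_disk_closed.
  - intros z Hz eps Heps.
    pose proof (cdiff_cont _ _ _ (Hf z (Rle_lt_trans _ _ _ Hz Hr))) as Hc.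
    destruct (proj1 (locally_Cmod _ _) (Hc eps Heps)) as [d [Hd H]].
    exists d; split; [exact Hd|]. intros w _ Hw. specialize (H w Hw).
    pose proof (Cmod_triangle_inv (f w) (f z)) as Q1.
    pose proof (Cmod_triangle_inv (f z) (f w)) as Q2. rewrite Cmod_minus_sym in Q2.
    apply Rabs_def1; lra.
Qed.

Lemma in_larger_disk : forall z w r, Cmod z <= r -> Cmod (w - z) < 1 - r -> Cmod w < 1.
Proof.
  intros z w r Hz Hw. pose proof (Cmod_triangle_inv w z). lra.
Qed.

Lemma hol_lipschitz : forall f f' r, hol f f' -> 0 <= r < 1 ->
  exists K, 0 <= K /\ (forall z, Cmod z <= r -> Cmod (f' z) <= K) /\
    forall a b, Cmod a <= r -> Cmod b <= r -> Cmod (f b - f a) <= K * Cmod (b - a).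
Proof.
  intros f f' r Hf Hr.
  destruct (hol_bounded f f' ((1 + r) / 2) Hf) as [M HM]; [lra|].
  set (rho := (1 - r) / 2). assert (Hrho : 0 < rho) by (unfold rho; lra).
  assert (Hd : forall z, Cmod z <= r -> Cmod (f' z) <= 2 * M / rho).
  { intros z Hz. apply (cauchy_estimate f z (1 - r)).
    - intros w Hw. exists (f' w). apply Hf, in_larger_disk with z r; assumption.
    - apply Hf. lra.
    - unfold rho; lra.
    - intros w Hw. apply HM. pose proof (Cmod_triangle_inv w z). unfold rho in Hw. lra. }
  exists (2 * M / rho). split; [|split; [exact Hd|]].
  - eapply Rle_trans; [apply Cmod_ge_0|apply (Hd 0)]. rewrite Cmod_0. lra.
  - intros a b Ha Hb. apply cdiff_Cmod_le with f'; intros t Ht;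
    pose proof (segment_in_disk a b r t Ha Hb Ht); [apply Hf; lra|auto].
Qed.

(** Apply the Cauchy estimate to the increment [w |-> f (w + h) - f w]. *)
Lemma hol_deriv_lipschitz : forall f f' r, hol f f' -> 0 <= r < 1 ->
  exists K, 0 <= K /\
    forall a b, Cmod a <= r -> Cmod b <= r -> Cmod (f' b - f' a) <= K * Cmod (b - a).
Proof.
  intros f f' r Hf Hr.
  destruct (hol_lipschitz f f' ((1 + r) / 2) Hf) as [K [HK [_ HL]]]; [lra|].
  set (rho := (1 - r) / 2). assert (Hrho : 0 < rho) by (unfold rho; lra).
  exists (2 * K / rho). split.
  { apply Rdiv_le_0_compat; lra. }
  intros a b Ha Hb.
  replace (2 * K / rho * Cmod (b - a)) with (2 * (K * Cmod (b - a)) / rho) by (field; lra).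
  assert (Hsh : forall w, Cmod (w - a) < 1 - r -> Cmod (w + (b - a)) < 1).
  { intros w Hw. apply in_larger_disk with b r; [exact Hb|].
    replace (w + (b - a) - b)%C with (w - a)%C by ring. exact Hw. }
  assert (D : forall w, Cmod (w - a) < 1 - r ->
    cdiff (fun w => (f (w + (b - a)) - f w)%C) w (f' (w + (b - a))%C * (1 + 0) - f' w)%C).
  { intros w Hw. apply diff_minus.
    - apply (cdiff_comp f (fun w => (w + (b - a))%C)); [apply Hf, Hsh, Hw|].
      apply diff_plus; [apply cdiff_id|apply diff_const].
    - apply Hf, in_larger_disk with a r; assumption. }
  apply (cauchy_estimate (fun w => (f (w + (b - a)) - f w)%C) a (1 - r)).
  - intros w Hw. eexists. apply D, Hw.
  - eapply diff_val; cycle 1.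
    + apply D. rewrite Cmod_diag. lra.
    + replace (a + (b - a))%C with b by ring. ring.
  - unfold rho; lra.
  - intros w Hw.
    replace (Cmod (b - a)) with (Cmod (w + (b - a) - w)) by (f_equal; ring).
    apply HL.
    + pose proof (Cmod_triangle_inv w a). unfold rho in Hw. lra.
    + pose proof (Cmod_triangle_inv (w + (b - a)) b) as Q.
      replace (w + (b - a) - b)%C with (w - a)%C in Q by ring. unfold rho in Hw. lra.
Qed.

Lemma hol_taylor1 : forall f f' r, hol f f' -> 0 <= r < 1 ->
  exists K, 0 <= K /\ forall a b, Cmod a <= r -> Cmod b <= r ->
    Cmod (f b - f a - f' a * (b - a)) <= K * Cmod (b - a) ^ 2.
Proof.
  intros f f' r Hf Hr. destruct (hol_deriv_lipschitz f f' r Hf Hr) as [K [HK HL]].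
  exists K; split; [exact HK|]. intros a b Ha Hb.
  replace (f b - f a - f' a * (b - a))%C with ((f b - f' a * b) - (f a - f' a * a))%C by ring.
  replace (K * Cmod (b - a) ^ 2) with (K * Cmod (b - a) * Cmod (b - a)) by ring.
  apply (cdiff_Cmod_le (fun w => (f w - f' a * w)%C) (fun w => (f' w - f' a * 1)%C)).
  - intros t Ht. apply diff_minus; [|apply diff_scal, cdiff_id].
    apply Hf. pose proof (segment_in_disk a b r t Ha Hb Ht). lra.
  - intros t Ht. replace (f' (segment a b t) - f' a * 1)%C with (f' (segment a b t) - f' a)%C by ring.
    eapply Rle_trans; [apply HL; [exact Ha|apply segment_in_disk; assumption]|].
    apply Rmult_le_compat_l; [exact HK|]. unfold segment.
    replace (a + RtoC t * (b - a) - a)%C with (RtoC t * (b - a))%C by ring.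
    rewrite Cmod_mult, Cmod_R, Rabs_pos_eq by lra. pose proof (Cmod_ge_0 (b - a)). nra.
Qed.

Lemma lipschitz_cont : forall f r K, 0 <= K -> (forall a b, Cmod a <= r -> Cmod b <= r -> Cmod (f b - f a) <= K * Cmod (b - a)) ->
  forall z, Cmod z < r -> @ccont C_UniformSpace f z.
Proof.
  intros f r K HK HL z Hz eps Heps. apply locally_Cmod.
  exists (Rmin (r - Cmod z) (eps / (K + 1))). split.
  { apply Rmin_case; [lra|]. apply Rdiv_lt_0_compat; lra. }
  intros w Hw.
  pose proof (Rlt_le_trans _ _ _ Hw (Rmin_l _ _)) as H1.
  pose proof (Rlt_le_trans _ _ _ Hw (Rmin_r _ _)) as H2.
  pose proof (Cmod_triangle_inv w z) as Q.
  eapply Rle_lt_trans; [apply HL; lra|].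
  pose proof (Cmod_ge_0 (w - z)).
  apply Rle_lt_trans with ((K + 1) * Cmod (w - z)); [nra|].
  replace eps with ((K + 1) * (eps / (K + 1))) by (field; lra).
  apply Rmult_lt_compat_l; lra.
Qed.

(** The Cauchy formula for [f'] may be differentiated under the integral sign. *)
Lemma hol_deriv : forall f f', hol f f' -> exists f'', hol f' f''.
Proof.
  intros f f' Hf.
  assert (H : forall z, exists m, Cmod z < 1 -> cdiff f' z m).
  2: { exists (fun z => proj1_sig (constructive_indefinite_description _ (H z))).
       intros z. exact (proj2_sig (constructive_indefinite_description _ (H z))). }
  intros z. destruct (Rlt_or_le (Cmod z) 1) as [Hz|Hz]; [|exists 0; lra].
  pose proof (Cmod_ge_0 z) as Pz. pose proof PI_RGT_0 as HPI.
  set (rho := (1 - Cmod z) / 3). assert (Hrho : 0 < rho) by (unfold rho; lra).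
  set (r := 1 - rho).
  destruct (hol_taylor1 f f' r Hf) as [K [HK HT]]; [unfold r, rho; lra|].
  destruct (hol_deriv_lipschitz f f' r Hf) as [K' [HK' HL']]; [unfold r, rho; lra|].
  set (u := fun t => slope f' z (z + RtoC rho * expi t)%C).
  assert (Hm : forall a t, (a + RtoC rho * expi t - a)%C = (RtoC rho * expi t)%C) by (intros; ring).
  assert (Hm' : forall t, Cmod (RtoC rho * expi t) = rho).
  { intros t. rewrite Cmod_mult, Cmod_R, Cmod_expi, Rabs_pos_eq by lra. ring. }
  assert (Hm0 : forall t, (RtoC rho * expi t)%C <> 0).
  { intros t. apply Cmod_gt_0. rewrite Hm'. exact Hrho. }
  assert (Cu : cont_seg u 0 (2 * PI)).
  { apply circle_cont; [|lra]. intros w Hw. unfold slope.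
    assert (Q := Cmod_triangle_inv w z).
    apply ccont_div.
    - apply ccont_minus; [|apply ccont_const]. apply lipschitz_cont with r K'; auto.
      unfold r, rho in *. lra.
    - apply ccont_minus; [apply ccont_id|apply ccont_const].
    - apply Cmod_gt_0. lra. }
  set (m := (CI u 0 (2 * PI) / RtoC (2 * PI))%C).
  assert (HP2 : RtoC (2 * PI) <> 0) by (intros E; apply RtoC_inj in E; lra).
  exists m. intros _. apply cdiff_eps. intros eps Heps.
  exists (Rmin rho (eps * rho / (2 * K + 1))). split.
  { apply Rmin_case; [exact Hrho|]. apply Rdiv_lt_0_compat; [nra|lra]. }
  intros w Hw. set (h := (w - z)%C) in *.
  pose proof (Rlt_le_trans _ _ _ Hw (Rmin_l _ _)) as H1.
  pose proof (Rlt_le_trans _ _ _ Hw (Rmin_r _ _)) as H2.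
  assert (Hwz : Cmod w <= Cmod z + rho) by (pose proof (Cmod_triangle_inv w z); unfold h in *; lra).
  assert (Ew := cauchy_derivative f w (2 * rho) rho (f' w)).
  assert (Ez := cauchy_derivative f z (2 * rho) rho (f' z)).
  assert (Cs : forall a, Cmod a <= Cmod z + rho ->
    cont_seg (fun t => slope f a (a + RtoC rho * expi t)%C) 0 (2 * PI)).
  { intros a Ha. apply circle_cont; [|lra]. intros v Hv.
    assert (Q := Cmod_triangle_inv v a).
    destruct (slope_cdiff f a v (f' v)) as [k Hk].
    - intros ->. rewrite Cmod_diag in Hv. lra.
    - apply Hf. unfold rho in *. lra.
    - eapply cdiff_cont, Hk. }
  assert (E : (RtoC (2 * PI) * (f' w - f' z - m * h))%C =
    CI (fun t => (slope f w (w + RtoC rho * expi t) - slope f z (z + RtoC rho * expi t) - h * u t)%C) 0 (2 * PI)).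
  { rewrite CI_minus, CI_minus, CI_scal, Ew, Ez; try lra; try assumption.
    - unfold m. field. exact HP2.
    - intros v Hv. exists (f' v). apply Hf. pose proof (Cmod_triangle_inv v z). unfold rho in *; lra.
    - apply Hf. exact Hz.
    - intros v Hv. exists (f' v). apply Hf. pose proof (Cmod_triangle_inv v w). unfold rho in *; lra.
    - apply Hf. unfold rho in *; lra.
    - apply Cs; lra.
    - apply Cs; lra.
    - intros t Ht. apply ccont_minus; apply Cs; lra.
    - apply cont_seg_scal; exact Cu. }
  assert (B : Cmod (RtoC (2 * PI) * (f' w - f' z - m * h)) <= 2 * K * Cmod h ^ 2 / rho * (2 * PI - 0)).
  { rewrite E. apply CI_bound; [lra| |].
    - intros t Ht. apply ccont_minus.
      + apply ccont_minus; apply Cs; lra.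
      + apply cont_seg_scal with (a := 0) (b := 2 * PI); assumption.
    - intros t Ht. unfold u, slope. rewrite !Hm.
      set (e := (RtoC rho * expi t)%C) in *.
      assert (Ee : Cmod e = rho) by apply Hm'.
      assert (e0 : e <> 0) by apply Hm0.
      replace ((f (w + e) - f w) / e - (f (z + e) - f z) / e - h * ((f' (z + e) - f' z) / e))%C
        with (((f (w + e) - f (z + e) - f' (z + e) * ((w + e) - (z + e))) - (f w - f z - f' z * (w - z))) / e)%C
        by (unfold h; field; exact e0).
      rewrite Cmod_div by exact e0. rewrite Ee.
      apply Rmult_le_compat_r; [apply Rlt_le, Rinv_0_lt_compat, Hrho|].
      eapply Rle_trans; [apply Cmod_triangle_sub|].
      pose proof (Cmod_triangle w e). pose proof (Cmod_triangle z e).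
      assert (T1 := HT (z + e)%C (w + e)%C). assert (T2 := HT z w).
      replace (w + e - (z + e))%C with h in * by (unfold h; ring). fold h in T2 |- *.
      unfold r, rho in *. lra. }
  rewrite Cmod_mult, Cmod_R, Rabs_pos_eq, Rminus_0_r in B by lra.
  assert (B' : Cmod (f' w - f' z - m * h) <= 2 * K * Cmod h ^ 2 / rho).
  { apply Rmult_le_reg_l with (2 * PI); lra. }
  eapply Rle_trans; [exact B'|].
  pose proof (Cmod_ge_0 h) as Ph.
  replace (2 * K * Cmod h ^ 2 / rho) with (2 * K * Cmod h / rho * Cmod h) by (field; lra).
  apply Rmult_le_compat_r; [exact Ph|].
  apply Rmult_le_reg_r with rho; [exact Hrho|].
  unfold Rdiv. rewrite Rmult_assoc, Rinv_l, Rmult_1_r by lra.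
  assert (Q : Cmod h * (2 * K + 1) <= eps * rho).
  { apply Rmult_le_reg_r with (/ (2 * K + 1)); [apply Rinv_0_lt_compat; lra|].
    rewrite Rmult_assoc, Rinv_r, Rmult_1_r by lra. apply Rlt_le. exact H2. }
  nra.
Qed.

(** * Maximum principle and Schwarz lemma *)

Lemma Cmod_circle : forall z rho t, 0 <= rho -> Cmod (z + RtoC rho * expi t - z) = rho.
Proof.
  intros z rho t Hr. replace (z + RtoC rho * expi t - z)%C with (RtoC rho * expi t)%C by ring.
  rewrite Cmod_mult, Cmod_R, Cmod_expi, Rabs_pos_eq by lra. ring.
Qed.

(** By the mean value property the average over the circle of
    [2 Re (conj (G z) G w)] is [2 |G z|^2], and this quantity is at most
    [|G z|^2 + |G w|^2]; the average of [|w|^2] exceeds [|z|^2] by [rho^2], which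
    makes the resulting inequality strict. *)
Lemma no_interior_max : forall G z Rad rho eps,
  (forall w : C, w <> z -> Cmod (w - z) < Rad -> exists l, cdiff G w l) ->
  @ccont C_UniformSpace G z -> 0 < rho < Rad -> 0 < eps ->
  ~ (forall t, Cmod (G (z + RtoC rho * expi t)%C) ^ 2 + eps * Cmod (z + RtoC rho * expi t) ^ 2
      <= Cmod (G z) ^ 2 + eps * Cmod z ^ 2).
Proof.
  intros G z Rad rho eps HG Hc Hr Heps Hmax. pose proof PI_RGT_0 as HPI.
  set (w := fun t => (z + RtoC rho * expi t)%C).
  assert (EG : CI (fun t => G (w t)) 0 (2 * PI) = (RtoC (2 * PI) * G z)%C)
    by exact (mean_value G z Rad rho (G z) HG (cont_tends _ _ Hc) Hr).
  assert (Ei : CI w 0 (2 * PI) = (RtoC (2 * PI) * z)%C).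
  { apply (mean_value (fun v => v) z Rad rho z); [|apply (cont_tends (fun v => v)), ccont_id|exact Hr].
    intros v _ _. eexists. apply cdiff_id. }
  assert (CG : cont_seg (fun t => G (w t)) 0 (2 * PI)).
  { apply circle_cont; [|lra]. intros v Hv. destruct (HG v) as [l Hl]; [|lra|eapply cdiff_cont, Hl].
    intros ->. rewrite Cmod_diag in Hv. lra. }
  assert (Cw : cont_seg w 0 (2 * PI)).
  { apply (circle_cont (fun v => v)); [|lra]. intros v _. apply ccont_id. }
  set (A := (2 * Cconj (G z))%C). set (B := (RtoC (2 * eps) * Cconj z)%C).
  set (F := Cmod (G z) ^ 2 + eps * Cmod z ^ 2) in *.
  assert (E : Re (CI (fun t => (A * G (w t) + B * w t)%C) 0 (2 * PI)) = 2 * PI * (2 * F)).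
  { rewrite CI_plus, CI_scal, CI_scal, EG, Ei; try lra; try assumption; try apply cont_seg_scal; try assumption.
    unfold A, B, F. rewrite !Cmod2_alt. unfold Re, Im, Cconj; simpl. ring. }
  assert (L : Re (CI (fun t => (A * G (w t) + B * w t)%C) 0 (2 * PI)) <=
     RInt (fun _ => 2 * F - eps * rho ^ 2) 0 (2 * PI)).
  { apply Re_CI_le; [lra| | |apply ex_RInt_const].
    - intros t Ht. apply ccont_plus; apply cont_seg_scal with (a := 0) (b := 2 * PI); assumption.
    - intros t _. specialize (Hmax t). fold (w t) in Hmax.
      assert (Hrho : Cmod (w t - z) ^ 2 = rho ^ 2) by (f_equal; apply Cmod_circle; lra).
      assert (Q : Re (A * G (w t)) = Cmod (G z) ^ 2 + Cmod (G (w t)) ^ 2 - Cmod (G (w t) - G z) ^ 2).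
      { unfold A. rewrite !Cmod2_alt. unfold Re, Im, Cconj; simpl. ring. }
      assert (Q' : Re (B * w t) = eps * (Cmod z ^ 2 + Cmod (w t) ^ 2 - Cmod (w t - z) ^ 2)).
      { unfold B. rewrite !Cmod2_alt. unfold Re, Im, Cconj; simpl. ring. }
      change (Re (A * G (w t) + B * w t)) with (Re (A * G (w t)) + Re (B * w t)).
      rewrite Q, Q', Hrho. pose proof (pow2_ge_0 (Cmod (G (w t) - G z))). unfold F in *. lra. }
  rewrite RInt_const, E in L. unfold scal in L; simpl in L; unfold mult in L; simpl in L.
  assert (0 < eps * rho ^ 2) by (apply Rmult_lt_0_compat; [exact Heps|apply pow_lt; lra]).
  assert (0 < 2 * PI * (eps * rho ^ 2)) by (apply Rmult_lt_0_compat; lra). lra.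
Qed.

(** The maximum of [|G|^2 + eps |z|^2] over the closed disk lies on the circle;
    then [eps] tends to [0]. At the origin continuity is enough, so that quotients
    by [z] extended by their limit are covered. *)
Lemma max_principle : forall G r M, 0 < r < 1 ->
  (forall w : C, w <> 0 -> Cmod w < 1 -> exists l, cdiff G w l) -> @ccont C_UniformSpace G (RtoC 0) ->
  (forall z, Cmod z = r -> Cmod (G z) <= M) -> forall z, Cmod z <= r -> Cmod (G z) <= M.
Proof.
  intros G r M Hr HG H0 HM.
  assert (PM : 0 <= M).
  { eapply Rle_trans; [apply Cmod_ge_0|apply (HM (RtoC r))]. rewrite Cmod_R, Rabs_pos_eq; lra. }
  assert (Hcont : forall z, Cmod z < 1 -> @ccont C_UniformSpace G z).
  { intros z Hz. destruct (Ceq_dec z 0) as [->|Hz0]; [exact H0|].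
    destruct (HG z Hz0 Hz) as [l Hl]. eapply cdiff_cont, Hl. }
  assert (Heps : forall eps, 0 < eps -> forall z, Cmod z <= r -> Cmod (G z) ^ 2 <= M ^ 2 + eps).
  { intros eps He.
    set (F := fun z => Cmod (G z) ^ 2 + eps * Cmod z ^ 2).
    destruct (cont_max (fun z => Cmod z <= r) F r) as [z1 [Hz1 Hmax]].
    - apply closed_disk_closed.
    - auto.
    - intros z Hz e Hpe.
      assert (Cz : @continuous C_UniformSpace R_UniformSpace F z).
      { assert (Hsq : forall u : C_UniformSpace -> R, continuous u z -> continuous (fun w => u w ^ 2) z).
        { intros u Hu. apply (continuous_comp u (fun x => x ^ 2)); [exact Hu|].
          apply (ex_derive_continuous (K := R_AbsRing) (V := R_NormedModule)). auto_derive. auto. }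
        apply (continuous_plus (V := R_NormedModule)).
        - apply Hsq, ccont_Cmod, Hcont. lra.
        - apply (continuous_scal_r (K := R_AbsRing) (V := R_NormedModule) eps), Hsq.
          apply (ccont_Cmod (fun w => w)), ccont_id. }
      pose proof (proj1 (filterlim_locally _ _) Cz (mkposreal e Hpe)) as Q.
      destruct (proj1 (locally_Cmod _ _) Q) as [d [Hd H]].
      exists d; split; [exact Hd|]. intros w _ Hw. apply H, Hw.
    - exists 0. rewrite Cmod_0. lra.
    - assert (Hz1r : Cmod z1 = r).
      { destruct (Req_dec (Cmod z1) r) as [E|E]; [exact E|exfalso].
        pose proof (Cmod_ge_0 z1) as P1.
        destruct (Ceq_dec z1 0) as [E0|E0].
        - subst z1. apply (no_interior_max G 0 1 (r / 2) eps); try assumption; try lra.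
          + intros w Hw Hw'. apply HG; [exact Hw|]. replace (w - 0)%C with w in Hw' by ring. exact Hw'.
          + intros t. apply (Hmax (0 + RtoC (r / 2) * expi t)%C).
            assert (Q : Cmod (0 + RtoC (r / 2) * expi t - 0) = r / 2) by (apply Cmod_circle; lra).
            replace (0 + RtoC (r / 2) * expi t - 0)%C with (0 + RtoC (r / 2) * expi t)%C in Q by ring. lra.
        - pose proof (proj1 (Cmod_gt_0 z1) E0) as P1'.
          set (d := Rmin (r - Cmod z1) (Cmod z1)).
          assert (Hd : 0 < d) by (apply Rmin_case; lra).
          pose proof (Rmin_l (r - Cmod z1) (Cmod z1)) as d1. pose proof (Rmin_r (r - Cmod z1) (Cmod z1)) as d2.
          fold d in d1, d2.
          apply (no_interior_max G z1 d (d / 2) eps); try assumption; try lra.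
          + intros w Hw Hw'. apply HG.
            * intros ->. replace (0 - z1)%C with (- z1)%C in Hw' by ring. rewrite Cmod_opp in Hw'. lra.
            * pose proof (Cmod_triangle_inv w z1). lra.
          + apply Hcont. lra.
          + intros t. apply (Hmax (z1 + RtoC (d / 2) * expi t)%C).
            pose proof (Cmod_circle z1 (d / 2) t).
            pose proof (Cmod_triangle_inv (z1 + RtoC (d / 2) * expi t) z1). lra. }
      intros z Hz. specialize (Hmax z Hz). specialize (HM z1 Hz1r). unfold F in Hmax.
      rewrite Hz1r in Hmax.
      assert (Cmod (G z1) ^ 2 <= M ^ 2) by (apply pow_incr; split; [apply Cmod_ge_0|exact HM]).
      assert (0 <= eps * Cmod z ^ 2) by (apply Rmult_le_pos; [lra|apply pow2_ge_0]).
      assert (eps * r ^ 2 <= eps * 1) by (apply Rmult_le_compat_l; nra). lra. }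
  intros z Hz. apply Rnot_lt_le. intros K.
  assert (Q := Heps ((Cmod (G z) ^ 2 - M ^ 2) / 2)). specialize (fun h => Q h z Hz).
  assert (0 < Cmod (G z) ^ 2 - M ^ 2) by nra. lra.
Qed.

(** Extension of [g] across a removable singularity at [z]. *)
Definition patch (g : C -> C) (z L : C) (w : C) : C := if Ceq_dec w z then L else g w.

Lemma patch_at : forall g z L, patch g z L z = L.
Proof. intros. unfold patch. destruct (Ceq_dec z z); congruence. Qed.

Lemma patch_off : forall g z L w, w <> z -> patch g z L w = g w.
Proof. intros. unfold patch. destruct (Ceq_dec w z); congruence. Qed.

Lemma patch_cdiff : forall g z L w l, w <> z -> cdiff g w l -> cdiff (patch g z L) w l.
Proof.
  intros g z L w l Hw. apply cdiff_ext_loc.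
  exists (Cmod (w - z)). split; [apply Cmod_gt_0, Cminus_neq_0, Hw|].
  intros v Hv. symmetry. apply patch_off. intros ->. rewrite Cmod_minus_sym in Hv. lra.
Qed.

Lemma patch_cont : forall g z L, tends_at g z L -> @ccont C_UniformSpace (patch g z L) z.
Proof.
  intros g z L H eps Heps. destruct (H eps Heps) as [d [Hd H']]. apply locally_Cmod.
  exists d; split; [exact Hd|]. intros w Hw. rewrite patch_at.
  destruct (Ceq_dec w z) as [->|E].
  - rewrite patch_at. rewrite Cmod_diag. exact Heps.
  - rewrite patch_off by exact E. apply H'; assumption.
Qed.

(** The maximum principle for [phi w / w] on circles of radius tending to [1]. *)
Lemma schwarz : forall phi L,
  (forall w : C, w <> 0 -> Cmod w < 1 -> exists l, cdiff phi w l) ->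
  (forall w : C, w <> 0 -> Cmod w < 1 -> Cmod (phi w) <= 1) ->
  tends_at (fun w => (phi w / w)%C) 0 L ->
  (forall w : C, w <> 0 -> Cmod w < 1 -> Cmod (phi w) <= Cmod w) /\ Cmod L <= 1.
Proof.
  intros phi L Hd Hb HL.
  set (G := patch (fun w => (phi w / w)%C) 0 L).
  assert (HG : forall w : C, w <> 0 -> Cmod w < 1 -> exists l, cdiff G w l).
  { intros w Hw Hw'. destruct (Hd w Hw Hw') as [l Hl]. eexists. apply patch_cdiff; [exact Hw|].
    apply cdiff_div; [exact Hl|apply cdiff_id|exact Hw]. }
  assert (B : forall z, Cmod z < 1 -> Cmod (G z) <= 1).
  { intros z Hz. pose proof (Cmod_ge_0 z) as Pz. apply Rnot_lt_le. intros K.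
    set (m := Rmax (Cmod z) (/ Cmod (G z))).
    assert (Hm : 0 < m < 1).
    { split.
      - eapply Rlt_le_trans; [|apply Rmax_r]. apply Rinv_0_lt_compat; lra.
      - apply Rmax_case; [exact Hz|]. rewrite <- Rinv_1. apply Rinv_lt_contravar; lra. }
    set (r := (1 + m) / 2). assert (Hr : m < r < 1) by (unfold r; lra).
    assert (Q : Cmod (G z) <= / r).
    { apply (max_principle G r); try assumption; try lra.
      - apply patch_cont, HL.
      - intros w Hw. assert (w0 : w <> 0) by (apply Cmod_gt_0; lra).
        unfold G. rewrite patch_off by exact w0. rewrite Cmod_div, Hw by exact w0.
        unfold Rdiv. rewrite <- (Rmult_1_l (/ r)) at 2. apply Rmult_le_compat_r.
        + apply Rlt_le, Rinv_0_lt_compat; lra.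
        + apply Hb; [exact w0|lra].
      - pose proof (Rmax_l (Cmod z) (/ Cmod (G z))). fold m in H. lra. }
    assert (/ Cmod (G z) < r) by (pose proof (Rmax_r (Cmod z) (/ Cmod (G z))) as T; fold m in T; lra).
    apply Rinv_lt_contravar in H; [|apply Rmult_lt_0_compat; [apply Rinv_0_lt_compat|]; lra].
    rewrite Rinv_inv in H. lra. }
  split.
  - intros w Hw Hw'. specialize (B w Hw'). unfold G in B. rewrite patch_off in B by exact Hw.
    rewrite Cmod_div in B by exact Hw. pose proof (proj1 (Cmod_gt_0 w) Hw).
    apply Rmult_le_reg_r with (/ Cmod w); [apply Rinv_0_lt_compat; lra|].
    rewrite Rinv_r by lra. exact B.
  - assert (H := B 0). unfold G in H. rewrite patch_at in H. apply H. rewrite Cmod_0. lra.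
Qed.

(** * Taylor expansion *)

(** The quotient is differentiable at the origin because [f'] is: integrating the
    first order expansion of [f'] gives the second order expansion of [f]. *)
Lemma hol_remove_root : forall f f', hol f f' -> exists g g', hol g g' /\ g 0 = f' 0 /\
  forall z, f z = (f 0 + z * g z)%C.
Proof.
  intros f f' Hf. destruct (hol_deriv f f' Hf) as [f'' Hf'].
  set (g := patch (slope f 0) 0 (f' 0)).
  assert (Hg : forall z, f z = (f 0 + z * g z)%C).
  { intros z. unfold g. destruct (Ceq_dec z 0) as [->|E].
    - rewrite patch_at. ring.
    - rewrite patch_off by exact E. unfold slope. field. replace (z - 0)%C with z by ring. exact E. }
  assert (Hd : forall z, Cmod z < 1 -> exists l, cdiff g z l).
  { intros z Hz. destruct (Ceq_dec z 0) as [->|E].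
    2: { destruct (slope_cdiff f 0 z (f' z) E (Hf z Hz)) as [m Hm]. exists m. apply patch_cdiff; assumption. }
    set (m := f'' 0). exists (m / 2)%C. apply cdiff_eps. intros eps Heps.
    assert (H0 : Cmod 0 < 1) by (rewrite Cmod_0; lra).
    destruct (proj1 (cdiff_eps _ _ _) (Hf' 0 H0) eps Heps) as [d [Hd1 Hd2]].
    exists (Rmin d 1). split; [apply Rmin_case; lra|]. intros w Hw.
    replace (w - 0)%C with w in * by ring.
    pose proof (Rlt_le_trans _ _ _ Hw (Rmin_l _ _)) as w1.
    pose proof (Rlt_le_trans _ _ _ Hw (Rmin_r _ _)) as w2.
    unfold g at 2. rewrite patch_at.
    destruct (Ceq_dec w 0) as [->|E].
    { unfold g. rewrite patch_at. replace (f' 0 - f' 0 - m / 2 * 0)%C with (RtoC 0) by ring.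
      rewrite Cmod_0. lra. }
    unfold g. rewrite patch_off by exact E. unfold slope. replace (w - 0)%C with w by ring.
    pose proof (proj1 (Cmod_gt_0 w) E) as Pw.
    assert (K : Cmod ((f w - f' 0 * w - m / 2 * (w * w)) - (f 0 - f' 0 * 0 - m / 2 * (0 * 0)))
       <= eps * Cmod w * Cmod (w - 0)).
    { assert (Hsg : forall t, 0 <= t <= 1 -> Cmod (segment 0 w t) <= Cmod w).
      { intros t Ht. pose proof (Cmod_ge_0 w). apply segment_in_disk; try rewrite Cmod_0; lra. }
      apply (cdiff_Cmod_le (fun v => (f v - f' 0 * v - m / 2 * (v * v))%C)
        (fun v => (f' v - f' 0 - m * v)%C)).
      - intros t Ht. specialize (Hsg t Ht). eapply diff_val; cycle 1.
        + apply diff_minus; [apply diff_minus|].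
          * apply Hf. lra.
          * apply diff_scal, cdiff_id.
          * apply diff_scal, cdiff_mult; apply cdiff_id.
        + cbv beta. field.
      - intros t Ht. specialize (Hsg t Ht). specialize (Hd2 (segment 0 w t)).
        replace (segment 0 w t - 0)%C with (segment 0 w t) in Hd2 by ring.
        eapply Rle_trans; [apply Hd2; lra|]. apply Rmult_le_compat_l; lra. }
    replace (f w - f' 0 * w - m / 2 * (w * w) - (f 0 - f' 0 * 0 - m / 2 * (0 * 0)))%C
      with (((f w - f 0) / w - f' 0 - m / 2 * w) * w)%C in K by (field; exact E).
    rewrite Cmod_mult in K. replace (w - 0)%C with w in K by ring.
    apply Rmult_le_reg_r with (Cmod w); assumption. }
  exists g, (fun z => match excluded_middle_informative (Cmod z < 1) with
     | left H => proj1_sig (constructive_indefinite_description _ (Hd z H)) | right _ => RtoC 0 end).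
  split; [|split; [unfold g; apply patch_at|exact Hg]].
  intros z Hz. destruct (excluded_middle_informative (Cmod z < 1)) as [H|H]; [|contradiction].
  exact (proj2_sig (constructive_indefinite_description _ (Hd z H))).
Qed.

Fixpoint psum (c : nat -> C) (z : C) (n : nat) : C :=
  match n with O => 0 | S n => (psum c z n + c n * z ^ n)%C end.

Lemma sum_n_psum : forall c z n,
  sum_n (fun k => @scal C_AbsRing C_NormedModule (pow_n z k) (c k)) n = psum c z (S n).
Proof.
  assert (Hp : forall z k, @pow_n C_AbsRing z k = (z ^ k)%C).
  { intros z k. induction k as [|k IH]; [reflexivity|]. simpl. rewrite IH. reflexivity. }
  intros c z n. induction n as [|n IH].
  - rewrite sum_O. rewrite Hp. simpl. change ((1 * c 0%nat)%C = (0 + c 0%nat * 1)%C). ring.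
  - rewrite sum_Sn, IH, Hp. simpl.
    change (plus (psum c z n + c n * z ^ n)%C (scal (z * z ^ n)%C (c (S n))) =
      (psum c z n + c n * z ^ n + c (S n) * (z * z ^ n))%C).
    change ((psum c z n + c n * z ^ n + (z * z ^ n) * c (S n))%C =
      (psum c z n + c n * z ^ n + c (S n) * (z * z ^ n))%C). ring.
Qed.

Lemma is_pseries_psum : forall c z l, @is_pseries C_AbsRing C_NormedModule c z l <->
  forall eps, 0 < eps -> exists N, forall n, (N <= n)%nat -> Cmod (psum c z n - l) < eps.
Proof.
  intros c z l. unfold is_pseries, is_series. split.
  - intros H eps Heps.
    destruct (H (fun w => Cmod (w - l) < eps)) as [N HN].
    { apply locally_Cmod. exists eps. auto. }
    exists (S N). intros [|n] Hn; [lia|]. rewrite <- sum_n_psum. apply HN. lia.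
  - intros H P HP. destruct (proj1 (locally_Cmod _ _) HP) as [d [Hd Hd']].
    destruct (H d Hd) as [N HN]. exists N. intros n Hn. apply Hd'.
    rewrite sum_n_psum. apply HN. lia.
Qed.

Lemma rdiff_expi_scal : forall k t, rdiff (fun t => expi (k * t)) t (RtoC k * (Ci * expi (k * t)))%C.
Proof.
  intros k t. apply rdiff_of_parts; unfold Re, Im, expi; simpl; auto_derive; auto; ring.
Qed.

Lemma CI_expi_opp : forall j, CI (fun t => expi (- INR (S j) * t)) 0 (2 * PI) = 0.
Proof.
  intros j. set (k := - INR (S j)).
  assert (Hk : RtoC k <> 0).
  { intros E. apply RtoC_inj in E. unfold k in E. pose proof (pos_INR j). rewrite S_INR in E. lra. }
  assert (HC : Ci <> 0) by (intros E; apply (f_equal Im) in E; unfold Im in E; simpl in E; lra).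
  assert (Hc : forall t, ccont (fun t => expi (k * t)) t) by (intros t; eapply rdiff_cont, rdiff_expi_scal).
  rewrite (CI_FTC (fun t => (/ (RtoC k * Ci) * expi (k * t))%C)).
  - replace (expi (k * (2 * PI))) with (expi (k * 0)); [ring|].
    unfold expi, k. replace (- INR (S j) * 0) with 0 by ring.
    replace (- INR (S j) * (2 * PI)) with (- (0 + 2 * INR (S j) * PI)) by ring.
    rewrite cos_neg, sin_neg, cos_period, sin_period, cos_0, sin_0. f_equal. ring.
  - apply two_PI_pos.
  - intros t _. apply Hc.
  - intros t _. apply diff_val with (/ (RtoC k * Ci) * (RtoC k * (Ci * expi (k * t))))%C.
    + field. auto.
    + apply diff_scal, rdiff_expi_scal.
Qed.

Lemma expi_plus : forall a b, expi (a + b) = (expi a * expi b)%C.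
Proof.
  intros a b. unfold expi. rewrite cos_plus, sin_plus. apply C_ext; unfold Re, Im; simpl; ring.
Qed.

(** Dividing out the root at [0] of [g_n - g_n(0)] again and again, one gets
    [f = psum c z n + z^n g_n]. The Fourier integrals of [f] over the circle of
    radius [rho] give [|c_n| rho^n <= M], hence [|g_n| <= (n + 1) M / rho^n] on
    that circle, and inside it by the maximum principle; so the remainder tends to
    [0] when [|z| < rho]. *)
Lemma hol_taylor : forall f f', hol f f' -> exists c, taylor_coefficients f c.
Proof.
  intros f f' Hf. pose proof PI_RGT_0 as HPI.
  set (T := {p : (C -> C) * (C -> C) | hol (fst p) (snd p)}).
  assert (Hstep : forall p : T, exists q : T,
    forall z, fst (proj1_sig p) z = (fst (proj1_sig p) 0 + z * fst (proj1_sig q) z)%C).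
  { intros [[g g'] Hg]. destruct (hol_remove_root g g' Hg) as [h [h' [Hh [_ E]]]].
    exists (exist _ (h, h') Hh). exact E. }
  set (step := fun p => proj1_sig (constructive_indefinite_description _ (Hstep p))).
  set (s := fun n => Nat.iter n step (exist _ (f, f') Hf : T)).
  set (g := fun n => fst (proj1_sig (s n))).
  assert (Hg : forall n z, g n z = (g n 0 + z * g (S n) z)%C).
  { intros n. exact (proj2_sig (constructive_indefinite_description _ (Hstep (s n)))). }
  assert (Hgd : forall n w, Cmod w < 1 -> exists l, cdiff (g n) w l).
  { intros n w Hw. exists (snd (proj1_sig (s n)) w). exact (proj2_sig (s n) w Hw). }
  assert (Hgc : forall n w, Cmod w < 1 -> @ccont C_UniformSpace (g n) w).
  { intros n w Hw. destruct (Hgd n w Hw) as [l Hl]. eapply cdiff_cont, Hl. }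
  set (c := fun n => g n 0). exists c.
  assert (Hexp : forall n z, f z = (psum c z n + z ^ n * g n z)%C).
  { induction n as [|n IH]; intros z.
    - simpl. unfold g; simpl. ring.
    - rewrite (IH z), (Hg n z) at 1. simpl. unfold c. ring. }
  intros z Hz. unfold in_disk in Hz. pose proof (Cmod_ge_0 z) as Pz.
  set (rho := (1 + Cmod z) / 2). assert (Hrho : Cmod z < rho < 1) by (unfold rho; lra).
  assert (Prho : 0 < rho) by lra.
  destruct (hol_bounded f f' rho Hf) as [M HM]; [lra|].
  assert (PM : 0 <= M).
  { eapply Rle_trans; [apply Cmod_ge_0|apply (HM 0)]. rewrite Cmod_0; lra. }
  assert (Hcirc : forall n a b, cont_seg (fun t => g n (0 + RtoC rho * expi t)%C) a b).
  { intros n. apply circle_cont; [|lra]. intros w Hw. apply Hgc.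
    replace (w - 0)%C with w in Hw by ring. lra. }
  assert (He : forall k t, ccont (fun t => expi (k * t)) t).
  { intros k t. eapply rdiff_cont, rdiff_expi_scal. }
  (* the n-th Fourier coefficient of f on the circle *)
  assert (HI : forall j n,
    CI (fun t => (expi (- INR j * t) * g n (0 + RtoC rho * expi t))%C) 0 (2 * PI)
    = (RtoC (2 * PI) * c (n + j)%nat * RtoC rho ^ j)%C).
  { induction j as [|j IH]; intros n.
    - rewrite Nat.add_0_r. unfold c.
      rewrite (CI_ext _ (fun t => g n (0 + RtoC rho * expi t)%C)); [|intros t _|lra].
      + rewrite (mean_value (g n) 0 1 rho (g n 0)); [simpl; ring| | |lra].
        * intros w _ Hw. apply Hgd. replace (w - 0)%C with w in Hw by ring. exact Hw.
        * apply cont_tends, Hgc. rewrite Cmod_0; lra.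
      + simpl. replace (- 0 * t) with 0 by ring. rewrite expi_0. ring.
    - rewrite (CI_ext _ (fun t => (g n 0 * expi (- INR (S j) * t)
        + RtoC rho * (expi (- INR j * t) * g (S n) (0 + RtoC rho * expi t)))%C)); [|intros t _|lra].
      + rewrite CI_plus, CI_scal, CI_scal, CI_expi_opp, IH; try lra.
        * replace (S n + j)%nat with (n + S j)%nat by lia. simpl. ring.
        * intros t Ht. apply ccont_mult; [apply He|apply (Hcirc _ 0 (2 * PI)), Ht].
        * intros t _. apply He.
        * intros t _. apply ccont_mult; [apply ccont_const|apply He].
        * intros t Ht. apply ccont_mult; [apply ccont_const|].
          apply ccont_mult; [apply He|apply (Hcirc _ 0 (2 * PI)), Ht].
      + rewrite (Hg n). replace (expi (- INR j * t)) with (expi (- INR (S j) * t) * expi t)%C.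
        * ring.
        * rewrite <- expi_plus. f_equal. rewrite S_INR. ring. }
  assert (Hck : forall n, Cmod (c n) * rho ^ n <= M).
  { intros n. assert (B := HI n 0%nat). simpl in B.
    assert (B' : Cmod (CI (fun t => (expi (- INR n * t) * g 0%nat (0 + RtoC rho * expi t))%C) 0 (2 * PI)) <= M * (2 * PI - 0)).
    { apply CI_bound; [lra| |].
      - intros t Ht. apply ccont_mult; [apply He|apply (Hcirc _ 0 (2 * PI)), Ht].
      - intros t _. rewrite Cmod_mult, Cmod_expi, Rmult_1_l. apply (HM (0 + RtoC rho * expi t)%C).
        right. pose proof (Cmod_circle 0 rho t) as Q.
        replace (0 + RtoC rho * expi t - 0)%C with (0 + RtoC rho * expi t)%C in Q by ring. apply Q. lra. }
    rewrite B, !Cmod_mult, Cmod_pow, !Cmod_R, !Rabs_pos_eq, Rminus_0_r in B' by lra.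
    apply Rmult_le_reg_l with (2 * PI); lra. }
  assert (Hps : forall n w, Cmod w <= rho -> Cmod (psum c w n) <= INR n * M).
  { induction n as [|n IH]; intros w Hw.
    - simpl. rewrite Cmod_0. lra.
    - rewrite S_INR. simpl. eapply Rle_trans; [apply Cmod_triangle|].
      specialize (IH w Hw). rewrite Cmod_mult, Cmod_pow.
      assert (Cmod (c n) * Cmod w ^ n <= M); [|lra].
      eapply Rle_trans; [|apply (Hck n)]. apply Rmult_le_compat_l; [apply Cmod_ge_0|].
      apply pow_incr. split; [apply Cmod_ge_0|exact Hw]. }
  assert (Hgb : forall n, Cmod (g n z) <= (INR n + 1) * M / rho ^ n).
  { intros n. pose proof (pow_lt rho n Prho) as Pn.
    apply (max_principle (g n) rho); try lra.
    - intros w _ Hw. apply Hgd, Hw.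
    - apply Hgc. rewrite Cmod_0; lra.
    - intros w Hw. apply Rmult_le_reg_r with (rho ^ n); [exact Pn|].
      unfold Rdiv. rewrite Rmult_assoc, Rinv_l, Rmult_1_r by lra.
      rewrite <- Hw at 1. rewrite <- Cmod_pow, <- Cmod_mult.
      replace (g n w * w ^ n)%C with (f w - psum c w n)%C by (rewrite (Hexp n w) at 1; ring).
      eapply Rle_trans; [apply Cmod_triangle_sub|].
      specialize (HM w). specialize (Hps n w). lra. }
  apply is_pseries_psum.
  set (q := Cmod z / rho). assert (Hq : 0 <= q < 1).
  { split; [apply Rdiv_le_0_compat; lra|]. apply Rmult_lt_reg_r with rho; [lra|].
    unfold q, Rdiv. rewrite Rmult_assoc, Rinv_l by lra. lra. }
  set (p := sqrt q). assert (Hp : 0 <= p < 1).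
  { split; [apply sqrt_pos|]. rewrite <- sqrt_1. apply sqrt_lt_1; lra. }
  assert (Hpq : p * p = q) by (apply sqrt_sqrt; lra).
  assert (Hgeo : forall n, (INR n + 1) * p ^ n <= / (1 - p)).
  { intros n. assert (Hgm : forall n, (INR n + 1) * p ^ n * (1 - p) <= 1 - p ^ (S n)).
    { induction n0 as [|m IH]; [simpl; lra|]. rewrite S_INR.
      pose proof (pow_le p m (proj1 Hp)). pose proof (pos_INR m). simpl in *.
      assert (0 <= (INR m + 1) * p ^ m * (1 - p)) by (repeat apply Rmult_le_pos; lra).
      nra. }
    specialize (Hgm n). pose proof (pow_le p (S n) (proj1 Hp)).
    apply Rmult_le_reg_r with (1 - p); [lra|]. rewrite Rinv_l; lra. }
  intros eps Heps.
  destruct (pow_lt_1_zero p) with (y := eps * (1 - p) / (M + 1)) as [N HN].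
  { rewrite Rabs_pos_eq; lra. }
  { apply Rdiv_lt_0_compat; nra. }
  exists N. intros n Hn. specialize (HN n Hn). rewrite Rabs_pos_eq in HN by (apply pow_le; lra).
  rewrite (Hexp n z). replace (psum c z n - (psum c z n + z ^ n * g n z))%C with (- (z ^ n * g n z))%C by ring.
  rewrite Cmod_opp, Cmod_mult, Cmod_pow.
  apply Rle_lt_trans with (Cmod z ^ n * ((INR n + 1) * M / rho ^ n)).
  { apply Rmult_le_compat_l; [apply pow_le, Pz|apply Hgb]. }
  replace (Cmod z ^ n * ((INR n + 1) * M / rho ^ n)) with (M * ((INR n + 1) * p ^ n) * p ^ n).
  2: { replace (Cmod z) with (p * p * rho) by (rewrite Hpq; unfold q; field; lra).
       rewrite !Rpow_mult_distr. field. apply pow_nonzero; lra. }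
  specialize (Hgeo n). pose proof (pow_le p n (proj1 Hp)).
  assert (Pi : 0 < / (1 - p)) by (apply Rinv_0_lt_compat; lra).
  apply Rle_lt_trans with (M * / (1 - p) * p ^ n).
  { apply Rmult_le_compat_r; [assumption|]. apply Rmult_le_compat_l; assumption. }
  apply Rle_lt_trans with ((M + 1) * / (1 - p) * p ^ n).
  { apply Rmult_le_compat_r; [assumption|]. apply Rmult_le_compat_r; lra. }
  replace eps with ((M + 1) * / (1 - p) * (eps * (1 - p) / (M + 1))) by (field; lra).
  apply Rmult_lt_compat_l; [apply Rmult_lt_0_compat; lra|exact HN].
Qed.

(** * The first point where the real part reaches a level *)

Lemma derive_nonpos_at_right_end : forall e l,
  is_derive e 1 l -> (forall t, 0 <= t < 1 -> e 1 <= e t) -> l <= 0.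
Proof.
  intros e l He Hmin. apply Rnot_lt_le. intros Hl.
  destruct (proj1 (is_derive_eps _ _ _) He (l / 2)) as [d [Hd H]]; [lra|].
  set (t := 1 - Rmin (d / 2) 1).
  assert (Hm : 0 < Rmin (d / 2) 1) by (apply Rmin_case; lra).
  pose proof (Rmin_l (d / 2) 1). pose proof (Rmin_r (d / 2) 1).
  assert (Ht : Rabs (t - 1) = 1 - t) by (unfold t; rewrite Rabs_left; lra).
  specialize (H t). rewrite Ht in H. specialize (Hmin t).
  assert (K : e t - e 1 - l * (t - 1) <= l / 2 * (1 - t)).
  { eapply Rle_trans; [apply Rle_abs|]. apply H. unfold t; lra. }
  unfold t in *. nra.
Qed.

Lemma derive_zero_at_min : forall e l,
  is_derive e 0 l -> (forall t, e 0 <= e t) -> l = 0.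
Proof.
  intros e l He Hmin.
  assert (H1 : l <= 0).
  { apply (derive_nonpos_at_right_end (fun t => e (t - 1))).
    - apply (is_derive_ext (fun t => e (t - 1))); [reflexivity|].
      replace l with (1 * l) by ring.
      apply (is_derive_comp (K := R_AbsRing) (V := R_NormedModule) e (fun t => t - 1)).
      + replace (1 - 1) with 0 by ring. exact He.
      + auto_derive; auto; ring.
    - intros t _. replace (1 - 1) with 0 by ring. apply Hmin. }
  assert (H2 : - l <= 0).
  { apply (derive_nonpos_at_right_end (fun t => e (1 - t))).
    - replace (- l) with (- (1) * l) by ring.
      apply (is_derive_comp (K := R_AbsRing) (V := R_NormedModule) e (fun t => 1 - t)).
      + replace (1 - 1) with 0 by ring. exact He.
      + auto_derive; auto; ring.
    - intros t _. replace (1 - 1) with 0 by ring. apply Hmin. }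
  lra.
Qed.

Lemma ge_at_right_end : forall e l c,
  is_derive e 1 l -> (forall t, 0 <= t < 1 -> c < e t) -> c <= e 1.
Proof.
  intros e l c He Hc. apply Rnot_lt_le. intros H.
  destruct (proj1 (is_derive_eps _ _ _) He 1) as [d [Hd K]]; [lra|].
  pose proof (Rabs_pos l) as Pl.
  set (s := Rmin (Rmin (d / 2) 1) ((c - e 1) / (Rabs l + 1) / 2)).
  assert (Hs : 0 < s).
  { repeat apply Rmin_pos; try lra. apply Rdiv_lt_0_compat; [apply Rdiv_lt_0_compat|]; lra. }
  pose proof (Rmin_l (Rmin (d / 2) 1) ((c - e 1) / (Rabs l + 1) / 2)) as s1.
  pose proof (Rmin_r (Rmin (d / 2) 1) ((c - e 1) / (Rabs l + 1) / 2)) as s2. fold s in s1, s2.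
  pose proof (Rmin_l (d / 2) 1). pose proof (Rmin_r (d / 2) 1).
  specialize (K (1 - s)). specialize (Hc (1 - s)).
  assert (E : Rabs (1 - s - 1) = s) by (rewrite Rabs_left; lra). rewrite E in K.
  assert (K' : e (1 - s) - e 1 - l * (1 - s - 1) <= 1 * s).
  { eapply Rle_trans; [apply Rle_abs|]. apply K; lra. }
  pose proof (Rle_abs (- l)) as Q. rewrite Rabs_Ropp in Q.
  assert (s * (Rabs l + 1) <= (c - e 1) / 2).
  { replace ((c - e 1) / 2) with ((c - e 1) / (Rabs l + 1) / 2 * (Rabs l + 1)) by (field; lra).
    apply Rmult_le_compat_r; lra. }
  nra.
Qed.

Lemma rdiff_ray : forall p p' z, hol p p' -> Cmod z < 1 ->
  rdiff (fun t => p (RtoC t * z)%C) 1 (z * p' z)%C.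
Proof.
  intros p p' z Hp Hz.
  apply diff_val with (p' z * (1 * z + RtoC 1 * 0))%C; [ring|].
  apply (rdiff_comp p (fun t => (RtoC t * z)%C)).
  - replace (RtoC 1 * z)%C with z by ring. apply Hp, Hz.
  - apply (rdiff_mult (fun t => RtoC t) (fun _ => z)); [apply rdiff_RtoC|apply diff_const].
Qed.

Lemma Cmod_ray : forall t z, 0 <= t -> Cmod (RtoC t * z) = t * Cmod z.
Proof. intros t z Ht. rewrite Cmod_mult, Cmod_R, Rabs_pos_eq by exact Ht. reflexivity. Qed.

(** Take [z0] of least modulus among the points where [Re p <= c]. On the circle
    through [z0] the minimum of [Re p] is at [z0], so [z0 p'(z0)] is real; along the
    radius [Re p] comes down to [c], so [z0 p'(z0) <= 0]. *)
Lemma first_touch : forall p p' c z1, hol p p' -> c < Re (p 0) -> Cmod z1 < 1 -> Re (p z1) <= c ->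
  exists z0 : C, z0 <> 0 /\ Cmod z0 < 1 /\ Re (p z0) = c /\ Im (z0 * p' z0) = 0 /\
    Re (z0 * p' z0) <= 0 /\ (forall z, Cmod z < Cmod z0 -> c < Re (p z)).
Proof.
  intros p p' c z1 Hp Hc Hz1 Hz1c.
  destruct (cont_max (fun z => Cmod z <= Cmod z1 /\ Re (p z) <= c) (fun z => - Cmod z) (Cmod z1))
    as [z0 [[Hz0 Hz0c] Hmax]].
  - intros z H. assert (Hzz : Cmod z <= Cmod z1).
    { apply closed_disk_closed. intros d Hd. destruct (H d Hd) as [w [[Hw _] Hwz]]. exists w; auto. }
    split; [exact Hzz|]. apply Rnot_lt_le. intros K.
    assert (Cz := cdiff_cont _ _ _ (Hp z (Rle_lt_trans _ _ _ Hzz Hz1))).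
    destruct (proj1 (locally_Cmod _ _) (Cz (Re (p z) - c) ltac:(lra))) as [d [Hd Hd']].
    destruct (H d Hd) as [w [[_ Hw] Hwz]]. specialize (Hd' w Hwz).
    pose proof (re_le_Cmod (p w - p z)) as Q.
    replace (Re (p w - p z)%C) with (Re (p w) - Re (p z)) in Q by (unfold Re; simpl; ring).
    revert Q. unfold Rabs; destruct Rcase_abs; lra.
  - tauto.
  - intros z _ eps Heps. exists eps; split; [exact Heps|]. intros w _ Hw.
    pose proof (Cmod_triangle_inv w z) as Q1. pose proof (Cmod_triangle_inv z w) as Q2.
    rewrite Cmod_minus_sym in Q2. apply Rabs_def1; lra.
  - exists z1. split; [lra|exact Hz1c].
  - assert (Hin : forall z, Cmod z < Cmod z0 -> c < Re (p z)).
    { intros z Hz. apply Rnot_le_lt. intros K. assert (- Cmod z <= - Cmod z0) by (apply Hmax; lra). lra. }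
    assert (H1 : Cmod z0 < 1) by lra.
    assert (Hne : z0 <> 0) by (intros ->; lra).
    pose proof (proj1 (Cmod_gt_0 z0) Hne) as Pz0.
    assert (Hcirc : forall z, Cmod z = Cmod z0 -> c <= Re (p z)).
    { intros z Hz. replace z with (RtoC 1 * z)%C by ring.
      apply (ge_at_right_end (fun t => Re (p (RtoC t * z)%C)) (Re (z * p' z))).
      - apply (rdiff_Re (fun t => p (RtoC t * z)%C)). apply rdiff_ray; [exact Hp|lra].
      - intros t Ht. apply Hin. rewrite Cmod_ray, Hz by lra. nra. }
    assert (E : Re (p z0) = c) by (apply Rle_antisym; [exact Hz0c|apply Hcirc; reflexivity]).
    exists z0. repeat split; try assumption.
    + (* the circle through z0 gives a tangential critical point *)
      assert (D : - Im (z0 * p' z0) = 0); [|lra].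
      apply (derive_zero_at_min (fun t => Re (p (z0 * expi t)%C))).
      * replace (- Im (z0 * p' z0)%C) with (Re (p' z0 * (z0 * Ci)))
          by (unfold Re, Im; simpl; ring).
        apply (rdiff_Re (fun t => p (z0 * expi t)%C)).
        apply (rdiff_comp p (fun t => (z0 * expi t)%C)).
        { rewrite expi_0, Cmult_1_r. apply Hp, H1. }
        apply diff_scal. apply diff_val with (Ci * expi 0)%C; [rewrite expi_0; ring|].
        apply rdiff_expi.
      * intros t. rewrite expi_0, Cmult_1_r, E. apply Hcirc. rewrite Cmod_mult, Cmod_expi. ring.
    + apply (derive_nonpos_at_right_end (fun t => Re (p (RtoC t * z0)%C))).
      * apply (rdiff_Re (fun t => p (RtoC t * z0)%C)). apply rdiff_ray; assumption.
      * intros t Ht. replace (RtoC 1 * z0)%C with z0 by ring. rewrite E. apply Rlt_le, Hin.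
        rewrite Cmod_ray by lra. nra.
Qed.

Lemma Cmod_sub_1_lt : forall w, 1 / 2 < Re w -> Cmod (w - 1) < Cmod w.
Proof.
  intros w Hw.
  assert (Cmod (w - 1) ^ 2 < Cmod w ^ 2).
  { rewrite !Cmod2_alt. unfold Re, Im in *; simpl in *. nra. }
  pose proof (Cmod_ge_0 w). pose proof (Cmod_ge_0 (w - 1)). nra.
Qed.

Lemma Re_pos_neq_0 : forall w : C, 0 < Re w -> w <> 0.
Proof. intros w Hw ->. unfold Re in Hw; simpl in Hw. lra. Qed.

Lemma tends_at_ext : forall g h z L, (forall w, w <> z -> Cmod (w - z) < 1 -> g w = h w) ->
  tends_at g z L -> tends_at h z L.
Proof.
  intros g h z L E H eps Heps. destruct (H eps Heps) as [d [Hd H']].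
  exists (Rmin d 1). split; [apply Rmin_case; lra|].
  intros w Hw Hw'. pose proof (Rmin_l d 1). pose proof (Rmin_r d 1).
  rewrite <- E by (exact Hw || lra). apply H'; [exact Hw|lra].
Qed.

(** Jack's lemma for [phi = (p - 1) / p]. This function maps the disk of radius
    [|z0|] into the unit disk and fixes [0], so [|phi (t z0)| <= t] by Schwarz's
    lemma; equality holds at [t = 1], where the comparison of derivatives gives the
    bound. *)
Lemma jack_half : forall (p p' : C -> C) (z0 : C), hol p p' -> p 0 = 1 -> z0 <> 0 -> Cmod z0 < 1 ->
  Re (p z0) = 1 / 2 -> (forall z, Cmod z < Cmod z0 -> 1 / 2 < Re (p z)) ->
  Re (z0 * p' z0) <= - (Re (p z0) ^ 2 + Im (p z0) ^ 2).
Proof.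
  intros p p' z0 Hp Hp0 Hne H1 Hc Hin.
  pose proof (proj1 (Cmod_gt_0 z0) Hne) as Pz0.
  assert (Hsc : forall w, Cmod w < 1 -> Cmod (z0 * w) < Cmod z0).
  { intros w Hw. rewrite Cmod_mult. nra. }
  set (phi := fun w => ((p (z0 * w) - 1) / p (z0 * w))%C).
  assert (Hphi : forall w, Cmod w < 1 -> exists l, cdiff phi w l).
  { intros w Hw. specialize (Hsc w Hw).
    assert (D : cdiff (fun w => p (z0 * w)%C) w (p' (z0 * w)%C * (z0 * 1))%C).
    { apply (cdiff_comp p (fun w => (z0 * w)%C)); [apply Hp; lra|apply diff_scal, cdiff_id]. }
    eexists. apply cdiff_div; [apply diff_minus; [exact D|apply diff_const]|exact D|].
    apply Re_pos_neq_0. specialize (Hin _ Hsc). lra. }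
  assert (Hphi0 : phi 0 = 0).
  { unfold phi. rewrite Cmult_0_r, Hp0. field. }
  destruct (Hphi 0) as [L HL]; [rewrite Cmod_0; lra|].
  destruct (schwarz phi L) as [S _].
  - intros w _ Hw. apply Hphi, Hw.
  - intros w _ Hw. specialize (Hin _ (Hsc w Hw)).
    apply Cmod_div_le; [apply Re_pos_neq_0; lra|]. pose proof (Cmod_sub_1_lt _ Hin). lra.
  - apply tends_at_ext with (slope phi 0); [|apply slope_tends, HL].
    intros w Hw _. unfold slope. rewrite Hphi0. replace (w - 0)%C with w by ring.
    unfold Cdiv. ring.
  - set (X := fun t => Re (p (RtoC t * z0)%C)). set (Y := fun t => Im (p (RtoC t * z0)%C)).
    pose proof (rdiff_ray p p' z0 Hp H1) as D.
    assert (DX : is_derive X 1 (Re (z0 * p' z0))) by (apply (rdiff_Re _ _ _ D)).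
    assert (DY : is_derive Y 1 (Im (z0 * p' z0))) by (apply (rdiff_Im _ _ _ D)).
    assert (E1 : (RtoC 1 * z0)%C = z0) by ring.
    assert (EX : X 1 = Re (p z0)) by (unfold X; rewrite E1; reflexivity).
    assert (EY : Y 1 = Im (p z0)) by (unfold Y; rewrite E1; reflexivity).
    set (n := fun t => t ^ 2 * (X t ^ 2 + Y t ^ 2) - ((X t - 1) ^ 2 + Y t ^ 2)).
    assert (Dn : is_derive n 1 (2 * (X 1 ^ 2 + Y 1 ^ 2) + 2 * Re (z0 * p' z0))).
    { unfold n. auto_derive.
      - repeat split; try (eexists; eassumption).
      - replace (Derive (fun x => X x) 1) with (Re (z0 * p' z0)) by (symmetry; apply is_derive_unique, DX).
        replace (Derive (fun x => Y x) 1) with (Im (z0 * p' z0)) by (symmetry; apply is_derive_unique, DY).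
        ring. }
    rewrite EX, EY in Dn.
    assert (2 * (Re (p z0) ^ 2 + Im (p z0) ^ 2) + 2 * Re (z0 * p' z0) <= 0); [|lra].
    apply (derive_nonpos_at_right_end n _ Dn).
    intros t Ht. replace (n 1) with 0.
    2: { unfold n. rewrite EX, EY, Hc. field. }
    assert (Hn : n t = (t * Cmod (p (RtoC t * z0)%C)) ^ 2 - Cmod (p (RtoC t * z0)%C - 1) ^ 2).
    { unfold n, X, Y. rewrite Rpow_mult_distr, !Cmod2_alt. unfold Re, Im; simpl. ring. }
    rewrite Hn.
    destruct (Req_dec t 0) as [->|Ht0].
    { rewrite Cmult_0_l, Hp0. rewrite Cmod_diag. lra. }
    assert (Ht' : Cmod t = t) by (rewrite Cmod_R, Rabs_pos_eq; lra).
    assert (Q := S (RtoC t)). rewrite Ht' in Q. unfold phi in Q.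
    rewrite (Cmult_comm z0 (RtoC t)) in Q.
    assert (Hpn : 1 / 2 < Re (p (RtoC t * z0)%C)) by (apply Hin; rewrite Cmod_ray by lra; nra).
    rewrite Cmod_div in Q by (apply Re_pos_neq_0; lra).
    assert (Pp : 0 < Cmod (p (RtoC t * z0)%C)) by (apply Cmod_gt_0, Re_pos_neq_0; lra).
    assert (Cmod (p (RtoC t * z0)%C - 1) <= t * Cmod (p (RtoC t * z0)%C)).
    { apply Rle_div_l; [exact Pp|]. apply Q; [|lra]. intros K. apply RtoC_inj in K. lra. }
    pose proof (Cmod_ge_0 (p (RtoC t * z0)%C - 1)). nra.
Qed.

(** * The classes [M_(alpha, 1 - alpha)] in terms of [p = f / z] *)

Lemma class_A_quotient : forall f, class_A f -> exists p p', hol p p' /\ p 0 = 1 /\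
  (forall z, f z = (z * p z)%C) /\ (forall z, f_over_z f z = p z) /\
  (forall z, Cmod z < 1 -> cdiff f z (p z + z * p' z)%C) /\
  (forall z, Cmod z < 1 -> p z <> 0 -> zf'_over_f f z = (1 + z * p' z / p z)%C).
Proof.
  intros f [Hh [H0 H1]].
  assert (Hf : hol f (C_derive f)).
  { intros z Hz. apply cdiff_is_derive, C_derive_correct; [exact z|]. apply Hh, Hz. }
  destruct (hol_remove_root f _ Hf) as [p [p' [Hp [Hp0 E]]]].
  rewrite (is_C_derive_unique _ _ _ H1) in Hp0.
  assert (E' : forall z, f z = (z * p z)%C) by (intros z; rewrite E, H0; ring).
  assert (D : forall z, Cmod z < 1 -> cdiff f z (p z + z * p' z)%C).
  { intros z Hz. apply cdiff_ext with (fun z => (z * p z)%C); [intros; symmetry; apply E'|].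
    apply diff_val with (1 * p z + z * p' z)%C; [ring|].
    apply (cdiff_mult (fun z => z)); [apply cdiff_id|apply Hp, Hz]. }
  exists p, p'. split; [exact Hp|]. split; [exact Hp0|]. split; [exact E'|].
  split; [|split; [exact D|]].
  - intros z. unfold f_over_z. destruct (Ceq_dec z 0) as [->|Hz]; [congruence|].
    rewrite E'. field. exact Hz.
  - intros z Hz Hpz. unfold zf'_over_f. destruct (Ceq_dec z 0) as [->|Hz0].
    + rewrite Hp0. field.
    + rewrite (cdiff_unique _ _ _ _ (Hf z Hz) (D z Hz)), E'. field. auto.
Qed.

Lemma Re_real_div : forall a b : C, Im a = 0 -> b <> 0 ->
  Re (a / b) = Re a * Re b / (Re b ^ 2 + Im b ^ 2).
Proof.
  intros [a1 a2] [b1 b2] Ha Hb. unfold Re, Im in *; simpl in *. subst a2.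
  assert (b1 ^ 2 + b2 ^ 2 <> 0).
  { intros K. apply Hb. assert (b1 = 0) by nra. assert (b2 = 0) by nra. subst; reflexivity. }
  field. simpl in *. intros K; apply H; lra.
Qed.

Definition q_alpha (alpha : R) (p p' : C -> C) (z : C) : C :=
  (RtoC alpha * p z + RtoC (1 - alpha) * (1 + z * p' z / p z))%C.

Lemma Re_q_alpha_real : forall alpha (p p' : C -> C) (z : C), p z <> 0 -> Im (z * p' z) = 0 ->
  Re (q_alpha alpha p p' z) = alpha * Re (p z) +
    (1 - alpha) * (1 + Re (z * p' z) * (Re (p z) / (Re (p z) ^ 2 + Im (p z) ^ 2))).
Proof.
  intros alpha p p' z Hp Hi. unfold q_alpha.
  rewrite re_plus, !re_scal_l, re_plus, Re_real_div by assumption.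
  unfold Rdiv. simpl. ring.
Qed.

Lemma class_M_quotient : forall alpha f, class_M alpha f -> exists p p', hol p p' /\ p 0 = 1 /\
  (forall z, f z = (z * p z)%C) /\ (forall z, f_over_z f z = p z) /\
  (alpha <> 1 -> forall z, Cmod z < 1 -> p z <> 0) /\
  (forall z, Cmod z < 1 -> (alpha = 1 \/ p z <> 0) -> 1 / 2 < Re (q_alpha alpha p p' z)).
Proof.
  intros alpha f [HA [Hnz HRe]].
  destruct (class_A_quotient f HA) as [p [p' [Hp [Hp0 [E [Ep [D Ez]]]]]]].
  exists p, p'. split; [exact Hp|]. split; [exact Hp0|]. split; [exact E|]. split; [exact Ep|]. split.
  - intros Ha z Hz. destruct (Ceq_dec z 0) as [->|Hz0].
    + rewrite Hp0. intros K. apply RtoC_inj in K. lra.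
    + specialize (Hnz Ha z Hz Hz0). rewrite E in Hnz. intros K. apply Hnz. rewrite K. ring.
  - intros z Hz Hor. specialize (HRe z Hz). rewrite Ep in HRe. unfold q_alpha.
    destruct Hor as [->|Hpz].
    + rewrite Rminus_diag in *. rewrite Cmult_0_l in *. exact HRe.
    + rewrite Ez in HRe by assumption. exact HRe.
Qed.

(** At the first point where [Re p = c] the quotient [z p' / p] has nonpositive real
    part, so for [alpha <= 1] the expression defining the class has real part at most
    [alpha c + 1 - alpha <= 1 / 2]. When [c = 0] the quotient is imaginary, which
    settles the case [alpha > 1] as well. *)
Lemma class_M_Re_gt : forall alpha c f, class_M alpha f ->
  0 <= c < 1 -> alpha * c + (1 - alpha) <= 1 / 2 -> alpha <= 1 \/ c = 0 ->
  forall z, in_disk z -> c < Re (f_over_z f z).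
Proof.
  intros alpha c f HM Hc Hac Hor z1 Hz1.
  destruct (class_M_quotient alpha f HM) as [p [p' [Hp [Hp0 [_ [Ep [Hnz HRe]]]]]]].
  rewrite Ep. apply Rnot_le_lt. intros K.
  destruct (first_touch p p' c z1 Hp) as [z0 [Hne [H1 [HR [HI [Hd _]]]]]]; try assumption.
  { rewrite Hp0. unfold Re; simpl. lra. }
  destruct (Req_dec alpha 1) as [Ha|Ha].
  - specialize (HRe z0 H1 (or_introl Ha)). subst alpha. unfold q_alpha in HRe.
    rewrite Rminus_diag, Cmult_0_l, re_plus, re_scal_l, HR in HRe. unfold Re in HRe; simpl in HRe. lra.
  - specialize (Hnz Ha z0 H1). specialize (HRe z0 H1 (or_intror Hnz)).
    rewrite Re_q_alpha_real in HRe by assumption. rewrite HR in HRe.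
    destruct Hor as [Ha1|Hc0].
    + assert (0 <= c / (c ^ 2 + Im (p z0) ^ 2)).
      { destruct (Req_dec c 0) as [->|]; [unfold Rdiv; lra|].
        apply Rdiv_le_0_compat; [lra|]. pose proof (pow2_ge_0 (Im (p z0))).
        assert (0 < c ^ 2) by (apply pow_lt; lra). lra. }
      assert (0 <= - Re (z0 * p' z0) * (c / (c ^ 2 + Im (p z0) ^ 2))) by (apply Rmult_le_pos; lra).
      nra.
    + subst c. unfold Rdiv in HRe. rewrite Rmult_0_l, !Rmult_0_r in HRe. lra.
Qed.

Lemma class_M_sub_G : forall alpha f, 1 / 2 <= alpha < 2 -> class_M alpha f -> class_G f.
Proof.
  intros alpha f Ha HM. split; [apply HM|].
  apply class_M_Re_gt with alpha; auto; lra.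
Qed.

Lemma class_M_1 : forall f, class_M 1 f <-> class_A_half f.
Proof.
  intros f.
  assert (E : forall z, (RtoC 1 * f_over_z f z + RtoC (1 - 1) * zf'_over_f f z)%C = f_over_z f z).
  { intros z. rewrite Rminus_diag. ring. }
  split.
  - intros [HA [_ H]]. split; [exact HA|]. intros z Hz. rewrite <- E. apply H, Hz.
  - intros [HA H]. split; [exact HA|]. split; [intros K; lra|]. intros z Hz. rewrite E. apply H, Hz.
Qed.

(** Where [Re p] first equals [1 / 2], Jack's lemma gives [Re (z p' / p) <= - 1 / 2],
    and the expression defining the class has real part at most [1 / 2]. *)
Lemma class_M_sub_half : forall alpha f, 1 / 2 <= alpha <= 1 -> class_M alpha f -> class_A_half f.
Proof.
  intros alpha f Ha HM.
  destruct (Req_dec alpha 1) as [->|Ha1]; [exact (proj1 (class_M_1 f) HM)|].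
  split; [apply HM|]. intros z1 Hz1.
  destruct (class_M_quotient alpha f HM) as [p [p' [Hp [Hp0 [_ [Ep [Hnz HRe]]]]]]].
  rewrite Ep. apply Rnot_le_lt. intros K.
  destruct (first_touch p p' (1 / 2) z1 Hp) as [z0 [Hne [H1 [HR [HI [Hd Hin]]]]]]; try assumption.
  { rewrite Hp0. unfold Re; simpl. lra. }
  specialize (Hnz Ha1 z0 H1). specialize (HRe z0 H1 (or_intror Hnz)).
  rewrite Re_q_alpha_real in HRe by assumption.
  assert (J := jack_half p p' z0 Hp Hp0 Hne H1 HR Hin).
  set (N := Re (p z0) ^ 2 + Im (p z0) ^ 2) in *.
  assert (PN : 0 < N).
  { unfold N. rewrite HR. pose proof (pow2_ge_0 (Im (p z0))). lra. }
  rewrite HR in HRe.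
  assert (Q : Re (z0 * p' z0) * (1 / 2 / N) <= - N * (1 / 2 / N)).
  { apply Rmult_le_compat_r; [|exact J]. apply Rdiv_le_0_compat; lra. }
  replace (- N * (1 / 2 / N)) with (- 1 / 2) in Q by (field; lra). nra.
Qed.

(** The expression for [t] is a convex combination of those for [s] and for [1],
    the latter being [f / z]. *)
Lemma class_M_mono : forall s t f, 1 / 2 <= s -> s <= t -> t <= 1 -> class_M s f -> class_M t f.
Proof.
  intros s t f Hs Hst Ht HM.
  destruct (Req_dec s t) as [<-|Hne]; [exact HM|].
  assert (HH := class_M_sub_half s f (conj Hs (Rle_trans _ _ _ Hst Ht)) HM).
  destruct HM as [HA [Hnz HRe]]. split; [exact HA|]. split.
  - intros _. apply Hnz. lra.
  - intros z Hz. specialize (HRe z Hz). destruct HH as [_ HH]. specialize (HH z Hz).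
    rewrite re_plus, !re_scal_l in *.
    set (P := Re (f_over_z f z)) in *. set (J := Re (zf'_over_f f z)) in *.
    set (m := (1 - t) / (1 - s)).
    assert (Hm : 0 <= m <= 1).
    { split; [apply Rdiv_le_0_compat; lra|].
      apply Rle_div_l; lra. }
    replace (t * P + (1 - t) * J) with (m * (s * P + (1 - s) * J) + (1 - m) * P)
      by (unfold m; field; lra).
    destruct (Req_dec m 0) as [E|E]; [rewrite E; lra|]. nra.
Qed.

Lemma filtration : is_filtration_of_G (Finite (1 / 2)) (Finite 1) (fun s : Rbar => class_M (real s)).
Proof.
  split; [simpl; lra|]. split.
  - intros [s| |] H1 H2 f Hf; simpl in *; try contradiction.
    apply class_M_sub_G with s; [lra|exact Hf].
  - intros [s| |] [t| |] H1 H2 H3 f Hf; simpl in *; try contradiction.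
    apply class_M_mono with s; assumption.
Qed.

Lemma class_A_half_sub_G : forall f, class_A_half f -> class_G f.
Proof.
  intros f [HA H]. split; [exact HA|]. intros z Hz. specialize (H z Hz). lra.
Qed.

Lemma class_A_half_proper : exists f, class_G f /\ ~ class_A_half f.
Proof.
  set (f := fun z : C => (z * (1 - z))%C). exists f.
  assert (D : forall z, cdiff f z (1 - 2 * z)%C).
  { intros z. apply diff_val with (1 * (1 - z) + z * (0 - 1))%C; [ring|].
    apply (cdiff_mult (fun z => z) (fun z => (1 - z)%C)); [apply cdiff_id|].
    apply diff_minus; [apply diff_const|apply cdiff_id]. }
  assert (HA : class_A f).
  { split; [|split].
    - intros z _. exists (1 - 2 * z)%C. apply cdiff_is_derive, D.
    - unfold f. ring.
    - apply cdiff_is_derive. eapply diff_val; [|apply D]. ring. }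
  assert (E : forall z, f_over_z f z = (1 - z)%C).
  { intros z. unfold f_over_z. destruct (Ceq_dec z 0) as [->|Hz]; [ring|]. unfold f. field. exact Hz. }
  split.
  - split; [exact HA|]. intros z Hz. rewrite E. pose proof (Re_le_Cmod z). unfold in_disk in Hz.
    unfold Re in *; simpl. lra.
  - intros [_ H]. assert (Hz : in_disk (RtoC (3 / 4))).
    { unfold in_disk. rewrite Cmod_R, Rabs_pos_eq; lra. }
    specialize (H _ Hz). rewrite E in H. unfold Re in H; simpl in H. lra.
Qed.

(** * Picard iteration *)

Lemma rdiff_CI : forall u a t, (forall s, ccont u s) -> rdiff (fun b => CI u a b) t (u t).
Proof.
  intros u a t Hu. apply rdiff_of_parts; unfold CI, Re at 1, Im at 1; simpl.
  - apply (is_derive_RInt (V := R_NormedModule) (fun s => Re (u s)) _ a).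
    + apply filter_forall. intros b. apply (RInt_correct (V := R_CompleteNormedModule)).
      apply (ex_RInt_continuous (V := R_CompleteNormedModule)). intros s _. apply ccont_Re, Hu.
    + apply ccont_Re, Hu.
  - apply (is_derive_RInt (V := R_NormedModule) (fun s => Im (u s)) _ a).
    + apply filter_forall. intros b. apply (RInt_correct (V := R_CompleteNormedModule)).
      apply (ex_RInt_continuous (V := R_CompleteNormedModule)). intros s _. apply ccont_Im, Hu.
    + apply ccont_Im, Hu.
Qed.

Lemma CI_point : forall u a, CI u a a = 0.
Proof. intros u a. unfold CI. rewrite !RInt_point. reflexivity. Qed.

Lemma Rmax_0_lipschitz : forall x y, Rabs (Rmax 0 x - Rmax 0 y) <= Rabs (x - y).
Proof.
  intros x y. unfold Rmax. destruct (Rle_dec 0 x), (Rle_dec 0 y); unfold Rabs;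
  repeat destruct Rcase_abs; lra.
Qed.

Lemma ccont_Rmax_0 : forall u t, ccont u (Rmax 0 t) -> ccont (fun s => u (Rmax 0 s)) t.
Proof.
  intros u t Hu eps Heps.
  destruct (proj1 (locally_Rabs _ _) (Hu eps Heps)) as [d [Hd H]].
  apply locally_Rabs. exists d; split; [exact Hd|]. intros s Hs. apply H.
  eapply Rle_lt_trans; [apply Rmax_0_lipschitz|exact Hs].
Qed.

Lemma geometric_limit : forall (s : nat -> C) A,
  (forall n, Cmod (s (S n) - s n) <= A / 2 ^ n) ->
  exists l, forall n, Cmod (s n - l) <= 4 * A / 2 ^ n.
Proof.
  intros s A H.
  assert (HA : 0 <= A).
  { specialize (H 0%nat). simpl in H. pose proof (Cmod_ge_0 (s 1%nat - s 0%nat)). lra. }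
  assert (Hp : forall n, 0 <= A / 2 ^ n).
  { intros n. apply Rdiv_le_0_compat; [exact HA|apply pow_lt; lra]. }
  set (q := fun n => let d := 2 * (A / 2 ^ n) in
    Rect (Re (s n) - d) (Re (s n) + d) (Im (s n) - d) (Im (s n) + d)).
  destruct (nested_rects q) as [x [y Hxy]].
  - intros n. specialize (Hp n). unfold rect_ok, q; simpl. lra.
  - intros n. unfold sub_rect, q. cbn [xl xr yl yr].
    assert (E : 2 * (A / 2 ^ S n) = A / 2 ^ n) by (simpl; field; apply pow_nonzero; lra).
    rewrite E. specialize (H n).
    pose proof (re_le_Cmod (s (S n) - s n)) as Q1. pose proof (im_le_Cmod (s (S n) - s n)) as Q2.
    replace (Re (s (S n) - s n)%C) with (Re (s (S n)) - Re (s n)) in Q1 by (unfold Re; simpl; ring).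
    replace (Im (s (S n) - s n)%C) with (Im (s (S n)) - Im (s n)) in Q2 by (unfold Im; simpl; ring).
    revert Q1 Q2. unfold Rabs. repeat destruct Rcase_abs; lra.
  - exists (x, y). intros n. destruct (Hxy n) as [K1 K2]. unfold q in K1, K2. cbn [xl xr yl yr] in K1, K2.
    eapply Rle_trans; [apply Cmod_le_Re_Im|].
    replace (Re (s n - (x, y))%C) with (Re (s n) - x) by (unfold Re; simpl; ring).
    replace (Im (s n - (x, y))%C) with (Im (s n) - y) by (unfold Im; simpl; ring).
    replace (4 * A / 2 ^ n) with (2 * (A / 2 ^ n) + 2 * (A / 2 ^ n)) by (field; apply pow_nonzero; lra).
    unfold Rabs. repeat destruct Rcase_abs; lra.
Qed.

Section Picard.
Variables (G : C -> C) (K : R).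
Hypothesis HK : 1 <= K.
Hypothesis HG : forall a b, Cmod (G b - G a) <= K * Cmod (b - a).

Lemma picard_G_cont : forall z, @ccont C_UniformSpace G z.
Proof.
  intros z eps Heps. apply locally_Cmod. exists (eps / K). split; [apply Rdiv_lt_0_compat; lra|].
  intros w Hw. eapply Rle_lt_trans; [apply HG|].
  replace eps with (K * (eps / K)) by (field; lra). apply Rmult_lt_compat_l; lra.
Qed.

(** Negative times are clamped to [0] to keep the iterates continuous on the line. *)
Fixpoint picard_iter (n : nat) (t : R) : C :=
  match n with
  | O => 0
  | S n => CI (fun s => G (picard_iter n s)) 0 (Rmax 0 t)
  end.

Lemma picard_iter_cont : forall n t, ccont (picard_iter n) t.
Proof.
  induction n as [|n IH]; intros t; [apply ccont_const|].
  apply (ccont_Rmax_0 (fun s => CI (fun s => G (picard_iter n s)) 0 s)).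
  eapply rdiff_cont, rdiff_CI. intros s. apply ccont_comp; [apply picard_G_cont|apply IH].
Qed.

Lemma picard_G_iter_cont : forall n a b, cont_seg (fun s => G (picard_iter n s)) a b.
Proof. intros n a b t _. apply ccont_comp; [apply picard_G_cont|apply picard_iter_cont]. Qed.

Let B := Cmod (G 0).

Lemma is_RInt_exp : forall A t, 0 <= t ->
  is_RInt (fun s => A * exp (2 * K * s)) 0 t (A / (2 * K) * exp (2 * K * t) - A / (2 * K)).
Proof.
  intros A t Ht.
  replace (A / (2 * K)) with (A / (2 * K) * exp (2 * K * 0)) at 2 by (rewrite Rmult_0_r, exp_0; ring).
  apply (is_RInt_derive (V := R_CompleteNormedModule) (fun s => A / (2 * K) * exp (2 * K * s))).
  - intros s _. auto_derive; auto. field. lra.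
  - intros s _. apply (ex_derive_continuous (K := R_AbsRing) (V := R_NormedModule)). auto_derive. auto.
Qed.

(** The weight [exp (2 K t)] makes the Picard operator a contraction with ratio [1/2]. *)
Lemma picard_step : forall n t, 0 <= t ->
  Cmod (picard_iter (S n) t - picard_iter n t) <= B * exp (2 * K * t) / 2 ^ n.
Proof.
  induction n as [|n IH]; intros t Ht.
  - simpl. rewrite Rmax_right by exact Ht. rewrite CI_const.
    replace (RtoC (t - 0) * G 0 - 0)%C with (RtoC t * G 0)%C by (rewrite Rminus_0_r; ring).
    rewrite Cmod_mult, Cmod_R, Rabs_pos_eq by exact Ht. fold B.
    assert (PB : 0 <= B) by apply Cmod_ge_0.
    pose proof (exp_ineq1_le (2 * K * t)). unfold Rdiv. rewrite Rinv_1, Rmult_1_r.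
    rewrite (Rmult_comm t). apply Rmult_le_compat_l; [exact PB|]. nra.
  - change (picard_iter (S (S n)) t) with (CI (fun s => G (picard_iter (S n) s)) 0 (Rmax 0 t)).
    change (picard_iter (S n) t) with (CI (fun s => G (picard_iter n s)) 0 (Rmax 0 t)).
    rewrite Rmax_right by exact Ht.
    rewrite <- CI_minus by (try exact Ht; apply picard_G_iter_cont).
    assert (E := is_RInt_exp (K * B / 2 ^ n) t Ht).
    eapply Rle_trans; [apply CI_norm_le with (f := fun s => K * B / 2 ^ n * exp (2 * K * s))|].
    + exact Ht.
    + intros s Hs. apply ccont_minus; apply picard_G_iter_cont with 0 t; exact Hs.
    + intros s Hs. eapply Rle_trans; [apply HG|].
      replace (K * B / 2 ^ n * exp (2 * K * s)) with (K * (B * exp (2 * K * s) / 2 ^ n)) by (unfold Rdiv; ring).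
      apply Rmult_le_compat_l; [lra|]. apply IH. lra.
    + eexists. exact E.
    + rewrite (is_RInt_unique _ _ _ _ E). simpl.
      assert (PB : 0 <= B / 2 ^ n) by (apply Rdiv_le_0_compat; [apply Cmod_ge_0|apply pow_lt; lra]).
      replace (K * B / 2 ^ n / (2 * K)) with (B / 2 ^ n / 2) by (field; split; [apply pow_nonzero|]; lra).
      replace (B * exp (2 * K * t) / (2 * 2 ^ n)) with (B / 2 ^ n / 2 * exp (2 * K * t)) by (field; apply pow_nonzero; lra).
      lra.
Qed.

Lemma picard_lindelof : exists v : R -> C, v 0 = 0 /\ forall t, 0 <= t -> rdiff v t (G (v t)).
Proof.
  assert (PB : 0 <= B) by apply Cmod_ge_0.
  set (W := fun t => 4 * (B * exp (2 * K * Rmax 0 t))).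
  assert (Hclamp : forall n t, picard_iter n t = picard_iter n (Rmax 0 t)).
  { intros [|n] t; [reflexivity|]. simpl. rewrite (Rmax_right 0 (Rmax 0 t)) by apply Rmax_l. reflexivity. }
  assert (Hlim : forall t, exists l, forall n, Cmod (picard_iter n t - l) <= W t / 2 ^ n).
  { intros t. destruct (geometric_limit (fun n => picard_iter n (Rmax 0 t)) (B * exp (2 * K * Rmax 0 t))) as [l Hl].
    - intros n. apply picard_step. apply Rmax_l.
    - exists l. intros n. rewrite Hclamp. apply Hl. }
  set (v := fun t => proj1_sig (constructive_indefinite_description _ (Hlim t))).
  assert (Hv : forall t n, Cmod (picard_iter n t - v t) <= W t / 2 ^ n).
  { intros t. exact (proj2_sig (constructive_indefinite_description _ (Hlim t))). }
  assert (HW : forall s t, s <= t -> W s <= W t).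
  { intros s t Hst. unfold W. apply Rmult_le_compat_l; [lra|]. apply Rmult_le_compat_l; [exact PB|].
    apply exp_le_compat. apply Rmult_le_compat_l; [lra|]. apply Rle_max_compat_l, Hst. }
  assert (HW0 : forall t, 0 <= W t).
  { intros t. unfold W. pose proof (exp_pos (2 * K * Rmax 0 t)). nra. }
  assert (Cv : forall t, ccont v t).
  { intros t eps Heps. destruct (pow2_small (W (t + 1)) (eps / 3)) as [n Hn]; [lra|].
    assert (H3 : 0 < eps / 3) by lra.
    destruct (proj1 (locally_Rabs _ _) (picard_iter_cont n t _ H3)) as [d [Hd H]].
    apply locally_Rabs. exists (Rmin d 1). split; [apply Rmin_case; lra|].
    intros s Hs. pose proof (Rlt_le_trans _ _ _ Hs (Rmin_l _ _)) as s1.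
    pose proof (Rlt_le_trans _ _ _ Hs (Rmin_r _ _)) as s2. apply Rabs_def2 in s2.
    specialize (H s s1).
    assert (P2 : 0 < / 2 ^ n) by (apply Rinv_0_lt_compat, pow_lt; lra).
    assert (Q1 := Hv s n). assert (Q2 := Hv t n).
    assert (W s / 2 ^ n <= W (t + 1) / 2 ^ n) by (apply Rmult_le_compat_r; [lra|apply HW; lra]).
    assert (W t / 2 ^ n <= W (t + 1) / 2 ^ n) by (apply Rmult_le_compat_r; [lra|apply HW; lra]).
    replace (v s - v t)%C with (- (picard_iter n s - v s) + (picard_iter n s - picard_iter n t) + (picard_iter n t - v t))%C by ring.
    eapply Rle_lt_trans; [apply Cmod_triangle|].
    eapply Rle_lt_trans; [apply Rplus_le_compat_r, Cmod_triangle|]. rewrite Cmod_opp. lra. }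
  assert (CGv : forall t, ccont (fun s => G (v s)) t) by (intros t; apply ccont_comp; [apply picard_G_cont|apply Cv]).
  set (V := fun t => CI (fun s => G (v s)) 0 t).
  assert (HV : forall t, 0 <= t -> V t = v t).
  { intros t Ht.
    assert (E : (V t - v t = 0)%C); [|replace (V t) with (V t - v t + v t)%C by ring; rewrite E; ring].
    apply Cmod_eq_0. apply Rle_antisym; [|apply Cmod_ge_0]. apply Rnot_lt_le. intros P.
    destruct (pow2_small (W t * (1 + K * t)) _ P) as [n Hn].
    assert (P2 : 0 < / 2 ^ n) by (apply Rinv_0_lt_compat, pow_lt; lra).
    assert (Q1 : Cmod (picard_iter (S n) t - v t) <= W t / 2 ^ n).
    { eapply Rle_trans; [apply Hv|]. apply Rmult_le_compat_l; [apply HW0|]. simpl.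
      rewrite Rinv_mult. lra. }
    assert (Q2 : Cmod (V t - picard_iter (S n) t) <= K * (W t / 2 ^ n) * (t - 0)).
    { simpl. rewrite Rmax_right by exact Ht. unfold V.
      rewrite <- CI_minus; [|exact Ht|intros s _; apply CGv|apply picard_G_iter_cont].
      apply CI_bound; [exact Ht| |].
      - intros s Hs. apply ccont_minus; [apply CGv|apply picard_G_iter_cont with 0 t; exact Hs].
      - intros s Hs. eapply Rle_trans; [apply HG|]. apply Rmult_le_compat_l; [lra|].
        rewrite Cmod_minus_sym. eapply Rle_trans; [apply Hv|]. apply Rmult_le_compat_r; [lra|].
        apply HW; lra. }
    pose proof (Cmod_minus_triangle (V t) (picard_iter (S n) t) (v t)).
    replace (W t * (1 + K * t) / 2 ^ n) with (W t / 2 ^ n + K * (W t / 2 ^ n) * (t - 0)) in Hn by (unfold Rdiv; ring).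
    lra. }
  exists V. split; [apply CI_point|].
  intros t Ht. rewrite (HV t Ht). apply (rdiff_CI (fun s => G (v s))), CGv.
Qed.

End Picard.

(** * The flow *)

Lemma Re_growth : forall u u' c T, 0 <= T -> (forall t, 0 <= t <= T -> is_derive u t (u' t)) ->
  (forall t, 0 <= t <= T -> c <= u' t) -> u 0 + c * T <= u T.
Proof.
  intros u u' c T HT Hu Hc.
  destruct (MVT_gen u 0 T u') as [x [Hx E]].
  - rewrite Rmin_left, Rmax_right by lra. intros t Ht. apply Hu. lra.
  - rewrite Rmin_left, Rmax_right by lra. intros t Ht.
    apply continuity_pt_filterlim. apply (ex_derive_continuous (K := R_AbsRing) (V := R_NormedModule)).
    eexists. apply Hu, Ht.
  - rewrite Rmin_left, Rmax_right in Hx by lra. specialize (Hc x Hx). nra.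
Qed.

Lemma is_derive_Cmod2 : forall d t l, rdiff d t l ->
  is_derive (fun s => Cmod (d s) ^ 2) t (2 * Re (Cconj (d t) * l)).
Proof.
  intros d t l H.
  apply is_derive_ext with (fun s => Re (d s) ^ 2 + Im (d s) ^ 2).
  { intros s. symmetry. apply Cmod2_alt. }
  set (X := fun s => Re (d s)). set (Y := fun s => Im (d s)).
  assert (H1 : is_derive X t (Re l)) by apply (rdiff_Re _ _ _ H).
  assert (H2 : is_derive Y t (Im l)) by apply (rdiff_Im _ _ _ H).
  apply (is_derive_ext (fun s => X s ^ 2 + Y s ^ 2)); [reflexivity|].
  auto_derive.
  - repeat split; eexists; eassumption.
  - replace (Derive (fun x => X x) t) with (Re l) by (symmetry; apply is_derive_unique, H1).
    replace (Derive (fun x => Y x) t) with (Im l) by (symmetry; apply is_derive_unique, H2).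
    unfold X, Y, Re, Im, Cconj; simpl. ring.
Qed.

(** The function [|d|^2 exp (- 2 K t)] is nonincreasing. *)
Lemma gronwall : forall d d' K T, 0 <= T -> (forall t, 0 <= t <= T -> rdiff d t (d' t)) ->
  (forall t, 0 <= t <= T -> Cmod (d' t) <= K * Cmod (d t)) -> Cmod (d T) <= Cmod (d 0) * exp (K * T).
Proof.
  intros d d' K T HT Hd HK.
  assert (H : - (Cmod (d 0) ^ 2 * exp (- (2 * K) * 0)) + 0 * T <= - (Cmod (d T) ^ 2 * exp (- (2 * K) * T))).
  { apply (Re_growth (fun t => - (Cmod (d t) ^ 2 * exp (- (2 * K) * t)))
     (fun t => (2 * K * Cmod (d t) ^ 2 - 2 * Re (Cconj (d t) * d' t)) * exp (- (2 * K) * t))); [exact HT| |].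
    - intros t Ht. pose proof (is_derive_Cmod2 d t (d' t) (Hd t Ht)) as D.
      set (N := fun s => Cmod (d s) ^ 2) in *. change (Cmod (d t) ^ 2) with (N t).
      apply (is_derive_ext (fun s => - (N s * exp (- (2 * K) * s)))); [reflexivity|].
      auto_derive.
      + repeat split; eexists; eassumption.
      + replace (Derive (fun x => N x) t) with (2 * Re (Cconj (d t) * d' t)) by (symmetry; apply is_derive_unique, D).
        ring.
    - intros t Ht. apply Rmult_le_pos; [|apply Rlt_le, exp_pos].
      pose proof (Re_le_Cmod (Cconj (d t) * d' t)) as Q. rewrite Cmod_mult, Cmod_conj in Q.
      specialize (HK t Ht). pose proof (Cmod_ge_0 (d t)). nra. }
  rewrite Rmult_0_r, exp_0 in H.
  assert (E : exp (- (2 * K) * T) * (exp (K * T) * exp (K * T)) = 1).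
  { rewrite <- !exp_plus. replace (- (2 * K) * T + (K * T + K * T)) with 0 by ring. apply exp_0. }
  pose proof (exp_pos (K * T)) as Pe. set (e := exp (K * T)) in *. set (e2 := exp (- (2 * K) * T)) in *.
  assert (Q : Cmod (d T) ^ 2 <= (Cmod (d 0) * e) ^ 2).
  { replace (Cmod (d T) ^ 2) with (Cmod (d T) ^ 2 * (e2 * (e * e))) by (rewrite E; ring).
    replace (Cmod (d T) ^ 2 * (e2 * (e * e))) with (Cmod (d T) ^ 2 * e2 * (e * e)) by ring.
    replace ((Cmod (d 0) * e) ^ 2) with (Cmod (d 0) ^ 2 * (e * e)) by ring.
    apply Rmult_le_compat_r; nra. }
  apply Rnot_lt_le. intros Hlt. pose proof (Cmod_ge_0 (d 0)).
  assert (0 <= Cmod (d 0) * e) by (apply Rmult_le_pos; lra). nra.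
Qed.

(** One-sided derivatives at [0] become two-sided after prolonging the curve
    along its tangent. *)
Definition prolong (v : R -> C) (l : C) (t : R) : C :=
  if Rlt_dec t 0 then (v 0%R + RtoC t * l)%C else v t.

Lemma prolong_ge0 : forall v l t, 0 <= t -> prolong v l t = v t.
Proof. intros v l t Ht. unfold prolong. destruct (Rlt_dec t 0); [lra|reflexivity]. Qed.

Lemma norm_C_R : forall z : C, @norm R_AbsRing C_R_NormedModule z = Cmod z.
Proof.
  intros [x y]. unfold norm; simpl. unfold prod_norm, Cmod; simpl.
  unfold norm; simpl. unfold abs; simpl. f_equal.
  rewrite !Rmult_1_r, <- !Rabs_mult, !Rabs_pos_eq; [reflexivity|nra|nra].
Qed.

Lemma minus_scal_C_R : forall (a b l : C) (h : R),
  @minus C_R_NormedModule (@minus C_R_NormedModule a b) (@scal R_AbsRing C_R_NormedModule h l)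
  = (a - b - l * RtoC h)%C.
Proof.
  intros a b l h. replace (l * RtoC h)%C with (RtoC h * l)%C by ring.
  rewrite <- scal_R_Cmult. reflexivity.
Qed.

Lemma prolong_rdiff : forall v t l l0, 0 <= t -> (t = 0 -> l0 = l) ->
  is_derive_ge0 v t l -> rdiff (prolong v l0) t l.
Proof.
  intros v t l l0 Ht Hl0 [_ H]. apply rdiff_eps. intros eps Heps.
  assert (Hlim : is_filter_lim (within (fun s : R => 0 <= s) (locally t)) t).
  { intros P HP. unfold within. generalize HP. apply filter_imp. auto. }
  destruct (proj1 (locally_Rabs t _) (H t Hlim (mkposreal eps Heps))) as [d [Hd Hd']].
  exists (if Req_EM_T t 0 then d else Rmin d t). split.
  { destruct (Req_EM_T t 0); [exact Hd|apply Rmin_case; lra]. }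
  intros s Hs. rewrite (prolong_ge0 v l0 t Ht).
  destruct (Rlt_dec s 0) as [Hneg|Hpos].
  - destruct (Req_EM_T t 0) as [E|E].
    + subst t. unfold prolong. destruct (Rlt_dec s 0); [|lra]. rewrite (Hl0 eq_refl), Rminus_0_r.
      replace (v 0%R + RtoC s * l - v 0%R - l * RtoC s)%C with (RtoC 0) by ring.
      rewrite Cmod_0. apply Rmult_le_pos; [lra|apply Rabs_pos].
    + pose proof (Rmin_r d t). apply Rabs_def2 in Hs. lra.
  - rewrite prolong_ge0 by lra.
    assert (Hsd : Rabs (s - t) < d).
    { destruct (Req_EM_T t 0); [exact Hs|]. eapply Rlt_le_trans; [exact Hs|apply Rmin_l]. }
    specialize (Hd' s Hsd ltac:(lra)). rewrite norm_C_R, minus_scal_C_R in Hd'. exact Hd'.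
Qed.

Lemma rdiff_is_derive_ge0 : forall u t l, 0 <= t -> rdiff u t l -> is_derive_ge0 u t l.
Proof.
  intros u t l Ht H. split; [apply (is_linear_scal_l (K := R_AbsRing) (V := C_R_NormedModule))|].
  intros x Hx.
  assert (x = t) as ->.
  { apply NNPP. intros Hne.
    assert (Hd : 0 < Rabs (x - t) / 2) by (apply Rdiv_lt_0_compat; [apply Rabs_pos_lt|]; lra).
    assert (H1 := Hx (fun s => Rabs (s - x) < Rabs (x - t) / 2)).
    assert (H2 : within (fun s : R => 0 <= s) (locally t) (fun s => Rabs (s - x) < Rabs (x - t) / 2)).
    { apply H1. apply locally_Rabs. exists (Rabs (x - t) / 2). auto. }
    destruct (proj1 (locally_Rabs t _) H2) as [e [He K]].
    specialize (K t ltac:(rewrite Rminus_diag, Rabs_R0; exact He) Ht).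
    simpl in K. rewrite Rabs_minus_sym in K. lra. }
  intros eps. destruct (proj1 (rdiff_eps _ _ _) H eps (cond_pos eps)) as [d [Hd Hd']].
  unfold within. apply locally_Rabs. exists d; split; [exact Hd|]. intros s Hs _.
  rewrite norm_C_R, minus_scal_C_R. apply Hd'. exact Hs.
Qed.

Definition half_plane_proj (v : C) : C := (Rmax 0 (Re v), Im v).

Lemma half_plane_proj_lipschitz : forall a b,
  Cmod (half_plane_proj b - half_plane_proj a) <= Cmod (b - a).
Proof.
  intros a b. apply Rnot_lt_le. intros H.
  assert (Q : Cmod (half_plane_proj b - half_plane_proj a) ^ 2 <= Cmod (b - a) ^ 2).
  { rewrite !Cmod2_alt. unfold half_plane_proj, Re, Im; simpl.
    pose proof (Rmax_0_lipschitz (fst b) (fst a)) as L.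
    apply Rsqr_le_abs_1 in L. unfold Rsqr in L. lra. }
  pose proof (Cmod_ge_0 (b - a)). nra.
Qed.

Section Flow.
Variables (f f' p p' : C -> C) (gam : R).
Hypothesis Hf : hol f f'.
Hypothesis Hp : hol p p'.
Hypothesis Hfp : forall z, f z = (z * p z)%C.
Hypothesis Hgam : 0 <= gam.
Hypothesis HRe : forall z, Cmod z < 1 -> gam <= Re (p z).

(** In the coordinate [u = z exp (- v)] the equation becomes [v' = p (z exp (- v))];
    its right-hand side has nonnegative real part, which keeps [v] in the right
    half-plane and [u] in the disk of radius [|z|]. *)
Lemma flow_exists : forall z, Cmod z < 1 -> exists u : R -> C, u 0 = z /\
  forall t, 0 <= t -> rdiff u t (- f (u t))%C /\ Cmod (u t) <= exp (- gam * t) * Cmod z.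
Proof.
  intros z Hz. pose proof (Cmod_ge_0 z) as Pz.
  set (g := fun v => p (z * cexp (- v))%C).
  set (G := fun v => g (half_plane_proj v)).
  destruct (hol_lipschitz p p' (Cmod z) Hp) as [K [HK [HK' _]]]; [lra|].
  assert (Hw : forall v, 0 <= Re v -> Cmod (z * cexp (- v)) <= Cmod z).
  { intros v Hv. rewrite Cmod_mult, Cmod_cexp, re_opp.
    assert (exp (- Re v) <= 1) by (rewrite <- exp_0; apply exp_le_compat; lra). nra. }
  assert (Dg : forall v, 0 <= Re v -> cdiff g v (- (p' (z * cexp (- v)) * (z * cexp (- v))))%C).
  { intros v Hv. specialize (Hw v Hv).
    apply diff_val with (p' (z * cexp (- v)) * (z * (cexp (- v) * - (1))))%C; [ring|].
    apply (cdiff_comp p (fun v => (z * cexp (- v))%C)); [apply Hp; lra|].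
    apply diff_scal. apply (cdiff_comp cexp (fun v => (- v)%C)); [apply cdiff_cexp|].
    apply diff_opp, cdiff_id. }
  destruct (picard_lindelof G (K + 1)) as [v [Hv0 Hv]]; [lra| |].
  { intros a b. unfold G.
    eapply Rle_trans; [|apply Rmult_le_compat_l; [lra|apply half_plane_proj_lipschitz]].
    set (a' := half_plane_proj a). set (b' := half_plane_proj b).
    assert (Hseg : forall t, 0 <= t <= 1 -> 0 <= Re (segment a' b' t)).
    { intros t Ht. unfold segment, a', b', half_plane_proj, Re; simpl.
      pose proof (Rmax_l 0 (fst a)). pose proof (Rmax_l 0 (fst b)). nra. }
    apply (cdiff_Cmod_le g (fun v => (- (p' (z * cexp (- v)) * (z * cexp (- v))))%C)).
    - intros t Ht. apply Dg, Hseg, Ht.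
    - intros t Ht. specialize (Hw _ (Hseg t Ht)). specialize (HK' _ Hw).
      rewrite Cmod_opp, Cmod_mult.
      pose proof (Cmod_ge_0 (z * cexp (- segment a' b' t))).
      pose proof (Cmod_ge_0 (p' (z * cexp (- segment a' b' t))%C)). nra. }
  assert (Hdisk : forall w, Cmod (z * cexp (- half_plane_proj w)) < 1).
  { intros w. eapply Rle_lt_trans; [apply Hw|exact Hz]. unfold half_plane_proj, Re; simpl. apply Rmax_l. }
  assert (Hgrow : forall t, 0 <= t -> gam * t <= Re (v t)).
  { intros t Ht. assert (Q : Re (v 0%R) + gam * t <= Re (v t)).
    { apply (Re_growth (fun s => Re (v s)) (fun s => Re (G (v s)))); [exact Ht| |].
      - intros s Hs. apply (rdiff_Re v), Hv. lra.
      - intros s Hs. apply HRe, Hdisk. }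
    rewrite Hv0 in Q. unfold Re in Q at 1; simpl in Q. lra. }
  exists (fun t => (z * cexp (- v t))%C). split.
  { rewrite Hv0. replace (- 0)%C with (RtoC 0) by ring. rewrite cexp_0. ring. }
  intros t Ht. specialize (Hgrow t Ht).
  assert (Hgt : 0 <= gam * t) by (apply Rmult_le_pos; assumption).
  split.
  - assert (EG : G (v t) = p (z * cexp (- v t))%C).
    { unfold G, g. replace (half_plane_proj (v t)) with (v t); [reflexivity|].
      unfold half_plane_proj. rewrite Rmax_right by lra. destruct (v t); reflexivity. }
    rewrite Hfp, <- EG.
    apply diff_val with (z * (cexp (- v t) * - G (v t)))%C; [ring|].
    apply diff_scal. apply (rdiff_comp cexp (fun t => (- v t)%C)); [apply cdiff_cexp|].
    apply diff_opp, Hv, Ht.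
  - rewrite Cmod_mult, Cmod_cexp, re_opp, Rmult_comm. apply Rmult_le_compat_r; [exact Pz|].
    apply exp_le_compat. lra.
Qed.

Lemma orbit_decreasing : forall u T, 0 <= T ->
  (forall t, 0 <= t <= T -> Cmod (u t) < 1 /\ rdiff u t (- f (u t))%C) -> Cmod (u T) <= Cmod (u 0).
Proof.
  intros u T HT Hu.
  assert (H : - Cmod (u 0) ^ 2 + 0 * T <= - Cmod (u T) ^ 2).
  { apply (Re_growth (fun t => - Cmod (u t) ^ 2) (fun t => - (2 * Re (Cconj (u t) * (- f (u t)))))); [exact HT| |].
    - intros t Ht. apply (is_derive_opp (K := R_AbsRing) (V := R_NormedModule)), is_derive_Cmod2, Hu, Ht.
    - intros t Ht. destruct (Hu t Ht) as [H1 _]. specialize (HRe _ H1). rewrite Hfp.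
      replace (- (2 * Re (Cconj (u t) * (- (u t * p (u t)))))) with (2 * (Cmod (u t) ^ 2 * Re (p (u t)))).
      + apply Rmult_le_pos; [lra|]. apply Rmult_le_pos; [apply pow2_ge_0|lra].
      + rewrite Cmod2_alt. unfold Re, Im, Cconj; simpl. ring. }
  apply Rnot_lt_le. intros Hlt. pose proof (Cmod_ge_0 (u 0)). nra.
Qed.

Lemma orbits_close : forall u v r K T, 0 <= T ->
  (forall a b, Cmod a <= r -> Cmod b <= r -> Cmod (f b - f a) <= K * Cmod (b - a)) ->
  (forall t, 0 <= t <= T -> Cmod (u t) <= r /\ rdiff u t (- f (u t))%C) ->
  (forall t, 0 <= t <= T -> Cmod (v t) <= r /\ rdiff v t (- f (v t))%C) ->
  Cmod (v T - u T) <= Cmod (v 0 - u 0) * exp (K * T).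
Proof.
  intros u v r K T HT HL Hu Hv.
  apply (gronwall (fun t => (v t - u t)%C) (fun t => (- f (v t) - - f (u t))%C)); [exact HT| |].
  - intros t Ht. apply diff_minus; [apply Hv, Ht|apply Hu, Ht].
  - intros t Ht. replace (- f (v t) - - f (u t))%C with (- (f (v t) - f (u t)))%C by ring.
    rewrite Cmod_opp. apply HL; [apply Hu, Ht|apply Hv, Ht].
Qed.

(** Both curves remain in the disk of radius [|z|], where [f] is Lipschitz. *)
Lemma flow_unique : forall u v z, Cmod z < 1 ->
  (u 0 = z /\ forall t, 0 <= t -> Cmod (u t) < 1 /\ rdiff u t (- f (u t))%C) ->
  cauchy_solution f z v -> forall t, 0 <= t -> v t = u t.
Proof.
  intros u v z Hz [Hu0 Hu] [Hv0 Hv] T HT.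
  set (w := prolong v (- f (v 0%R))%C).
  assert (Hw : forall t, 0 <= t -> Cmod (w t) < 1 /\ rdiff w t (- f (w t))%C).
  { intros t Ht. destruct (Hv t Ht) as [H1 H2]. unfold w. rewrite prolong_ge0 by exact Ht.
    split; [exact H1|]. apply prolong_rdiff; [exact Ht| |exact H2]. intros ->. reflexivity. }
  assert (Hw0 : w 0 = z) by (unfold w; rewrite prolong_ge0; [exact Hv0|lra]).
  pose proof (Cmod_ge_0 z) as Pz.
  destruct (hol_lipschitz f f' (Cmod z) Hf) as [K [_ [_ HL]]]; [lra|].
  assert (Q : Cmod (w T - u T) <= Cmod (w 0 - u 0) * exp (K * T)).
  { apply orbits_close with (Cmod z); [exact HT|exact HL| |].
    - intros t Ht. split; [|apply Hu; lra]. rewrite <- Hu0. apply orbit_decreasing; [lra|].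
      intros s Hs. apply Hu. lra.
    - intros t Ht. split; [|apply Hw; lra]. rewrite <- Hw0. apply orbit_decreasing; [lra|].
      intros s Hs. apply Hw. lra. }
  rewrite Hw0, Hu0 in Q. replace (z - z)%C with (RtoC 0) in Q by ring. rewrite Cmod_0, Rmult_0_l in Q.
  replace (v T) with (w T) by (apply prolong_ge0, HT).
  replace (w T) with (w T - u T + u T)%C by ring.
  replace (w T - u T)%C with (RtoC 0); [ring|]. symmetry. apply Cmod_eq_0.
  apply Rle_antisym; [exact Q|apply Cmod_ge_0].
Qed.

(** The difference of two orbits is compared with the solution [h E] of the
    linearized equation: the quotient of the error by [E] has a derivative of order
    [|h|^2], because [f'] is locally Lipschitz. *)
Lemma flow_holomorphic : forall (F : R -> C -> C),
  (forall z, Cmod z < 1 -> F 0 z = z /\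
     forall t, 0 <= t -> Cmod (F t z) <= Cmod z /\ rdiff (fun t => F t z) t (- f (F t z))%C) ->
  forall T z, 0 <= T -> Cmod z < 1 -> exists l, cdiff (F T) z l.
Proof.
  intros F HF T z HT Hz. pose proof (Cmod_ge_0 z) as Pz.
  set (r := (1 + Cmod z) / 2). assert (Hr : 0 <= r < 1) by (unfold r; lra).
  destruct (hol_lipschitz f f' r Hf Hr) as [K [HK [HK' HL]]].
  destruct (hol_taylor1 f f' r Hf Hr) as [K2 [HK2 HT2]].
  destruct (hol_deriv f f' Hf) as [f'' Hf'].
  destruct (HF z Hz) as [Fz0 Fz].
  set (c := fun s => f' (F (Rmax 0 s) z)).
  assert (Hc0 : forall s, 0 <= s -> c s = f' (F s z)) by (intros s Hs; unfold c; rewrite Rmax_right by exact Hs; reflexivity).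
  assert (Cc : forall s, ccont c s).
  { intros s. apply (ccont_Rmax_0 (fun s => f' (F s z))).
    apply (ccont_comp f' (fun s => F s z)).
    - eapply cdiff_cont, Hf'. destruct (Fz (Rmax 0 s) (Rmax_l _ _)). lra.
    - eapply rdiff_cont, (Fz (Rmax 0 s) (Rmax_l _ _)). }
  assert (Bc : forall s, Cmod (c s) <= K).
  { intros s. apply HK'. destruct (Fz (Rmax 0 s) (Rmax_l _ _)). unfold r; lra. }
  set (I := fun s => CI c 0 s).
  assert (DI : forall s, rdiff I s (c s)) by (intros s; apply rdiff_CI, Cc).
  assert (I0 : I 0 = 0) by apply CI_point.
  set (E := fun s => cexp (- I s)).
  assert (DE : forall s, rdiff E s (E s * - c s)%C).
  { intros s. apply (rdiff_comp cexp (fun s => (- I s)%C)); [apply cdiff_cexp|apply diff_opp, DI]. }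
  assert (BI : forall s, 0 <= s <= T -> Cmod (I s) <= K * T).
  { intros s Hs. assert (Q : Cmod (I s) <= K * (s - 0)).
    { apply CI_bound; [lra|intros x _; apply Cc|intros x _; apply Bc]. }
    nra. }
  exists (E T). apply cdiff_eps. intros eps Heps.
  set (A := K2 * exp (2 * (K * T)) * exp (K * T) * T * exp (K * T)).
  assert (HA : 0 <= A).
  { unfold A. repeat apply Rmult_le_pos; try apply Rlt_le, exp_pos; assumption. }
  exists (Rmin ((1 - Cmod z) / 2) (eps / (A + 1))). split.
  { apply Rmin_case; [lra|]. apply Rdiv_lt_0_compat; lra. }
  intros w Hw. set (h := (w - z)%C) in *.
  pose proof (Rlt_le_trans _ _ _ Hw (Rmin_l _ _)) as w1.
  pose proof (Rlt_le_trans _ _ _ Hw (Rmin_r _ _)) as w2.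
  assert (Hwr : Cmod w <= r) by (pose proof (Cmod_triangle_inv w z); unfold h, r in *; lra).
  assert (Hw1 : Cmod w < 1) by lra.
  destruct (HF w Hw1) as [Fw0 Fw].
  set (d := fun s => (F s w - F s z)%C).
  assert (Bd : forall s, 0 <= s <= T -> Cmod (d s) <= Cmod h * exp (K * T)).
  { intros s Hs. eapply Rle_trans.
    - apply (orbits_close (fun s => F s z) (fun s => F s w) r K s); [lra|exact HL| |].
      + intros t Ht. destruct (Fz t); [lra|]. split; [unfold r; lra|assumption].
      + intros t Ht. destruct (Fw t); [lra|]. split; [lra|assumption].
    - cbv beta. rewrite Fz0, Fw0. fold h. apply Rmult_le_compat_l; [apply Cmod_ge_0|].
      apply exp_le_compat. apply Rmult_le_compat_l; lra. }
  set (e := fun s => ((d s - h * E s) * cexp (I s))%C).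
  set (Rm := fun s => (f (F s w) - f (F s z) - f' (F s z) * (F s w - F s z))%C).
  assert (De : forall s, 0 <= s <= T -> rdiff e s (- Rm s * cexp (I s))%C).
  { intros s Hs. unfold e. eapply diff_val; cycle 1.
    - apply rdiff_mult.
      + apply diff_minus; [apply diff_minus; [apply (Fw s); lra|apply (Fz s); lra]|apply diff_scal, DE].
      + apply (rdiff_comp cexp I); [apply cdiff_cexp|apply DI].
    - cbv beta. rewrite Hc0 by lra. unfold d, Rm. ring. }
  assert (Be : Cmod (e T - e 0) <= K2 * (Cmod h * exp (K * T)) ^ 2 * exp (K * T) * (T - 0)).
  { apply (rdiff_Cmod_le e (fun s => (- Rm s * cexp (I s))%C)); [exact HT|exact De|].
    intros s Hs. rewrite Cmod_mult, Cmod_opp, Cmod_cexp.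
    apply Rmult_le_compat; [apply Cmod_ge_0|apply Rlt_le, exp_pos| |].
    - eapply Rle_trans.
      + apply HT2; [destruct (Fz s); unfold r; lra|destruct (Fw s); lra].
      + apply Rmult_le_compat_l; [exact HK2|]. apply pow_incr. split; [apply Cmod_ge_0|apply Bd, Hs].
    - apply exp_le_compat. eapply Rle_trans; [apply Re_le_Cmod|apply BI, Hs]. }
  assert (e0 : e 0 = 0).
  { unfold e, d, E. rewrite Fz0, Fw0, I0. replace (- 0)%C with (RtoC 0) by ring. rewrite cexp_0. fold h. ring. }
  rewrite e0 in Be. replace (e T - 0)%C with (e T) in Be by ring.
  assert (Ed : (F T w - F T z - E T * h)%C = (e T * cexp (- I T))%C).
  { unfold e. rewrite <- Cmult_assoc, cexp_opp_r. unfold d. ring. }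
  rewrite Ed, Cmod_mult, Cmod_cexp.
  assert (exp (Re (- I T)) <= exp (K * T)).
  { apply exp_le_compat. eapply Rle_trans; [apply Re_le_Cmod|]. rewrite Cmod_opp. apply BI. lra. }
  apply Rle_trans with (A * Cmod h * Cmod h).
  { replace (A * Cmod h * Cmod h) with (K2 * (Cmod h * exp (K * T)) ^ 2 * exp (K * T) * (T - 0) * exp (K * T)).
    - apply Rmult_le_compat; [apply Cmod_ge_0|apply Rlt_le, exp_pos|exact Be|assumption].
    - unfold A. replace (2 * (K * T)) with (K * T + K * T) by ring. rewrite exp_plus. ring. }
  apply Rmult_le_compat_r; [apply Cmod_ge_0|]. pose proof (Cmod_ge_0 h).
  apply Rle_trans with ((A + 1) * Cmod h); [nra|].
  replace eps with ((A + 1) * (eps / (A + 1))) by (field; lra).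
  apply Rmult_le_compat_l; lra.
Qed.

Lemma flow_semigroup : exists F : R -> C -> C,
  generates f F /\ semigroup_of_self_maps F /\
  forall (z : C) (t : R), in_disk z -> 0 < t -> Cmod (F t z) <= exp (- gam * t) * Cmod z.
Proof.
  assert (Hex : forall z, exists u : R -> C, Cmod z < 1 -> u 0 = z /\
    forall t, 0 <= t -> rdiff u t (- f (u t))%C /\ Cmod (u t) <= exp (- gam * t) * Cmod z).
  { intros z. destruct (Rlt_or_le (Cmod z) 1) as [H|H].
    - destruct (flow_exists z H) as [u Hu]. exists u. auto.
    - exists (fun _ => z). lra. }
  set (F := fun t z => proj1_sig (constructive_indefinite_description _ (Hex z)) t).
  assert (HF : forall z, Cmod z < 1 -> F 0 z = z /\ forall t, 0 <= t ->
    rdiff (fun t => F t z) t (- f (F t z))%C /\ Cmod (F t z) <= exp (- gam * t) * Cmod z).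
  { intros z. exact (proj2_sig (constructive_indefinite_description _ (Hex z))). }
  assert (HF' : forall z, Cmod z < 1 -> F 0 z = z /\ forall t, 0 <= t ->
    Cmod (F t z) <= Cmod z /\ rdiff (fun t => F t z) t (- f (F t z))%C).
  { intros z Hz. destruct (HF z Hz) as [H0 H]. split; [exact H0|]. intros t Ht.
    destruct (H t Ht) as [H1 H2]. split; [|exact H1]. eapply Rle_trans; [exact H2|].
    assert (exp (- gam * t) <= 1).
    { rewrite <- exp_0. apply exp_le_compat. assert (0 <= gam * t) by (apply Rmult_le_pos; assumption). lra. }
    pose proof (Cmod_ge_0 z). nra. }
  assert (HF1 : forall z, Cmod z < 1 -> F 0 z = z /\ forall t, 0 <= t ->
    Cmod (F t z) < 1 /\ rdiff (fun t => F t z) t (- f (F t z))%C).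
  { intros z Hz. destruct (HF' z Hz) as [H0 H]. split; [exact H0|]. intros t Ht.
    destruct (H t Ht) as [H1 H2]. split; [lra|exact H2]. }
  exists F. split; [|split].
  - intros z Hz. split.
    + destruct (HF1 z Hz) as [H0 H]. split; [exact H0|]. intros t Ht. destruct (H t Ht) as [H1 H2].
      split; [exact H1|]. apply rdiff_is_derive_ge0; assumption.
    + intros v Hv. apply (flow_unique (fun t => F t z) v z Hz); [apply HF1, Hz|exact Hv].
  - split; [|split; [|split]].
    + intros t Ht. split.
      * intros z Hz. destruct (flow_holomorphic F HF' t z Ht Hz) as [l Hl]. exists l.
        apply cdiff_is_derive, Hl.
      * intros z Hz. destruct (HF1 z Hz) as [_ H]. apply H, Ht.
    + intros z Hz. apply HF, Hz.
    + intros s t z Hs Ht Hz. destruct (HF1 z Hz) as [_ Hzt].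
      destruct (Hzt t Ht) as [Hd _].
      apply (flow_unique (fun s => F s (F t z)) (fun s => F (s + t) z) (F t z)); [exact Hd|apply HF1, Hd| |exact Hs].
      split; [f_equal; ring|]. intros x Hx. destruct (Hzt (x + t)) as [H1 H2]; [lra|].
      split; [exact H1|]. apply rdiff_is_derive_ge0; [exact Hx|].
      rewrite rdiff_eps in *. intros eps Heps. destruct (H2 eps Heps) as [d [Hd1 Hd2]].
      exists d; split; [exact Hd1|]. intros y Hy. specialize (Hd2 (y + t)).
      replace (y + t - (x + t)) with (y - x) in Hd2 by ring. apply Hd2, Hy.
    + intros z Hz. destruct (HF1 z Hz) as [H0 H]. destruct (H 0 (Rle_refl 0)) as [_ H2].
      apply rdiff_cont in H2. intros P HP. rewrite <- H0 in HP.
      destruct (proj1 (locally_Cmod _ _) HP) as [d [Hd Hd']].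
      destruct (proj1 (locally_Rabs _ _) (H2 d Hd)) as [e [He He']].
      unfold filtermap, at_right, within. apply locally_Rabs. exists e; split; [exact He|].
      intros t Ht _. apply Hd', He', Ht.
  - intros z t Hz Ht. destruct (HF z Hz) as [_ H]. apply H. lra.
Qed.

End Flow.

Lemma class_M_semigroup : forall alpha f, 1 / 2 <= alpha <= 1 -> class_M alpha f ->
  exists F : R -> C -> C,
    generates f F /\ semigroup_of_self_maps F /\
    forall (z : C) (t : R), in_disk z -> 0 < t ->
      Cmod (F t z) <= exp ((1 - 2 * alpha) / (2 * alpha) * t) * Cmod z.
Proof.
  intros alpha f Ha HM.
  set (gam := - ((1 - 2 * alpha) / (2 * alpha))).
  assert (Eg : alpha * gam = alpha - 1 / 2) by (unfold gam; field; lra).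
  assert (Hg : 0 <= gam < 1).
  { split; apply Rnot_lt_le || apply Rnot_le_lt; intros K; nra. }
  destruct (class_A_quotient f (proj1 HM)) as [p [p' [Hp [_ [E [Ep [D _]]]]]]].
  assert (HRe := class_M_Re_gt alpha gam f HM Hg ltac:(lra) (or_introl (proj2 Ha))).
  destruct (flow_semigroup f (fun z => (p z + z * p' z)%C) p p' gam D Hp E (proj1 Hg)) as [F HF].
  - intros z Hz. rewrite <- Ep. apply Rlt_le, HRe, Hz.
  - exists F. destruct HF as [H1 [H2 H3]]. split; [exact H1|]. split; [exact H2|].
    intros z t Hz Ht. specialize (H3 z t Hz Ht). unfold gam in H3. rewrite Ropp_involutive in H3. exact H3.
Qed.

(** * Second order expansions at the origin *)

Definition bounded_near_0 (r : C -> C) : Prop :=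
  exists B d, 0 <= B /\ 0 < d /\ forall z : C, z <> 0 -> Cmod z < d -> Cmod (r z) <= B.

Lemma bounded_const : forall c, bounded_near_0 (fun _ => c).
Proof. intros c. exists (Cmod c), 1. split; [apply Cmod_ge_0|]. split; [lra|]. intros; lra. Qed.

Lemma bounded_id : bounded_near_0 (fun z => z).
Proof. exists 1, 1. split; [lra|]. split; [lra|]. intros; lra. Qed.

Lemma bounded_plus : forall r s, bounded_near_0 r -> bounded_near_0 s ->
  bounded_near_0 (fun z => (r z + s z)%C).
Proof.
  intros r s [B [d [HB [Hd H]]]] [B' [d' [HB' [Hd' H']]]].
  exists (B + B'), (Rmin d d'). split; [lra|]. split; [apply Rmin_case; assumption|].
  intros z Hz Hz'. eapply Rle_trans; [apply Cmod_triangle|].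
  apply Rplus_le_compat; [apply H|apply H']; try exact Hz; (eapply Rlt_le_trans; [exact Hz'|]).
  - apply Rmin_l.
  - apply Rmin_r.
Qed.

Lemma bounded_mult : forall r s, bounded_near_0 r -> bounded_near_0 s ->
  bounded_near_0 (fun z => (r z * s z)%C).
Proof.
  intros r s [B [d [HB [Hd H]]]] [B' [d' [HB' [Hd' H']]]].
  exists (B * B'), (Rmin d d'). split; [nra|]. split; [apply Rmin_case; assumption|].
  intros z Hz Hz'. rewrite Cmod_mult.
  apply Rmult_le_compat; try apply Cmod_ge_0; [apply H|apply H']; try exact Hz; (eapply Rlt_le_trans; [exact Hz'|]).
  - apply Rmin_l.
  - apply Rmin_r.
Qed.

Ltac bounded := repeat first [assumption | apply bounded_const | apply bounded_id
  | apply bounded_plus | apply bounded_mult].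

(** Expansion up to [O(z^3)] at the origin. The value at the origin is ignored, as
    are those outside the disk, where total functions are arbitrary. *)
Definition jet (g : C -> C) (a0 a1 a2 : C) : Prop :=
  exists r, bounded_near_0 r /\ forall z : C, z <> 0 -> Cmod z < 1 ->
    g z = (a0 + a1 * z + a2 * (z * z) + z * z * z * r z)%C.

Lemma jet_ext : forall g h a0 a1 a2, (forall z : C, z <> 0 -> Cmod z < 1 -> g z = h z) -> jet g a0 a1 a2 -> jet h a0 a1 a2.
Proof.
  intros g h a0 a1 a2 E [r [Hr H]]. exists r. split; [exact Hr|].
  intros z Hz Hz1. rewrite <- E by assumption. auto.
Qed.

Lemma jet_val : forall g a0 a1 a2 b0 b1 b2, a0 = b0 -> a1 = b1 -> a2 = b2 ->
  jet g a0 a1 a2 -> jet g b0 b1 b2.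
Proof. intros; subst; assumption. Qed.

Lemma jet_const : forall c, jet (fun _ => c) c 0 0.
Proof. intros c. exists (fun _ => 0). split; [bounded|]. intros; ring. Qed.

Lemma jet_plus : forall g h a0 a1 a2 b0 b1 b2, jet g a0 a1 a2 -> jet h b0 b1 b2 ->
  jet (fun z => (g z + h z)%C) (a0 + b0) (a1 + b1) (a2 + b2).
Proof.
  intros g h a0 a1 a2 b0 b1 b2 [r [Hr H]] [s [Hs H']].
  exists (fun z => (r z + s z)%C). split; [bounded|].
  intros z Hz Hz1. rewrite H, H' by assumption. ring.
Qed.

Lemma jet_mult : forall g h a0 a1 a2 b0 b1 b2, jet g a0 a1 a2 -> jet h b0 b1 b2 ->
  jet (fun z => (g z * h z)%C) (a0 * b0) (a0 * b1 + a1 * b0) (a0 * b2 + a1 * b1 + a2 * b0).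
Proof.
  intros g h a0 a1 a2 b0 b1 b2 [r [Hr H]] [s [Hs H']].
  exists (fun z => (a1 * b2 + a2 * b1 + z * (a2 * b2) + r z * (b0 + b1 * z + b2 * (z * z))
     + (a0 + a1 * z + a2 * (z * z)) * s z + (z * z * z) * (r z * s z))%C).
  split; [bounded|]. intros z Hz Hz1. rewrite H, H' by assumption. ring.
Qed.

Lemma jet_scal : forall c g a0 a1 a2, jet g a0 a1 a2 ->
  jet (fun z => (c * g z)%C) (c * a0) (c * a1) (c * a2).
Proof.
  intros c g a0 a1 a2 H. eapply jet_val; [| | |apply jet_mult; [apply jet_const|exact H]]; ring.
Qed.

Lemma tends_of_bounded : forall g r a, bounded_near_0 r ->
  (forall z : C, z <> 0 -> Cmod z < 1 -> g z = (a + z * r z)%C) -> tends_at g 0 a.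
Proof.
  intros g r a [B [d [HB [Hd H]]]] Hg eps Heps.
  exists (Rmin (Rmin d 1) (eps / (B + 1))). split.
  { apply Rmin_case; [apply Rmin_case; lra|]. apply Rdiv_lt_0_compat; lra. }
  intros z Hz Hz'. replace (z - 0)%C with z in Hz' by ring.
  pose proof (Rlt_le_trans _ _ _ Hz' (Rmin_l _ _)) as z1.
  pose proof (Rlt_le_trans _ _ _ Hz' (Rmin_r _ _)) as z2.
  pose proof (Rlt_le_trans _ _ _ z1 (Rmin_r _ _)) as z3.
  pose proof (Rlt_le_trans _ _ _ z1 (Rmin_l _ _)) as z4.
  rewrite Hg by assumption. replace (a + z * r z - a)%C with (z * r z)%C by ring.
  rewrite Cmod_mult. specialize (H z Hz z4). pose proof (Cmod_ge_0 z).
  apply Rle_lt_trans with (Cmod z * (B + 1)); [apply Rmult_le_compat_l; lra|].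
  replace eps with (eps / (B + 1) * (B + 1)) by (field; lra).
  apply Rmult_lt_compat_r; lra.
Qed.

Lemma tends_at_unique : forall g z L L', tends_at g z L -> tends_at g z L' -> L = L'.
Proof.
  intros g z L L' H H'.
  assert (E : (L - L' = 0)%C); [|replace L with (L - L' + L')%C by ring; rewrite E; ring].
  apply Cmod_eq_0. apply Rle_antisym; [|apply Cmod_ge_0]. apply Rnot_lt_le. intros P.
  assert (P2 : 0 < Cmod (L - L') / 2) by lra.
  destruct (H _ P2) as [d [Hd K]]. destruct (H' _ P2) as [d' [Hd' K']].
  set (m := Rmin d d'). assert (Hm : 0 < m) by (apply Rmin_case; assumption).
  pose proof (Rmin_l d d') as m1. pose proof (Rmin_r d d') as m2. fold m in m1, m2.
  assert (Hw : Cmod (z + RtoC (m / 2) - z) = m / 2).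
  { replace (z + RtoC (m / 2) - z)%C with (RtoC (m / 2)) by ring. rewrite Cmod_R, Rabs_pos_eq; lra. }
  assert (Hne : (z + RtoC (m / 2))%C <> z).
  { intros E. rewrite E in Hw. rewrite Cmod_diag in Hw. lra. }
  assert (Q := K _ Hne). assert (Q' := K' _ Hne). rewrite Hw in Q, Q'.
  pose proof (Cmod_minus_triangle L (g (z + RtoC (m / 2))%C) L') as T.
  rewrite (Cmod_minus_sym L (g _)) in T. specialize (Q ltac:(lra)). specialize (Q' ltac:(lra)). lra.
Qed.

Lemma jet_tends : forall g a0 a1 a2, jet g a0 a1 a2 -> tends_at g 0 a0.
Proof.
  intros g a0 a1 a2 [r [Hr H]].
  apply (tends_of_bounded g (fun z => (a1 + a2 * z + z * z * r z)%C)); [bounded|].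
  intros z Hz Hz1. rewrite H by assumption. ring.
Qed.

Lemma jet_unique : forall g a0 a1 a2 b0 b1 b2, jet g a0 a1 a2 -> jet g b0 b1 b2 ->
  a0 = b0 /\ a1 = b1 /\ a2 = b2.
Proof.
  intros g a0 a1 a2 b0 b1 b2 Ha Hb.
  assert (E0 : a0 = b0) by (apply (tends_at_unique g 0); eapply jet_tends; eassumption).
  split; [exact E0|]. subst b0.
  assert (T1 : forall b1 b2, jet g a0 b1 b2 -> tends_at (fun z => ((g z - a0) / z)%C) 0 b1).
  { intros c1 c2 [r [Hr H]]. apply (tends_of_bounded _ (fun z => (c2 + z * r z)%C)); [bounded|].
    intros z Hz Hz1. rewrite H by assumption. field. exact Hz. }
  assert (E1 : a1 = b1) by (eapply tends_at_unique; eapply T1; eassumption).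
  split; [exact E1|]. subst b1.
  assert (T2 : forall b2, jet g a0 a1 b2 -> tends_at (fun z => ((g z - a0 - a1 * z) / (z * z))%C) 0 b2).
  { intros c2 [r [Hr H]]. apply (tends_of_bounded _ r); [bounded|].
    intros z Hz Hz1. rewrite H by assumption. field. exact Hz. }
  eapply tends_at_unique; eapply T2; eassumption.
Qed.

Lemma bounded_inv : forall (g : C -> C) (a : C), tends_at g 0 a -> a <> 0 -> bounded_near_0 (fun z => (/ g z)%C).
Proof.
  intros g a H Ha. pose proof (proj1 (Cmod_gt_0 a) Ha) as Pa.
  destruct (H (Cmod a / 2)) as [d [Hd K]]; [lra|].
  exists (/ (Cmod a / 2)), d. split; [apply Rlt_le, Rinv_0_lt_compat; lra|]. split; [exact Hd|].
  intros z Hz Hz'. specialize (K z Hz). replace (z - 0)%C with z in K by ring. specialize (K Hz').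
  pose proof (Cmod_triangle_inv a (g z)) as Q. rewrite Cmod_minus_sym in Q.
  assert (Hg : g z <> 0) by (apply Cmod_gt_0; lra).
  rewrite Cmod_inv by exact Hg. apply Rinv_le_contravar; lra.
Qed.

Lemma jet_inv : forall (g : C -> C) (a1 a2 : C), (forall z : C, z <> 0 -> Cmod z < 1 -> g z <> 0) -> jet g 1 a1 a2 ->
  jet (fun z => (/ g z)%C) 1 (- a1) (a1 * a1 - a2).
Proof.
  intros g a1 a2 Hne Hg.
  assert (Hb : bounded_near_0 (fun z => (/ g z)%C)).
  { apply bounded_inv with (RtoC 1); [eapply jet_tends, Hg|]. intros K. apply RtoC_inj in K. lra. }
  assert (HP : jet (fun z => (1 + - a1 * z + (a1 * a1 - a2) * (z * z))%C) 1 (- a1) (a1 * a1 - a2)).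
  { exists (fun _ => 0). split; [bounded|]. intros; ring. }
  destruct (jet_mult _ _ _ _ _ _ _ _ Hg HP) as [r [Hr H]].
  exists (fun z => (- (1) * r z * / g z)%C). split; [bounded|].
  intros z Hz Hz1. specialize (H z Hz Hz1). specialize (Hne z Hz Hz1).
  assert (E : (1 + - a1 * z + (a1 * a1 - a2) * (z * z))%C = ((1 + z * z * z * r z) / g z)%C).
  { replace (1 + z * z * z * r z)%C with (g z * (1 + - a1 * z + (a1 * a1 - a2) * (z * z)))%C
      by (rewrite H; ring). field. exact Hne. }
  rewrite E. field. exact Hne.
Qed.

(** * Coefficient bounds for Schwarz functions *)

Lemma tends_at_div : forall (g h : C -> C) (z a b : C), tends_at g z a -> tends_at h z b -> b <> 0 ->
  tends_at (fun w => (g w / h w)%C) z (a / b)%C.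
Proof.
  intros g h z a b Hg Hh Hb.
  apply tends_at_ext with (fun w => (patch g z a w / patch h z b w)%C).
  { intros w Hw _. rewrite !patch_off by exact Hw. reflexivity. }
  replace (a / b)%C with (patch g z a z / patch h z b z)%C by (rewrite !patch_at; reflexivity).
  apply (cont_tends (fun w => (patch g z a w / patch h z b w)%C)).
  apply ccont_div; try apply patch_cont; try assumption. rewrite patch_at. exact Hb.
Qed.

Lemma disk_automorphism_bound : forall a x : C, Cmod a <= 1 -> Cmod x <= 1 ->
  Cmod (x - a) <= Cmod (1 - Cconj a * x).
Proof.
  intros a x Ha Hx.
  assert (E : Cmod (1 - Cconj a * x) ^ 2 - Cmod (x - a) ^ 2 = (1 - Cmod a ^ 2) * (1 - Cmod x ^ 2)).
  { rewrite !Cmod2_alt. unfold Re, Im, Cconj; simpl. ring. }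
  pose proof (Cmod_ge_0 a). pose proof (Cmod_ge_0 x).
  pose proof (Cmod_ge_0 (x - a)). pose proof (Cmod_ge_0 (1 - Cconj a * x)).
  assert (0 <= (1 - Cmod a ^ 2) * (1 - Cmod x ^ 2)) by (apply Rmult_le_pos; nra).
  nra.
Qed.

(** Schwarz's lemma bounds [psi = phi / w] by [1], with [psi 0 = b1]; composing with
    the disk automorphism that sends [b1] to [0] one applies it again, and the
    derivative at [0] gives the bound on [b2]. Replacing [psi] by [s psi] with
    [s < 1] covers [|b1| = 1], where the automorphism degenerates. *)
Lemma schwarz_coefficients : forall phi b1 b2,
  (forall w : C, w <> 0 -> Cmod w < 1 -> exists l, cdiff phi w l) ->
  (forall w : C, w <> 0 -> Cmod w < 1 -> Cmod (phi w) <= 1) ->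
  jet phi 0 b1 b2 -> Cmod b2 <= 1 - Cmod b1 ^ 2.
Proof.
  intros phi b1 b2 Hd Hb [r [Hr Hj]].
  set (psi := fun w => (phi w / w)%C).
  assert (Hpsi : forall w : C, w <> 0 -> Cmod w < 1 -> psi w = (b1 + b2 * w + w * w * r w)%C).
  { intros w Hw Hw1. unfold psi. rewrite Hj by assumption. field. exact Hw. }
  assert (Tpsi : tends_at psi 0 b1).
  { apply (tends_of_bounded psi (fun w => (b2 + w * r w)%C)); [bounded|].
    intros w Hw Hw1. rewrite Hpsi by assumption. ring. }
  destruct (schwarz phi b1 Hd Hb Tpsi) as [S1 S2].
  assert (Bpsi : forall w : C, w <> 0 -> Cmod w < 1 -> Cmod (psi w) <= 1).
  { intros w Hw Hw'. apply Cmod_div_le; [exact Hw|]. specialize (S1 w Hw Hw'). lra. }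
  assert (Hs : forall s, 0 < s < 1 -> s * Cmod b2 <= 1 - s ^ 2 * Cmod b1 ^ 2).
  { intros s Hs.
    set (den := fun w => (1 - Cconj (RtoC s * b1) * (RtoC s * psi w))%C).
    assert (Hden0 : forall x, Cmod x <= 1 -> (1 - Cconj (RtoC s * b1) * (RtoC s * x))%C <> 0).
    { intros x Hx. apply Cmod_gt_0.
      eapply Rlt_le_trans; [|apply Cmod_triangle_inv]. rewrite Cmod_1, !Cmod_mult, Cmod_conj, Cmod_mult, Cmod_R, Rabs_pos_eq by lra.
      pose proof (Cmod_ge_0 x). pose proof (Cmod_ge_0 b1).
      assert (s * Cmod b1 <= s * 1) by (apply Rmult_le_compat_l; lra).
      assert (s * Cmod x <= s * 1) by (apply Rmult_le_compat_l; lra).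
      assert (0 <= s * Cmod b1) by (apply Rmult_le_pos; lra). nra. }
    set (T := fun w => ((RtoC s * psi w - RtoC s * b1) / den w)%C).
    set (D := (1 - Cconj (RtoC s * b1) * (RtoC s * b1))%C).
    assert (HD : D <> 0) by (apply Hden0, S2).
    assert (TT : tends_at (fun w => (T w / w)%C) 0 (RtoC s * b2 / D)%C).
    { apply tends_at_ext with (fun w => ((RtoC s * (b2 + w * r w)) / den w)%C).
      - intros w Hw Hw1. replace (w - 0)%C with w in Hw1 by ring. unfold T. rewrite Hpsi by assumption. unfold Cdiv.
        replace (RtoC s * (b1 + b2 * w + w * w * r w) - RtoC s * b1)%C
          with (w * (RtoC s * (b2 + w * r w)))%C by ring.
        replace (w * (RtoC s * (b2 + w * r w)) * / den w * / w)%C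
          with (RtoC s * (b2 + w * r w) * / den w * (w * / w))%C by ring.
        rewrite Cinv_r by exact Hw. ring.
      - apply tends_at_div; [| |exact HD].
        + apply (tends_of_bounded _ (fun w => (RtoC s * r w)%C)); [bounded|]. intros; ring.
        + apply (tends_of_bounded _ (fun w => (- Cconj (RtoC s * b1) * (RtoC s * (b2 + w * r w)))%C)); [bounded|].
          intros w Hw Hw1. unfold den, D. rewrite Hpsi by assumption. ring. }
    destruct (schwarz T (RtoC s * b2 / D)%C) as [_ Q]; [| |exact TT|].
    - intros w Hw Hw'. destruct (Hd w Hw Hw') as [l Hl].
      assert (Dpsi : exists m, cdiff psi w m).
      { eexists. apply cdiff_div; [exact Hl|apply cdiff_id|exact Hw]. }
      destruct Dpsi as [m Hm]. eexists. apply cdiff_div.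
      + apply diff_minus; [apply diff_scal, Hm|apply diff_const].
      + apply diff_minus; [apply diff_const|]. apply diff_scal. apply diff_scal, Hm.
      + apply Hden0, Bpsi; assumption.
    - intros w Hw Hw'. specialize (Bpsi w Hw Hw'). apply Cmod_div_le; [apply Hden0, Bpsi|].
      assert (Hx : Cmod (RtoC s * psi w) <= 1).
      { rewrite Cmod_mult, Cmod_R, Rabs_pos_eq by lra. pose proof (Cmod_ge_0 (psi w)). nra. }
      assert (Ha : Cmod (RtoC s * b1) <= 1).
      { rewrite Cmod_mult, Cmod_R, Rabs_pos_eq by lra. pose proof (Cmod_ge_0 b1). nra. }
      rewrite Rmult_1_l. exact (disk_automorphism_bound _ _ Ha Hx).
    - rewrite Cmod_div, Cmod_mult, Cmod_R, Rabs_pos_eq in Q by (try exact HD; lra).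
      assert (Pb1 := Cmod_ge_0 b1).
      assert (ED : D = RtoC (1 - s ^ 2 * Cmod b1 ^ 2)).
      { rewrite Cmod2_alt. unfold D. apply C_ext; unfold Re, Im, Cconj; simpl; ring. }
      assert (PD : 0 < 1 - s ^ 2 * Cmod b1 ^ 2).
      { assert (Cmod b1 ^ 2 <= 1) by nra. assert (0 <= Cmod b1 ^ 2) by apply pow2_ge_0.
        assert (s ^ 2 < 1) by nra. nra. }
      rewrite ED, Cmod_R, Rabs_pos_eq in Q by lra.
      apply Rmult_le_reg_r with (/ (1 - s ^ 2 * Cmod b1 ^ 2)); [apply Rinv_0_lt_compat, PD|].
      rewrite Rinv_r by lra. exact Q. }
  pose proof (Cmod_ge_0 b2) as Pb2. pose proof (pow2_ge_0 (Cmod b1)) as Pb1.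
  apply Rnot_lt_le. intros K. set (X := Cmod b2 + Cmod b1 ^ 2).
  assert (HX : 1 < X) by (unfold X; lra).
  assert (HiX : 0 < / X < 1).
  { split; [apply Rinv_0_lt_compat; lra|]. rewrite <- Rinv_1. apply Rinv_lt_contravar; lra. }
  set (s := sqrt ((1 + / X) / 2)).
  assert (Es : s * s = (1 + / X) / 2) by (apply sqrt_sqrt; lra).
  assert (Hs0 : 0 < s) by (apply sqrt_lt_R0; lra).
  assert (Hs1 : s < 1) by nra.
  specialize (Hs s (conj Hs0 Hs1)).
  assert (s * s * X <= 1).
  { unfold X. assert (s * s * Cmod b2 <= s * Cmod b2) by (apply Rmult_le_compat_r; nra).
    simpl in *. lra. }
  rewrite Es in H. assert ((1 + / X) / 2 * X = (X + 1) / 2) by (field; lra). lra.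
Qed.

(** * From Taylor coefficients to expansions *)

Lemma eventually_bounded : forall (a : nat -> R) N B, (forall n, (N <= n)%nat -> a n <= B) ->
  exists B', forall n, a n <= B'.
Proof.
  intros a N. induction N as [|N IH]; intros B H.
  - exists B. intros n. apply H. lia.
  - apply (IH (Rmax B (a N))). intros n Hn. destruct (Nat.eq_dec n N) as [->|E].
    + apply Rmax_r.
    + eapply Rle_trans; [apply H; lia|apply Rmax_l].
Qed.

(** The terms of the series are bounded at [1 / 2], so for [|z| <= 1 / 4] the tail
    is dominated by a geometric series of ratio at most [1 / 2]. *)
Lemma taylor_remainder : forall f c, taylor_coefficients f c ->
  exists B, 0 <= B /\ forall z, Cmod z <= 1 / 4 -> Cmod (f z - psum c z 4) <= B * Cmod z ^ 4.
Proof.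
  intros f c Hc.
  assert (Hbd : exists B, forall n, Cmod (c n) * (1 / 2) ^ n <= B).
  { assert (Hh : in_disk (RtoC (1 / 2))) by (unfold in_disk; rewrite Cmod_R, Rabs_pos_eq; lra).
    destruct (proj1 (is_pseries_psum _ _ _) (Hc _ Hh) 1) as [N HN]; [lra|].
    apply (eventually_bounded _ N 2). intros n Hn.
    assert (H1 := HN n Hn). assert (H2 := HN (S n) ltac:(lia)). simpl in H2.
    set (s := psum c (RtoC (1 / 2)) n) in *. set (l := f (RtoC (1 / 2))) in *.
    replace (Cmod (c n) * (1 / 2) ^ n) with (Cmod (c n * RtoC (1 / 2) ^ n)).
    - replace (c n * RtoC (1 / 2) ^ n)%C with ((s + c n * RtoC (1 / 2) ^ n - l) - (s - l))%C by ring.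
      eapply Rle_trans; [apply Cmod_triangle_sub|]. lra.
    - rewrite Cmod_mult, Cmod_pow, Cmod_R, Rabs_pos_eq by lra. reflexivity. }
  destruct Hbd as [B HB].
  assert (PB : 0 <= B).
  { eapply Rle_trans; [|apply (HB 0%nat)]. simpl. pose proof (Cmod_ge_0 (c 0%nat)). lra. }
  exists (2 * B * 16). split; [lra|]. intros z Hz.
  set (x := 2 * Cmod z). assert (Hx : 0 <= x <= 1 / 2) by (pose proof (Cmod_ge_0 z); unfold x; lra).
  assert (Hterm : forall n, Cmod (c n * z ^ n) <= B * x ^ n).
  { intros n. rewrite Cmod_mult, Cmod_pow. replace (Cmod z) with (1 / 2 * x) by (unfold x; field).
    rewrite Rpow_mult_distr, <- Rmult_assoc. apply Rmult_le_compat_r; [apply pow_le; lra|apply HB]. }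
  assert (Hsum : forall k, Cmod (psum c z (4 + k) - psum c z 4) <= 2 * B * (x ^ 4 - x ^ (4 + k))).
  { induction k as [|k IH].
    - rewrite Nat.add_0_r. replace (psum c z 4 - psum c z 4)%C with (RtoC 0) by ring. rewrite Cmod_0. lra.
    - rewrite Nat.add_succ_r.
      change (psum c z (S (4 + k))) with (psum c z (4 + k) + c (4 + k)%nat * z ^ (4 + k))%C.
      replace (psum c z (4 + k) + c (4 + k)%nat * z ^ (4 + k) - psum c z 4)%C
        with (psum c z (4 + k) - psum c z 4 + c (4 + k)%nat * z ^ (4 + k))%C by ring.
      eapply Rle_trans; [apply Cmod_triangle|]. specialize (Hterm (4 + k)%nat).
      set (y := x ^ (4 + k)) in *. change (x ^ S (4 + k)) with (x * y).
      assert (0 <= y) by (apply pow_le; lra).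
      assert (B * (x * y) <= B * (1 / 2 * y)) by (apply Rmult_le_compat_l; [exact PB|nra]). lra. }
  replace (2 * B * 16 * Cmod z ^ 4) with (2 * B * x ^ 4) by (unfold x; ring).
  apply Rnot_lt_le. intros K.
  assert (Hd : in_disk z) by (unfold in_disk; lra).
  destruct (proj1 (is_pseries_psum _ _ _) (Hc z Hd) (Cmod (f z - psum c z 4) - 2 * B * x ^ 4)) as [N HN]; [lra|].
  specialize (HN (4 + N)%nat ltac:(lia)). specialize (Hsum N).
  pose proof (Cmod_minus_triangle (f z) (psum c z (4 + N)) (psum c z 4)) as T.
  rewrite (Cmod_minus_sym (f z) (psum c z (4 + N))) in T.
  assert (0 <= x ^ (4 + N)) by (apply pow_le; lra).
  assert (0 <= B * x ^ (4 + N)) by (apply Rmult_le_pos; assumption). lra.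
Qed.

Lemma taylor_at_0 : forall f c, taylor_coefficients f c -> c 0%nat = f 0.
Proof.
  intros f c Hc.
  assert (H0 : in_disk 0) by (unfold in_disk; rewrite Cmod_0; lra).
  assert (Ep : forall n, psum c 0 (S n) = c 0%nat).
  { induction n as [|n IH]; [simpl; ring|].
    change (psum c 0 (S (S n))) with (psum c 0 (S n) + c (S n) * 0 ^ (S n))%C. rewrite IH. simpl. ring. }
  assert (E : (c 0%nat - f 0 = 0)%C); [|replace (c 0%nat) with (c 0%nat - f 0 + f 0)%C by ring; rewrite E; ring].
  apply Cmod_eq_0. apply Rle_antisym; [|apply Cmod_ge_0]. apply Rnot_lt_le. intros P.
  destruct (proj1 (is_pseries_psum _ _ _) (Hc _ H0) _ P) as [N HN].
  specialize (HN (S N) ltac:(lia)). rewrite Ep in HN. lra.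
Qed.

Lemma taylor_jet : forall f c p, taylor_coefficients f c -> (forall z, f z = (z * p z)%C) ->
  jet p (c 1%nat) (c 2%nat) (c 3%nat).
Proof.
  intros f c p Hc Hfp.
  assert (Hc0 : c 0%nat = 0) by (rewrite (taylor_at_0 f c Hc), Hfp; ring).
  destruct (taylor_remainder f c Hc) as [B [HB HR]].
  exists (fun z => ((f z - psum c z 4) / (z * z * z * z))%C). split.
  - exists B, (1 / 4). split; [exact HB|]. split; [lra|]. intros z Hz Hz'.
    assert (H4 : (z * z * z * z <> 0)%C) by (repeat apply Cmult_neq_0; exact Hz).
    apply Cmod_div_le; [exact H4|]. rewrite !Cmod_mult.
    specialize (HR z ltac:(lra)). simpl in HR |- *. lra.
  - intros z Hz _. simpl. rewrite Hc0, Hfp. field. exact Hz.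
Qed.

(** Cauchy's estimate on the disk of radius [|z| / 2] around [z] bounds the
    derivative of the remainder. *)
Lemma jet_deriv : forall p p' a0 a1 a2, hol p p' -> jet p a0 a1 a2 ->
  jet (fun z => (z * p' z)%C) 0 a1 (2 * a2).
Proof.
  intros p p' a0 a1 a2 Hp [r [[B [d [HB [Hd Hr]]]] H]].
  exists (fun z => ((p' z - a1 - 2 * a2 * z) / (z * z))%C). split.
  2: { intros z Hz _. field. exact Hz. }
  exists (16 * B), (Rmin (d / 2) (1 / 2)). split; [lra|]. split; [apply Rmin_case; lra|].
  intros z Hz Hz'. pose proof (proj1 (Cmod_gt_0 z) Hz) as Pz.
  pose proof (Rlt_le_trans _ _ _ Hz' (Rmin_l _ _)) as z1.
  pose proof (Rlt_le_trans _ _ _ Hz' (Rmin_r _ _)) as z2.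
  set (R := fun w => (p w - (a0 + a1 * w + a2 * (w * w)))%C).
  assert (DR : forall w, Cmod w < 1 -> cdiff R w (p' w - (a1 + 2 * a2 * w))%C).
  { intros w Hw. apply diff_val with (p' w - (0 + a1 * 1 + a2 * (1 * w + w * 1)))%C; [ring|].
    apply diff_minus; [apply Hp, Hw|].
    apply (diff_plus (fun w => (a0 + a1 * w)%C)).
    - apply (diff_plus (fun _ => a0)); [apply diff_const|apply diff_scal, cdiff_id].
    - apply diff_scal. apply (cdiff_mult (fun w => w) (fun w => w)); apply cdiff_id. }
  assert (Hb : forall w, Cmod (w - z) <= Cmod z / 2 -> Cmod (R w) <= 4 * B * Cmod z ^ 3).
  { intros w Hw.
    pose proof (Cmod_triangle_inv w z) as Q1. pose proof (Cmod_triangle_inv z w) as Q2.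
    rewrite Cmod_minus_sym in Q2.
    assert (Hw0 : w <> 0) by (apply Cmod_gt_0; lra).
    replace (R w) with (w * w * w * r w)%C by (unfold R; rewrite H by (exact Hw0 || lra); ring).
    rewrite !Cmod_mult. specialize (Hr w Hw0 ltac:(lra)).
    assert (Hw3 : Cmod w * Cmod w * Cmod w <= 4 * Cmod z ^ 3).
    { replace (Cmod w * Cmod w * Cmod w) with (Cmod w ^ 3) by ring.
      apply Rle_trans with ((3 / 2 * Cmod z) ^ 3).
      - apply pow_incr. split; [apply Cmod_ge_0|lra].
      - rewrite Rpow_mult_distr. assert (0 < Cmod z ^ 3) by (apply pow_lt, Pz). lra. }
    replace (4 * B * Cmod z ^ 3) with (4 * Cmod z ^ 3 * B) by ring.
    apply Rmult_le_compat; try apply Cmod_ge_0; try assumption.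
    repeat apply Rmult_le_pos; apply Cmod_ge_0. }
  assert (Q : Cmod (p' z - (a1 + 2 * a2 * z)) <= 2 * (4 * B * Cmod z ^ 3) / (Cmod z / 2)).
  { apply (cauchy_estimate R z (Cmod z)); [|apply DR; lra|lra|exact Hb].
    intros w Hw. eexists. apply DR. pose proof (Cmod_triangle_inv w z). lra. }
  assert (Hz2 : (z * z <> 0)%C) by (apply Cmult_neq_0; exact Hz).
  apply Cmod_div_le; [exact Hz2|]. rewrite Cmod_mult.
  replace (p' z - a1 - 2 * a2 * z)%C with (p' z - (a1 + 2 * a2 * z))%C by ring.
  eapply Rle_trans; [exact Q|]. right. field. lra.
Qed.

(** * The Fekete-Szego bound *)

(** The function [phi = (q - 1) / q] is bounded by [1] because [Re q > 1 / 2], and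
    its expansion starts with [c2 z + (2 - alpha) (c3 - c2^2) z^2]. The bound on the
    second coefficient of [phi] leaves a convex combination of [1 / (2 - alpha)]
    and [|1 - lambda|], with weights [1 - |c2|^2] and [|c2|^2]. *)
Lemma fekete_szego_upper : forall alpha lambda f c, 1 / 2 <= alpha <= 1 ->
  class_M alpha f -> taylor_coefficients f c ->
  Cmod (Phi c lambda) <= Rmax (1 / (2 - alpha)) (Cmod (1 - lambda)%C).
Proof.
  intros alpha lambda f c Ha HM Hc.
  destruct (class_M_sub_half alpha f Ha HM) as [_ Hhalf].
  destruct (class_M_quotient alpha f HM) as [p [p' [Hp [Hp0 [E [Ep [_ HRe]]]]]]].
  assert (Hpne : forall z, Cmod z < 1 -> p z <> 0).
  { intros z Hz. apply Re_pos_neq_0. rewrite <- Ep. specialize (Hhalf z Hz). lra. }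
  assert (Jp := taylor_jet f c p Hc E).
  assert (Hc1 : c 1%nat = 1).
  { apply (tends_at_unique p 0); [eapply jet_tends, Jp|]. rewrite <- Hp0. apply cont_tends.
    eapply cdiff_cont, Hp. rewrite Cmod_0; lra. }
  rewrite Hc1 in Jp.
  assert (Jd := jet_deriv p p' _ _ _ Hp Jp).
  destruct (hol_deriv p p' Hp) as [p'' Hp'].
  set (q := q_alpha alpha p p').
  assert (Hq : forall z, Cmod z < 1 -> 1 / 2 < Re (q z)) by (intros z Hz; apply HRe; auto).
  assert (Hqne : forall z, Cmod z < 1 -> q z <> 0).
  { intros z Hz. apply Re_pos_neq_0. specialize (Hq z Hz). lra. }
  assert (Jq : jet q 1 (c 2%nat)
    (RtoC (2 - alpha) * c 3%nat - RtoC (1 - alpha) * (c 2%nat * c 2%nat))).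
  { assert (Ji := jet_inv p _ _ (fun z _ Hz => Hpne z Hz) Jp).
    assert (J := jet_plus _ _ _ _ _ _ _ _ (jet_scal (RtoC alpha) _ _ _ _ Jp)
      (jet_scal (RtoC (1 - alpha)) _ _ _ _ (jet_plus _ _ _ _ _ _ _ _ (jet_const 1)
        (jet_mult _ _ _ _ _ _ _ _ Jd Ji)))).
    revert J. apply jet_val; rewrite ?RtoC_minus; ring. }
  assert (Dq : forall z, Cmod z < 1 -> exists l, cdiff q z l).
  { intros z Hz. eexists. apply diff_plus; apply diff_scal; [apply Hp, Hz|].
    apply diff_plus; [apply diff_const|]. apply cdiff_div; [|apply Hp, Hz|apply Hpne, Hz].
    apply cdiff_mult; [apply cdiff_id|apply Hp', Hz]. }
  set (phi := fun z => ((q z + - (1)) * / q z)%C).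
  assert (Jphi : jet phi 0 (c 2%nat) (RtoC (2 - alpha) * (c 3%nat - c 2%nat * c 2%nat))).
  { assert (J := jet_mult _ _ _ _ _ _ _ _ (jet_plus _ _ _ _ _ _ _ _ Jq (jet_const (- (1))%C))
      (jet_inv q _ _ (fun z _ Hz => Hqne z Hz) Jq)).
    revert J. apply jet_val; rewrite ?RtoC_minus; ring. }
  assert (HS := fun h1 h2 => schwarz_coefficients phi _ _ h1 h2 Jphi).
  assert (B2 : Cmod (RtoC (2 - alpha) * (c 3%nat - c 2%nat * c 2%nat)) <= 1 - Cmod (c 2%nat) ^ 2).
  { apply HS.
    - intros w _ Hw. destruct (Dq w Hw) as [l Hl]. eexists. apply cdiff_mult.
      + apply diff_plus; [exact Hl|apply diff_const].
      + apply cdiff_inv; [exact Hl|apply Hqne, Hw].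
    - intros w _ Hw. apply (Cmod_div_le (q w + - (1)) (q w)); [apply Hqne, Hw|].
      replace (q w + - (1))%C with (q w - 1)%C by ring. pose proof (Cmod_sub_1_lt _ (Hq w Hw)). lra. }
  clear HS. rewrite Cmod_mult, Cmod_R, Rabs_pos_eq in B2 by lra.
  set (m := Rmax (1 / (2 - alpha)) (Cmod (1 - lambda))).
  pose proof (Rmax_l (1 / (2 - alpha)) (Cmod (1 - lambda))) as m1.
  pose proof (Rmax_r (1 / (2 - alpha)) (Cmod (1 - lambda))) as m2. fold m in m1, m2.
  unfold Phi.
  replace (c 3%nat - lambda * (c 2%nat * c 2%nat))%C
    with ((c 3%nat - c 2%nat * c 2%nat) + (1 - lambda) * (c 2%nat * c 2%nat))%C by ring.
  eapply Rle_trans; [apply Cmod_triangle|]. rewrite !Cmod_mult.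
  set (x := Cmod (c 3%nat - c 2%nat * c 2%nat)) in *. set (y := Cmod (c 2%nat)) in *.
  assert (Px : 0 <= x) by apply Cmod_ge_0.
  assert (Py : 0 <= y ^ 2) by apply pow2_ge_0.
  assert (Hx : x <= (1 - y ^ 2) * (1 / (2 - alpha))).
  { apply Rmult_le_reg_l with (2 - alpha); [lra|].
    replace ((2 - alpha) * ((1 - y ^ 2) * (1 / (2 - alpha)))) with (1 - y ^ 2) by (field; lra). exact B2. }
  assert (H1 : (1 - y ^ 2) * (1 / (2 - alpha)) <= (1 - y ^ 2) * m) by (apply Rmult_le_compat_l; nra).
  assert (H2 : Cmod (1 - lambda) * (y * y) <= m * (y * y)) by (apply Rmult_le_compat_r; nra).
  simpl in H1. nra.
Qed.

(** * Extremal functions *)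

Lemma class_M_of_quotient : forall alpha p p', hol p p' -> p 0 = 1 ->
  (forall z, Cmod z < 1 -> p z <> 0) ->
  (forall z, Cmod z < 1 -> 1 / 2 < Re (q_alpha alpha p p' z)) ->
  class_M alpha (fun z => (z * p z)%C).
Proof.
  intros alpha p p' Hp Hp0 Hne HRe.
  assert (D : forall z, Cmod z < 1 -> cdiff (fun z => (z * p z)%C) z (1 * p z + z * p' z)%C).
  { intros z Hz. apply (cdiff_mult (fun z => z)); [apply cdiff_id|apply Hp, Hz]. }
  assert (HA : class_A (fun z => (z * p z)%C)).
  { split; [|split].
    - intros z Hz. eexists. apply cdiff_is_derive, D, Hz.
    - ring.
    - apply cdiff_is_derive. eapply diff_val; [|apply D; rewrite Cmod_0; lra]. rewrite Hp0. ring. }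
  split; [exact HA|]. split.
  - intros _ z Hz Hz0. apply Cmult_neq_0; [exact Hz0|apply Hne, Hz].
  - intros z Hz. specialize (HRe z Hz). unfold q_alpha in HRe.
    replace (f_over_z (fun z => (z * p z)%C) z) with (p z).
    2: { unfold f_over_z. destruct (Ceq_dec z 0) as [->|Hz0]; [exact Hp0|]. field. exact Hz0. }
    replace (zf'_over_f (fun z => (z * p z)%C) z) with (1 + z * p' z / p z)%C; [exact HRe|].
    unfold zf'_over_f. destruct (Ceq_dec z 0) as [->|Hz0].
    + rewrite Hp0. field.
    + rewrite (is_C_derive_unique _ _ _ (proj1 (cdiff_is_derive _ _ _) (D z Hz))).
      field. split; [apply Hne, Hz|exact Hz0].
Qed.

Lemma class_A_taylor : forall f, class_A f -> exists c, taylor_coefficients f c.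
Proof.
  intros f [Hf _]. apply hol_taylor with (C_derive f). intros z Hz.
  apply cdiff_is_derive, C_derive_correct; [exact z|]. apply Hf, Hz.
Qed.

Lemma Re_inv_1_sub : forall x rho, Cmod x <= rho -> rho < 1 -> / (1 + rho) <= Re (/ (1 - x)).
Proof.
  intros x rho Hx Hrho.
  pose proof (Cmod_ge_0 x) as Px. pose proof (Cmod2_alt x) as E.
  assert (Hx2 : Cmod x ^ 2 <= rho ^ 2) by (apply pow_incr; lra).
  pose proof (re_le_Cmod x) as Ra. destruct x as [a b]. unfold Re, Im in *; simpl in *.
  assert (Ha : - rho <= a <= rho) by (revert Ra; unfold Rabs; destruct Rcase_abs; lra).
  set (N := (1 + - a) * ((1 + - a) * 1) + (0 + - b) * ((0 + - b) * 1)).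
  assert (PN : 0 < N) by (unfold N; nra).
  apply Rmult_le_reg_r with (N * (1 + rho)); [apply Rmult_lt_0_compat; lra|].
  replace (/ (1 + rho) * (N * (1 + rho))) with N by (field; lra).
  replace ((1 + - a) / N * (N * (1 + rho))) with ((1 - a) * (1 + rho)) by (field; lra).
  assert (0 <= (1 - rho) * (rho + a)) by (apply Rmult_le_pos; lra).
  unfold N. nra.
Qed.

Lemma one_sub_neq_0 : forall x : C, Cmod x < 1 -> (1 - x)%C <> 0.
Proof.
  intros x Hx. apply Cmod_gt_0. pose proof (Cmod_triangle_inv 1 x) as Q. rewrite Cmod_1 in Q. lra.
Qed.

Lemma Cinv_neq_0 : forall x : C, x <> 0 -> (/ x)%C <> 0.
Proof.
  intros x Hx K. apply C1_nz. rewrite <- (Cinv_r x Hx), K. ring.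
Qed.

(** The half-plane map [z / (1 - z)] satisfies [q_alpha = 1 / (1 - z)] for every [alpha]. *)
Lemma extremal_half_plane : forall alpha lambda, exists f c,
  class_M alpha f /\ taylor_coefficients f c /\ Phi c lambda = (1 - lambda)%C.
Proof.
  intros alpha lambda.
  set (p := fun z : C => (/ (1 - z))%C).
  set (p' := fun z : C => (- (0 - 1) / ((1 - z) * (1 - z)))%C).
  assert (Hp : hol p p').
  { intros z Hz. apply (cdiff_inv (fun z => (1 - z)%C)); [|apply one_sub_neq_0, Hz].
    apply diff_minus; [apply diff_const|apply cdiff_id]. }
  assert (Hp0 : p 0 = 1) by (unfold p; field).
  assert (Hne : forall z, Cmod z < 1 -> p z <> 0).
  { intros z Hz. apply Cinv_neq_0, one_sub_neq_0, Hz. }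
  assert (HM : class_M alpha (fun z => (z * p z)%C)).
  { apply class_M_of_quotient with p'; try assumption.
    intros z Hz. pose proof (one_sub_neq_0 z Hz) as H1.
    replace (q_alpha alpha p p' z) with (/ (1 - z))%C.
    - eapply Rlt_le_trans; [|apply (Re_inv_1_sub z (Cmod z)); lra].
      pose proof (Cmod_ge_0 z). unfold Rdiv. rewrite Rmult_1_l. apply Rinv_lt_contravar; lra.
    - unfold q_alpha, p, p'. rewrite RtoC_minus. field. exact H1. }
  destruct (class_A_taylor _ (proj1 HM)) as [c Hc].
  exists (fun z => (z * p z)%C), c. split; [exact HM|]. split; [exact Hc|].
  assert (J := taylor_jet _ c p Hc (fun z => eq_refl)).
  assert (J' : jet p 1 1 1).
  { exists p. split.
    - apply bounded_inv with (RtoC 1); [|intros K; apply RtoC_inj in K; lra].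
      apply (tends_of_bounded _ (fun _ => (- (1))%C)); [bounded|]. intros; ring.
    - intros z _ Hz. unfold p. field. apply one_sub_neq_0, Hz. }
  destruct (jet_unique _ _ _ _ _ _ _ J J') as [_ [E2 E3]].
  unfold Phi. rewrite E2, E3. ring.
Qed.

(** For the second extremal function one wants [q_alpha = 1 / (1 - z^2)]. With
    [p = 1 / u] and [x = z^2] this is a linear differential equation for [u],
    solved by the power series [1 - \sum weight n x^(n+1)]; its weights are
    nonnegative with sum at most 1, and [excess N] is one minus their [N]-th partial sum. *)
Section Extremal.
Variable alpha : R.
Hypothesis Ha : 1 / 2 <= alpha <= 1.

Definition denom (n : nat) : R := 2 * (1 - alpha) * (INR n + 1) + alpha.

Fixpoint excess (n : nat) : R :=
  match n with O => 1 | S n => excess n - excess n / denom n end.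

Definition weight (n : nat) : R := excess n / denom n.

Fixpoint weighted_sum (n : nat) (x : C) : C :=
  match n with O => 0 | S n => (weighted_sum n x + RtoC (weight n) * x ^ S n)%C end.

Fixpoint weighted_sum' (n : nat) (x : C) : C :=
  match n with O => 0 | S n => (weighted_sum' n x + RtoC (weight n * (INR n + 1)) * x ^ n)%C end.

Lemma denom_ge_1 : forall n, 1 <= denom n.
Proof.
  intros n. unfold denom. pose proof (pos_INR n).
  assert (0 <= 2 * (1 - alpha) * INR n) by (apply Rmult_le_pos; lra). lra.
Qed.

Lemma excess_bounds : forall n, 0 <= excess n <= 1 /\ 0 <= weight n.
Proof.
  assert (H : forall n, 0 <= excess n -> 0 <= excess n / denom n <= excess n).
  { intros n Hn. pose proof (denom_ge_1 n) as Hd. split; [apply Rdiv_le_0_compat; lra|].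
    apply Rle_div_l; nra. }
  assert (Hn : forall n, 0 <= excess n <= 1).
  { induction n as [|n IH]; simpl; [lra|]. specialize (H n (proj1 IH)). lra. }
  intros n. split; [apply Hn|]. apply H, Hn.
Qed.

Lemma cdiff_pow : forall n x, cdiff (fun x => (x ^ S n)%C) x (RtoC (INR n + 1) * x ^ n)%C.
Proof.
  induction n as [|n IH]; intros x.
  - apply cdiff_ext with (fun x => x); [intros w; simpl; ring|].
    apply diff_val with (RtoC 1); [simpl; rewrite Rplus_0_l; ring|apply cdiff_id].
  - apply diff_val with (1 * x ^ S n + x * (RtoC (INR n + 1) * x ^ n))%C.
    + rewrite S_INR, !RtoC_plus. simpl. ring.
    + apply (cdiff_mult (fun x => x) (fun x => (x ^ S n)%C)); [apply cdiff_id|apply IH].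
Qed.

Lemma weighted_sum_cdiff : forall n x, cdiff (weighted_sum n) x (weighted_sum' n x).
Proof.
  induction n as [|n IH]; intros x; [apply diff_const|].
  change (cdiff (fun x => (weighted_sum n x + RtoC (weight n) * x ^ S n)%C) x
    (weighted_sum' n x + RtoC (weight n * (INR n + 1)) * x ^ n)%C).
  apply diff_plus; [apply IH|].
  eapply diff_val; [|apply diff_scal, cdiff_pow]. rewrite RtoC_mult. ring.
Qed.

Lemma weighted_sum_bound : forall n x, Cmod x <= 1 -> Cmod (weighted_sum n x) <= (1 - excess n) * Cmod x.
Proof.
  induction n as [|n IH]; intros x Hx.
  - simpl. rewrite Cmod_0. lra.
  - change (excess (S n)) with (excess n - weight n).
    change (weighted_sum (S n) x) with (weighted_sum n x + RtoC (weight n) * x ^ S n)%C.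
    eapply Rle_trans; [apply Cmod_triangle|]. specialize (IH x Hx).
    destruct (excess_bounds n) as [_ Hw].
    rewrite Cmod_mult, Cmod_R, Rabs_pos_eq, Cmod_pow by exact Hw.
    assert (Hp : Cmod x ^ S n <= Cmod x).
    { simpl. pose proof (Cmod_ge_0 x) as P.
      assert (Cmod x ^ n <= 1) by (rewrite <- (pow1 n); apply pow_incr; lra). nra. }
    assert (weight n * Cmod x ^ S n <= weight n * Cmod x) by (apply Rmult_le_compat_l; assumption). lra.
Qed.

(** The truncation error of the differential equation is the single monomial
    [excess N x^(N+1)]. *)
Lemma weighted_sum_equation : forall n x,
  ((1 - x) * (RtoC alpha + RtoC (1 - alpha) * ((1 - weighted_sum n x) + 2 * x * weighted_sum' n x)))%C
  = (1 - weighted_sum n x - RtoC (excess n) * x ^ S n)%C.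
Proof.
  induction n as [|n IH]; intros x.
  - simpl. rewrite RtoC_minus. ring.
  - pose proof (denom_ge_1 n) as Hd.
    assert (E1 : excess n = weight n * denom n) by (unfold weight; field; lra).
    assert (E2 : excess (S n) = weight n * (denom n - 1)).
    { change (excess (S n)) with (excess n - weight n). rewrite E1. ring. }
    specialize (IH x). rewrite E1 in IH. rewrite E2.
    change (weighted_sum (S n) x) with (weighted_sum n x + RtoC (weight n) * x ^ S n)%C.
    change (weighted_sum' (S n) x) with (weighted_sum' n x + RtoC (weight n * (INR n + 1)) * x ^ n)%C.
    change (x ^ S (S n))%C with (x * x ^ S n)%C. change (x ^ S n)%C with (x * x ^ n)%C in *.
    replace ((1 - x) * (RtoC alpha + RtoC (1 - alpha) * (1 - (weighted_sum n x + RtoC (weight n) * (x * x ^ n)) +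
        2 * x * (weighted_sum' n x + RtoC (weight n * (INR n + 1)) * x ^ n))))%C
      with ((1 - x) * (RtoC alpha + RtoC (1 - alpha) * (1 - weighted_sum n x + 2 * x * weighted_sum' n x))
        + (1 - x) * RtoC (1 - alpha) * RtoC (weight n) * (x * x ^ n) * (2 * RtoC (INR n + 1) - 1))%C
      by (rewrite RtoC_mult; ring).
    rewrite IH. unfold denom.
    repeat (rewrite RtoC_mult || rewrite RtoC_minus || rewrite RtoC_plus). ring.
Qed.

Lemma weighted_sum_jet : forall rho n, jet (fun z => weighted_sum (S n) (RtoC rho * (z * z))%C) 0 0 (RtoC (weight 0 * rho)).
Proof.
  intros rho n. induction n as [|n IH].
  - exists (fun _ => 0). split; [bounded|]. intros z _ _. simpl. rewrite RtoC_mult. ring.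
  - assert (Hb : forall r m, bounded_near_0 r -> bounded_near_0 (fun z => (r z ^ m)%C)).
    { intros r m Hr. induction m as [|m IHm]; simpl; bounded. }
    assert (J : jet (fun z => (RtoC (weight (S n)) * (RtoC rho * (z * z)) ^ S (S n))%C) 0 0 0).
    { exists (fun z => (RtoC (weight (S n)) * (RtoC rho * RtoC rho * z * (RtoC rho * (z * z)) ^ n))%C).
      split; [bounded; apply Hb; bounded|]. intros z _ _.
      generalize (RtoC (weight (S n))). intros v. simpl. ring. }
    assert (K := jet_plus _ _ _ _ _ _ _ _ IH J). revert K. apply jet_val; ring.
Qed.

(** The solution truncated at a high order and dilated by [rho < 1] still has
    [Re q > 1 / 2], since its error is at most a constant depending on [rho] times [rho^(N+1)]. Its
    third coefficient tends to that of the extremal function as [rho] tends to [1]. *)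
Lemma extremal_odd : forall rho lambda, 0 < rho < 1 -> exists f c,
  class_M alpha f /\ taylor_coefficients f c /\ Phi c lambda = RtoC (rho / (2 - alpha)).
Proof.
  intros rho lambda Hrho.
  set (eps := (1 - rho) ^ 3 / (2 * (1 + rho))).
  assert (Heps : 0 < eps) by (apply Rdiv_lt_0_compat; [apply pow_lt|]; lra).
  destruct (pow_lt_1_zero rho) with (y := eps) as [N HN]; [rewrite Rabs_pos_eq; lra|exact Heps|].
  set (n := S N).
  assert (Hpow : rho ^ S n < eps).
  { specialize (HN (S n) ltac:(unfold n; lia)). rewrite Rabs_pos_eq in HN by (apply pow_le; lra). exact HN. }
  set (X := fun z : C => (RtoC rho * (z * z))%C).
  assert (HX : forall z, Cmod z < 1 -> Cmod (X z) <= rho).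
  { intros z Hz. unfold X. rewrite !Cmod_mult, Cmod_R, Rabs_pos_eq by lra. pose proof (Cmod_ge_0 z).
    assert (Cmod z * Cmod z <= 1) by nra. nra. }
  set (u := fun z => (1 - weighted_sum n (X z))%C).
  assert (HW : forall z, Cmod z < 1 -> Cmod (weighted_sum n (X z)) <= rho).
  { intros z Hz. specialize (HX z Hz). destruct (excess_bounds n) as [He _].
    eapply Rle_trans; [apply weighted_sum_bound; lra|].
    assert (0 <= excess n * Cmod (X z)) by (apply Rmult_le_pos; [lra|apply Cmod_ge_0]). lra. }
  assert (Hu : forall z, Cmod z < 1 -> u z <> 0).
  { intros z Hz. apply one_sub_neq_0. specialize (HW z Hz). lra. }
  set (u' := fun z => (0 - weighted_sum' n (X z) * (RtoC rho * (1 * z + z * 1)))%C).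
  assert (Du : forall z, cdiff u z (u' z)).
  { intros z. apply diff_minus; [apply diff_const|].
    apply (cdiff_comp (weighted_sum n) X); [apply weighted_sum_cdiff|]. apply diff_scal.
    apply (cdiff_mult (fun z => z) (fun z => z)); apply cdiff_id. }
  set (p := fun z => (/ u z)%C). set (p' := fun z => (- u' z / (u z * u z))%C).
  assert (Hp : hol p p') by (intros z Hz; apply cdiff_inv; [apply Du|apply Hu, Hz]).
  assert (EW0 : forall m, weighted_sum m 0 = 0).
  { induction m as [|m IH]; [reflexivity|]. simpl. rewrite IH. ring. }
  assert (Hp0 : p 0 = 1).
  { unfold p, u, X. replace (RtoC rho * (0 * 0))%C with (RtoC 0) by ring. rewrite EW0. field. }
  assert (HM : class_M alpha (fun z => (z * p z)%C)).
  { apply class_M_of_quotient with p'; try assumption.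
    { intros z Hz. apply Cinv_neq_0, Hu, Hz. }
    intros z Hz. specialize (HX z Hz). pose proof (Hu z Hz) as Huz.
    pose proof (one_sub_neq_0 (X z) ltac:(lra)) as H1.
    set (err := (RtoC (excess n) * X z ^ S n / ((1 - X z) * u z))%C).
    assert (Eq : q_alpha alpha p p' z = (/ (1 - X z) - err)%C).
    { assert (E := weighted_sum_equation n (X z)). fold (u z) in E.
      assert (Eq1 : q_alpha alpha p p' z =
        ((RtoC alpha + RtoC (1 - alpha) * (u z + 2 * X z * weighted_sum' n (X z))) / u z)%C).
      { unfold q_alpha, p, p', u', X. field. exact Huz. }
      rewrite Eq1. unfold err.
      replace ((RtoC alpha + RtoC (1 - alpha) * (u z + 2 * X z * weighted_sum' n (X z))) / u z)%C
        with ((1 - X z) * (RtoC alpha + RtoC (1 - alpha) * (u z + 2 * X z * weighted_sum' n (X z))) / ((1 - X z) * u z))%C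
        by (field; auto).
      rewrite E. field. auto. }
    rewrite Eq. change (1 / 2 < Re (/ (1 - X z)) - Re err).
    assert (R1 := Re_inv_1_sub (X z) rho HX ltac:(lra)).
    assert (L1 : 1 - rho <= Cmod (1 - X z)).
    { pose proof (Cmod_triangle_inv 1 (X z)) as Q. rewrite Cmod_1 in Q. lra. }
    assert (L2 : 1 - rho <= Cmod (u z)).
    { pose proof (Cmod_triangle_inv 1 (weighted_sum n (X z))) as Q. rewrite Cmod_1 in Q. specialize (HW z Hz).
      unfold u. lra. }
    assert (R2 : Cmod err < (1 - rho) / (2 * (1 + rho))).
    { unfold err. rewrite Cmod_div by (apply Cmult_neq_0; assumption).
      rewrite !Cmod_mult, Cmod_pow, Cmod_R. destruct (excess_bounds n) as [He _].
      rewrite Rabs_pos_eq by lra.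
      assert (Pd : (1 - rho) * (1 - rho) <= Cmod (1 - X z) * Cmod (u z)) by (apply Rmult_le_compat; lra).
      assert (P0 : 0 < (1 - rho) * (1 - rho)) by (apply Rmult_lt_0_compat; lra).
      apply Rmult_lt_reg_r with (Cmod (1 - X z) * Cmod (u z)); [lra|].
      unfold Rdiv at 1. rewrite Rmult_assoc, Rinv_l, Rmult_1_r by lra.
      apply Rlt_le_trans with eps.
      - apply Rle_lt_trans with (rho ^ S n); [|exact Hpow].
        rewrite <- (Rmult_1_l (rho ^ S n)). apply Rmult_le_compat; try lra.
        + apply pow_le, Cmod_ge_0.
        + apply pow_incr. split; [apply Cmod_ge_0|exact HX].
      - replace eps with ((1 - rho) / (2 * (1 + rho)) * ((1 - rho) * (1 - rho))) by (unfold eps; field; lra).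
        apply Rmult_le_compat_l; [apply Rdiv_le_0_compat; lra|exact Pd]. }
    pose proof (Re_le_Cmod err) as R3.
    assert (/ (1 + rho) = 1 / 2 + (1 - rho) / (2 * (1 + rho))) by (field; lra). lra. }
  destruct (class_A_taylor _ (proj1 HM)) as [c Hc].
  exists (fun z => (z * p z)%C), c. split; [exact HM|]. split; [exact Hc|].
  assert (J := taylor_jet _ c p Hc (fun z => eq_refl)).
  assert (Ju : jet u 1 0 (- RtoC (weight 0 * rho))).
  { assert (K := jet_plus _ _ _ _ _ _ _ _ (jet_const 1) (jet_scal (- (1))%C _ _ _ _ (weighted_sum_jet rho N))).
    eapply jet_ext; [|eapply jet_val; [| | |exact K]]; try ring.
    intros z _ _. unfold u, n, X. ring. }
  assert (J' := jet_inv u _ _ (fun z _ Hz => Hu z Hz) Ju).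
  destruct (jet_unique _ _ _ _ _ _ _ J J') as [_ [E2 E3]].
  unfold Phi. rewrite E2, E3.
  replace (rho / (2 - alpha)) with (weight 0 * rho).
  - ring.
  - unfold weight, denom. simpl. field. lra.
Qed.

End Extremal.

Lemma fekete_szego : forall alpha : R, 1 / 2 <= alpha <= 1 -> forall lambda : C,
  is_lub
    (fun r : R => exists (f : C -> C) (c : nat -> C),
       class_M alpha f /\ taylor_coefficients f c /\ r = Cmod (Phi c lambda))
    (Rmax (1 / (2 - alpha)) (Cmod (1 - lambda)%C)).
Proof.
  intros alpha Ha lambda. split.
  - intros r [f [c [HM [Hc ->]]]]. apply fekete_szego_upper with f; assumption.
  - intros b Hb. apply Rmax_lub.
    + apply Rnot_lt_le. intros K.
      assert (H2 : 0 < 1 / (2 - alpha)) by (apply Rdiv_lt_0_compat; lra).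
      set (rho := (1 + Rmax 0 (b * (2 - alpha))) / 2).
      assert (Hm : Rmax 0 (b * (2 - alpha)) < 1).
      { apply Rmax_case; [lra|]. apply Rmult_lt_reg_r with (/ (2 - alpha)); [apply Rinv_0_lt_compat; lra|].
        rewrite Rmult_assoc, Rinv_r by lra. lra. }
      pose proof (Rmax_l 0 (b * (2 - alpha))) as M1. pose proof (Rmax_r 0 (b * (2 - alpha))) as M2.
      destruct (extremal_odd alpha Ha rho lambda) as [f [c [HM [Hc E]]]]; [unfold rho; lra|].
      assert (Q : rho / (2 - alpha) <= b).
      { apply Hb. exists f, c. split; [exact HM|]. split; [exact Hc|].
        rewrite E, Cmod_R, Rabs_pos_eq; [reflexivity|]. apply Rdiv_le_0_compat; unfold rho; lra. }
      apply Rmult_le_compat_r with (r := 2 - alpha) in Q; [|lra].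
      unfold Rdiv in Q. rewrite Rmult_assoc, Rinv_l in Q by lra. unfold rho in Q. lra.
    + destruct (extremal_half_plane alpha lambda) as [f [c [HM [Hc E]]]].
      apply Hb. exists f, c. split; [exact HM|]. split; [exact Hc|]. rewrite E. reflexivity.
Qed.

(** * The theorem *)

Theorem theorem4p2 :
  (forall alpha : R, 1 / 2 <= alpha < 2 ->
     forall f : C -> C, class_M alpha f -> class_G f) /\
  (forall alpha : R, 1 / 2 <= alpha <= 1 ->
     forall f : C -> C, class_M alpha f ->
     exists F : R -> C -> C,
       generates f F /\ semigroup_of_self_maps F /\
       forall (z : C) (t : R), in_disk z -> 0 < t ->
         Cmod (F t z) <= exp ((1 - 2 * alpha) / (2 * alpha) * t) * Cmod z) /\
  is_filtration_of_G (Finite (1 / 2)) (Finite 1)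
    (fun s : Rbar => class_M (real s)) /\
  (forall f : C -> C, class_M 1 f <-> class_A_half f) /\
  ((forall f : C -> C, class_A_half f -> class_G f) /\
   (exists f : C -> C, class_G f /\ ~ class_A_half f)) /\
  (forall alpha : R, 1 / 2 <= alpha <= 1 -> forall lambda : C,
     is_lub
       (fun r : R => exists (f : C -> C) (c : nat -> C),
          class_M alpha f /\ taylor_coefficients f c /\
          r = Cmod (Phi c lambda))
       (Rmax (1 / (2 - alpha)) (Cmod (1 - lambda)%C))).
Proof.
  split; [intros alpha Ha f; exact (class_M_sub_G alpha f Ha)|].
  split; [intros alpha Ha f; exact (class_M_semigroup alpha f Ha)|].
  split; [exact filtration|]. split; [exact class_M_1|].
  split; [|exact fekete_szego].
  split; [exact class_A_half_sub_G|exact class_A_half_proper].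
Qed.
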